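(* Let $\alpha>0$. Suppose that $\mu$ is a positive Borel measure on $\mathbb H$ satisfying $$\int_{\mathbb H}|K_\alpha(z,w)|^2\,e^{-\alpha|w|^2}\,d\mu(w)<\infty\qquad\text{for all } z\in\mathbb H,$$ and that $\mu^1:=\mu|_{\mathbb H\setminus\mathbb R}$ is a Radon measure on $\mathbb H\setminus\mathbb R$. Then the following are equivalent: (a) $T_\mu$ is bounded on $F_\alpha^2$; (b) the function $$z\longmapsto\int_{\mathbb H}\left|k_z(w)e^{-\frac{\alpha}{2}|w|^2}\right|^2\,d\mu(w)$$ is bounded on $\mathbb H$; (c) $\widehat\mu_r$ is bounded on $\mathbb H$ for some, equivalently for every, $r>0$.
   Context: $\mathbb H$ denotes the quaternions, $\mathbb S=\{I\in\mathbb H: I^2=-1\}$, $\mathbb C_I=\{x+yI:x,y\in\mathbb R\}$ for $I\in\mathbb S$, and $m_{2,I}$ is Lebesgue measure on $\mathbb C_I$. A (left) slice function is $f:\mathbb H\to\mathbb H$ of the form $f(x+yI)=f_0(x,y)+If_1(x,y)$ for all $x,y\in\mathbb R$, $I\in\mathbb S$, where $f_0,f_1:\mathbb R^2\to\mathbb H$ satisfy $f_0(x,-y)=f_0(x,y)$ and $f_1(x,-y)=-f_1(x,y)$. It is slice regular if moreover $f_0,f_1$ are $C^1$ and $\partial_xf_0-\partial_yf_1=0$, $\partial_yf_0+\partial_xf_1=0$. Measure $dV$: every non-real quaternion is uniquely $x+yI$ with $I\in\mathbb S$, $y>0$, so $\mathbb H\setminus\mathbb R\cong\mathbb S\times\mathbb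 C^+$ (with $\mathbb C^+$ the open upper half plane), and $dV(x+yI)=dm_{2,I}(x+yI)\,d\sigma(I)$, where $\sigma$ is the normalized surface measure on $\mathbb S$; the real axis has $dV$-measure $0$. Put $d\lambda_\alpha(z)=\frac{2\alpha}{\pi}e^{-\alpha|z|^2}dV(z)$. The global quaternionic Fock space $F_\alpha^2$ is the space of slice regular $f$ on $\mathbb H$ with $\|f\|_{2,\alpha}^2=\int_{\mathbb H}|f|^2\,d\lambda_\alpha<\infty$, a right quaternionic Hilbert space with $\langle f,g\rangle_\alpha=\int_{\mathbb H}\overline{g}\,f\,d\lambda_\alpha$. Its reproducing kernel is $K_\alpha(z,w)=\sum_{n\ge0}\frac{\alpha^n}{n!}z^n\overline w^{\,n}$, and the normalized kernel is $k_z(w)=K_\alpha(w,z)e^{-\alpha|z|^2/2}$. Toeplitz operator: let $\mathcal D$ be the dense subspace of $F_\alpha^2$ of finite sums $\sum_k K_\alpha(\cdot,a_k)c_k$ with $a_k,c_k\in\mathbb H$. $T_\mu$ is initially defined on $\mathcal D$ by $T_\mu g(z)=\int_{\mathbb H}K_\alpha(z,w)g(w)e^{-\alpha|w|^2}\,d\mu(w)$; ''$T_\mu$ is bounded on $F_\alpha^2$'' means that it extends from $\mathcal D$ to a bounded operator on $F_\alpha^2$. Symmetric boxes: for $z=x+yJ\in\mathbb H$ with $y\ge0$, $J\in\mathbb S$, and $r>0$, put $z_I=x+yI$ and $S(z,r)=\bigcup_{I\in\mathbb S}B_I(z_I,r)$, where $B_I(z_I,r)$ is the Euclidean disk in $\mathbb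 C_I$ with center $z_I$ and radius $r$. Put $\widehat\mu_r(z)=\mu(S(z,r))/(\pi r^2)$. *)

(* Defs.v *)
From HB Require Import structures.
From mathcomp Require Import all_boot all_order all_algebra.
From mathcomp Require Import all_classical all_reals all_analysis.
From mathcomp Require Import measurable_realfun ring lra.

Set Implicit Arguments.
Unset Strict Implicit.
Unset Printing Implicit Defensive.

Import Order.TTheory GRing.Theory Num.Theory.
Import numFieldNormedType.Exports.

Local Open Scope classical_set_scope.
Local Open Scope ring_scope.

Record quat (R : Type) := Quat { q0 : R; q1 : R; q2 : R; q3 : R }.

Section QuatAlgebra.
Variable R : realType.
Local Notation H := (quat R).
Implicit Types p q : H.

Definition quat_tuple q := (q0 q, q1 q, q2 q, q3 q).
Definition tuple_quat (t : R * R * R * R) : H :=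
  Quat t.1.1.1 t.1.1.2 t.1.2 t.2.

Lemma quat_tupleK : cancel quat_tuple tuple_quat.
Proof. by case. Qed.

HB.instance Definition _ := Choice.copy H (can_type quat_tupleK).

Lemma quat_eq p q :
  q0 p = q0 q -> q1 p = q1 q -> q2 p = q2 q -> q3 p = q3 q -> p = q.
Proof. by case: p => ????; case: q => ???? /= -> -> -> ->. Qed.

Definition qzero : H := Quat 0 0 0 0.
Definition qone : H := Quat 1 0 0 0.
Definition qopp p : H := Quat (- q0 p) (- q1 p) (- q2 p) (- q3 p).
Definition qadd p q : H :=
  Quat (q0 p + q0 q) (q1 p + q1 q) (q2 p + q2 q) (q3 p + q3 q).
Definition qscale (a : R) p : H :=
  Quat (a * q0 p) (a * q1 p) (a * q2 p) (a * q3 p).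
Definition qmul p q : H :=
  Quat (q0 p * q0 q - q1 p * q1 q - q2 p * q2 q - q3 p * q3 q)
       (q0 p * q1 q + q1 p * q0 q + q2 p * q3 q - q3 p * q2 q)
       (q0 p * q2 q - q1 p * q3 q + q2 p * q0 q + q3 p * q1 q)
       (q0 p * q3 q + q1 p * q2 q - q2 p * q1 q + q3 p * q0 q).

Lemma qaddA : associative qadd.
Proof. by move=> p q r; apply: quat_eq; rewrite /= addrA. Qed.
Lemma qaddC : commutative qadd.
Proof. by move=> p q; apply: quat_eq; rewrite /= addrC. Qed.
Lemma qadd0 : left_id qzero qadd.
Proof. by move=> p; apply: quat_eq; rewrite /= add0r. Qed.
Lemma qaddN : left_inverse qzero qopp qadd.
Proof. by move=> p; apply: quat_eq; rewrite /= addNr. Qed.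

HB.instance Definition _ := GRing.isZmodule.Build H qaddA qaddC qadd0 qaddN.

Lemma qmulA : associative qmul.
Proof. by move=> p q r; apply: quat_eq => /=; ring. Qed.
Lemma qmul1l : left_id qone qmul.
Proof. by move=> p; apply: quat_eq => /=; ring. Qed.
Lemma qmul1r : right_id qone qmul.
Proof. by move=> p; apply: quat_eq => /=; ring. Qed.
Lemma qmulDl : left_distributive qmul qadd.
Proof. by move=> p q r; apply: quat_eq => /=; ring. Qed.
Lemma qmulDr : right_distributive qmul qadd.
Proof. by move=> p q r; apply: quat_eq => /=; ring. Qed.
Lemma qone_neq0 : qone != qzero.
Proof. by apply/eqP => -[] /eqP; rewrite oner_eq0. Qed.

HB.instance Definition _ := GRing.Zmodule_isNzRing.Build H
  qmulA qmul1l qmul1r qmulDl qmulDr qone_neq0.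

Lemma qscaleA a b p : qscale a (qscale b p) = qscale (a * b) p.
Proof. by apply: quat_eq; rewrite /= mulrA. Qed.
Lemma qscale1 : left_id 1 qscale.
Proof. by move=> p; apply: quat_eq; rewrite /= mul1r. Qed.
Lemma qscaleDr : right_distributive qscale +%R.
Proof. by move=> a p q; apply: quat_eq; rewrite /= mulrDr. Qed.
Lemma qscaleDl p : {morph qscale^~ p : a b / a + b}.
Proof. by move=> a b; apply: quat_eq; rewrite /= mulrDl. Qed.

HB.instance Definition _ := GRing.Zmodule_isLmodule.Build R H
  qscaleA qscale1 qscaleDr qscaleDl.

Lemma qscaleAl (a : R) p q : a *: (p * q) = a *: p * q.
Proof. by apply: quat_eq => /=; ring. Qed.
HB.instance Definition _ := GRing.Lmodule_isLalgebra.Build R H qscaleAl.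
Lemma qscaleAr (a : R) p q : a *: (p * q) = p * (a *: q).
Proof. by apply: quat_eq => /=; ring. Qed.
HB.instance Definition _ := GRing.Lalgebra_isAlgebra.Build R H qscaleAr.

Definition qconj p : H := Quat (q0 p) (- q1 p) (- q2 p) (- q3 p).

Definition qnorm p : R :=
  Num.sqrt (q0 p ^+ 2 + q1 p ^+ 2 + q2 p ^+ 2 + q3 p ^+ 2).

Lemma qnorm_sqr p :
  qnorm p ^+ 2 = q0 p ^+ 2 + q1 p ^+ 2 + q2 p ^+ 2 + q3 p ^+ 2.
Proof. by rewrite sqr_sqrtr// !addr_ge0// sqr_ge0. Qed.

Lemma qnormD p q : qnorm (p + q) <= qnorm p + qnorm q.
Proof.
have p0 : 0 <= qnorm p by exact: sqrtr_ge0.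
have r0 : 0 <= qnorm q by exact: sqrtr_ge0.
have pq0 : 0 <= qnorm p * qnorm q by exact: mulr_ge0.
pose s := q0 p * q0 q + q1 p * q1 q + q2 p * q2 q + q3 p * q3 q.
have cs : s <= qnorm p * qnorm q.
  have [s0|s0] := leP s 0; first exact: le_trans s0 pq0.
  rewrite -(@ler_pXn2r _ 2) ?nnegrE ?(ltW s0)// exprMn !qnorm_sqr -subr_ge0.
  rewrite [leRHS](_ : _ = (q0 p * q1 q - q1 p * q0 q) ^+ 2
    + (q0 p * q2 q - q2 p * q0 q) ^+ 2 + (q0 p * q3 q - q3 p * q0 q) ^+ 2
    + (q1 p * q2 q - q2 p * q1 q) ^+ 2 + (q1 p * q3 q - q3 p * q1 q) ^+ 2
    + (q2 p * q3 q - q3 p * q2 q) ^+ 2); last by rewrite /s; ring.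
  by rewrite !addr_ge0// sqr_ge0.
rewrite -(@ler_pXn2r _ 2) ?nnegrE ?addr_ge0 ?sqrtr_ge0//.
rewrite sqrrD !qnorm_sqr -subr_ge0.
rewrite [leRHS](_ : _ = (qnorm p * qnorm q - s) *+ 2); last by rewrite /s /=; ring.
by rewrite mulrn_wge0// subr_ge0.
Qed.

Lemma qnormZ (a : R) p : qnorm (a *: p) = `|a| * qnorm p.
Proof.
rewrite /qnorm /= !exprMn -!mulrDr sqrtrM ?sqr_ge0//.
by rewrite sqrtr_sqr.
Qed.

Lemma qnorm0_eq0 p : qnorm p = 0 -> p = 0.
Proof.
move=> p0; have /esym/eqP := qnorm_sqr p; rewrite p0 expr0n/=.
rewrite !paddr_eq0 ?addr_ge0 ?sqr_ge0// !sqrf_eq0 => /andP[/andP[/andP[]]].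
by move=> /eqP ? /eqP ? /eqP ? /eqP ?; exact: quat_eq.
Qed.

HB.instance Definition _ := Lmodule_isNormed.Build R H qnormD qnormZ qnorm0_eq0.

HB.instance Definition _ := Measurable.copy H (g_sigma_algebraType (@open H)).

End QuatAlgebra.

Section Slices.
Variable R : realType.
Local Notation H := (quat R).

Definition unit_imag : set H := [set I | I ^+ 2 = -1].

Definition real_axis : set H := range (fun x : R => x%:A).

Definition slice_pt (x y : R) (I : H) : H := x%:A + y *: I.

Definition slice_plane (I : H) : set H :=
  [set slice_pt p.1 p.2 I | p in [set: R * R]].

Definition C1_fun (f : R * R -> H) :=
  [/\ forall p, derivable f p (1, 0), continuous ('D_(1, 0) f),
      forall p, derivable f p (0, 1) & continuous ('D_(0, 1) f)].

Definition slice_regular (f : H -> H) :=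
  exists f0 f1 : R * R -> H,
  [/\ forall x y I, unit_imag I -> f (slice_pt x y I) = f0 (x, y) + I * f1 (x, y),
      forall x y, f0 (x, - y) = f0 (x, y) /\ f1 (x, - y) = - f1 (x, y),
      C1_fun f0 /\ C1_fun f1 &
      forall p, 'D_(1, 0) f0 p - 'D_(0, 1) f1 p = 0 /\
                'D_(0, 1) f0 p + 'D_(1, 0) f1 p = 0].

Definition im_norm (z : H) : R := `|z - (q0 z)%:A|.

Definition slice_disk (I c : H) (r : R) : set H :=
  slice_plane I `&` [set w | `|w - c| < r].

(* [z = x + y J] with [y >= 0] and [J ^+ 2 = -1] forces [x = q0 z] and
   [y = im_norm z]. *)
Definition sym_box (z : H) (r : R) : set H :=
  \bigcup_(I in unit_imag) slice_disk I (slice_pt (q0 z) (im_norm z) I) r.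

End Slices.

Section VolumeMeasure.
Variable R : realType.
Local Notation H := (quat R).

Lemma coord_lip (k : H -> R) : (forall p q, k (p - q) = k p - k q) ->
  (forall p, `|k p| <= `|p|) -> measurable_fun [set: H] k.
Proof.
move=> kB kle; have kc : continuous k.
  move=> p; apply/(@cvgrPdist_lt _ _ _ (nbhs p)) => e e0.
  apply/nbhs_ballP; exists e => //= q; rewrite /ball/= => pq.
  by rewrite -kB (le_lt_trans (kle _)).
apply: (measurability _ (RGenOpens.measurableE R)) => /=.
move=> _ [_ [a [b ->]] <-].
rewrite setTI; apply: sub_sigma_algebra.
by apply: open_comp; [move=> p _; exact: kc|exact: interval_open].
Qed.

Lemma le_qnorm (p : H) (x : R) : x ^+ 2 <= `|p| ^+ 2 -> `|x| <= `|p|.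
Proof.
by move=> h; rewrite -(@ler_pXn2r _ 2) ?nnegrE// real_normK ?num_real.
Qed.

Lemma qnormE2 (p : H) :
  `|p| ^+ 2 = q0 p ^+ 2 + q1 p ^+ 2 + q2 p ^+ 2 + q3 p ^+ 2.
Proof. exact: qnorm_sqr. Qed.

Lemma measurable_q0 : measurable_fun [set: H] (@q0 R).
Proof.
by apply: coord_lip => // p; apply: le_qnorm; rewrite qnormE2 -!addrA lerDl
  !addr_ge0// sqr_ge0.
Qed.

Lemma measurable_q1 : measurable_fun [set: H] (@q1 R).
Proof.
by apply: coord_lip => // p; apply: le_qnorm; rewrite qnormE2 addrAC -!addrA
  addrCA lerDl !addr_ge0// sqr_ge0.
Qed.

Lemma measurable_q2 : measurable_fun [set: H] (@q2 R).
Proof.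
by apply: coord_lip => // p; apply: le_qnorm; rewrite qnormE2 addrAC lerDr
  !addr_ge0// sqr_ge0.
Qed.

Lemma measurable_q3 : measurable_fun [set: H] (@q3 R).
Proof.
by apply: coord_lip => // p; apply: le_qnorm; rewrite qnormE2 lerDr !addr_ge0//
  sqr_ge0.
Qed.

Lemma measurable_quat d (T : measurableType d) (g : T -> H) :
  measurable_fun setT (@q0 R \o g) -> measurable_fun setT (@q1 R \o g) ->
  measurable_fun setT (@q2 R \o g) -> measurable_fun setT (@q3 R \o g) ->
  measurable_fun [set: T] g.
Proof.
move=> m0 m1 m2 m3.
pose box (c : rat * rat * rat * rat * nat) : set H :=
  [set p | [/\ `|q0 p - ratr c.1.1.1.1| < c.2.+1%:R^-1,
               `|q1 p - ratr c.1.1.1.2| < c.2.+1%:R^-1,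
               `|q2 p - ratr c.1.1.2| < c.2.+1%:R^-1 &
               `|q3 p - ratr c.1.2| < c.2.+1%:R^-1]].
have mbox c : measurable (g @^-1` box c).
  have mk (k : H -> R) (a e : R) : 0 < e -> measurable_fun setT (k \o g) ->
      measurable (g @^-1` [set p | `|k p - a| < e]).
    move=> e0 mk; have -> : g @^-1` [set p | `|k p - a| < e] =
        setT `&` (k \o g) @^-1` (ball a e).
      by rewrite setTI; apply/seteqP; split => t /=; rewrite /ball/= distrC.
    by apply: mk => //; apply: open_measurable; exact: ball_open.
  rewrite [X in measurable X](_ : _ =
    (g @^-1` [set p | `|q0 p - ratr c.1.1.1.1| < c.2.+1%:R^-1]) `&`
    (g @^-1` [set p | `|q1 p - ratr c.1.1.1.2| < c.2.+1%:R^-1]) `&`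
    (g @^-1` [set p | `|q2 p - ratr c.1.1.2| < c.2.+1%:R^-1]) `&`
    (g @^-1` [set p | `|q3 p - ratr c.1.2| < c.2.+1%:R^-1])).
    by do ![apply: measurableI]; apply: mk => //; rewrite invr_gt0.
  by apply/seteqP; split => t /= => [[]|[[[]]]].
apply: (@measurability _ _ _ _ _ _ (@open H)) => //.
move=> _ [U oU <-]; rewrite setTI.
rewrite [X in measurable X](_ : _ = \bigcup_(c in [set c | box c `<=` U])
   (g @^-1` box c)); last first.
  apply/seteqP; split=> [t /= Ut|t [c /= cU gt]]; last exact: cU.
  have [e /= e0 eU] : exists2 e : R, 0 < e & ball (g t) e `<=` U.
    by move/nbhs_ballP : (open_nbhs_nbhs (conj oU Ut)).
  have [n n4] : exists n : nat, n.+1%:R^-1 < e / 4.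
    have e4 : 0 < e / 4 by exact: divr_gt0.
    near \oo => n; exists n; near: n; exact: near_infty_natSinv_lt (PosNum e4).
  have i0 : 0 < (n.+1%:R^-1 : R) by rewrite invr_gt0.
  have rx (x : R) : exists q : rat, `|x - ratr q| < n.+1%:R^-1.
    have [q] : exists q, ratr q \in `]x - n.+1%:R^-1, x + n.+1%:R^-1[.
      by apply: rat_in_itvoo; rewrite ltrD2l gtrN.
    by rewrite in_itv/= => ?; exists q; rewrite ltr_distlC.
  have [a ha] := rx (q0 (g t)); have [b hb] := rx (q1 (g t)).
  have [c hc] := rx (q2 (g t)); have [d' hd] := rx (q3 (g t)).
  exists (a, b, c, d', n) => //= p [/= pa pb pc pd]; apply: eU.
  rewrite -ball_normE/= -(@ltr_pXn2r _ 2) ?nnegrE ?(ltW e0)// qnormE2/=.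
  have tri (x y r : R) : `|x - r| < n.+1%:R^-1 -> `|y - r| < n.+1%:R^-1 ->
      (x - y) ^+ 2 < e ^+ 2 / 4.
    move=> xr yr; have : `|x - y| < e / 2.
      rewrite (_ : x - y = (x - r) - (y - r)); last by ring.
      rewrite (le_lt_trans (ler_normB _ _))//.
      by move: xr yr n4; move: (n.+1%:R^-1) => i; lra.
    have -> : e ^+ 2 / 4 = (e / 2) ^+ 2 by field.
    rewrite -(@ltr_pXn2r _ 2) ?nnegrE ?divr_ge0 ?(ltW e0)//.
    by rewrite real_normK ?num_real.
  have := tri _ _ _ ha pa; have := tri _ _ _ hb pb.
  by have := tri _ _ _ hc pc; have := tri _ _ _ hd pd; lra.
rewrite bigcup_mkcond; apply: countable_bigcupT_measurable => // c.
by case: ifPn => // _; exact: mbox.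
Unshelve. all: end_near. Qed.

Local Notation mR := (measurableTypeR R).
Local Notation leb := (@lebesgue_measure R).

Lemma measurable_slice_pt :
  measurable_fun [set: H * (mR * mR)] (fun u => slice_pt u.2.1 u.2.2 u.1).
Proof.
have m21 : measurable_fun [set: H * (mR * mR)] (fun u => u.2.1).
  by apply: (measurableT_comp measurable_fst); exact: measurable_snd.
have m22 : measurable_fun [set: H * (mR * mR)] (fun u => u.2.2).
  by apply: (measurableT_comp measurable_snd); exact: measurable_snd.
have mk (k : H -> R) : measurable_fun setT k ->
    measurable_fun [set: H * (mR * mR)] (fun u => u.2.2 * k u.1).
  move=> mk; apply: measurable_funM => //.
  by apply: (measurableT_comp mk); exact: measurable_fst.
apply: measurable_quat; rewrite /comp/=; apply: measurable_funD.
- by apply: measurable_funM.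
- exact: mk measurable_q0.
- by apply: measurable_funM.
- exact: mk measurable_q1.
- by apply: measurable_funM.
- exact: mk measurable_q2.
- by apply: measurable_funM.
- exact: mk measurable_q3.
Qed.

Definition sphere_pt (t : mR * mR) : H :=
  Quat 0 (sin t.1 * cos t.2) (sin t.1 * sin t.2) (cos t.1).

Lemma measurable_sphere_pt : measurable_fun [set: mR * mR] sphere_pt.
Proof.
have ms : measurable_fun [set: mR] (@sin R : mR -> R).
  by apply: continuous_measurable_fun; exact: continuous_sin.
have mc : measurable_fun [set: mR] (@cos R : mR -> R).
  by apply: continuous_measurable_fun; exact: continuous_cos.
have m1 := @measurable_fst _ _ mR mR; have m2 := @measurable_snd _ _ mR mR.
apply: measurable_quat; rewrite /comp/=.
- exact: measurable_cst.
- by apply: measurable_funM; [exact: measurableT_comp ms m1|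
    exact: measurableT_comp mc m2].
- by apply: measurable_funM; [exact: measurableT_comp ms m1|
    exact: measurableT_comp ms m2].
- exact: measurableT_comp mc m1.
Qed.

Definition plane_measure : set (mR * mR) -> \bar R := (leb \x leb)%E.

HB.instance Definition _ := Measure.on plane_measure.

Let plane_sigma_finite : sigma_finite setT plane_measure.
Proof.
have /sigma_finiteP[F [TF ndF Foo]] := sigma_finiteT leb.
exists (fun n => F n `*` F n).
  apply/seteqP; split => // -[x y] _.
  have [n _ Fnx] : (\bigcup_i F i) x by rewrite -TF.
  have [k _ Fky] : (\bigcup_i F i) y by rewrite -TF.
  exists (maxn n k) => //; split => /=.
  - by move: x Fnx; exact/subsetPset/ndF/leq_maxl.
  - by move: y Fky; exact/subsetPset/ndF/leq_maxr.
move=> k; have [mFk Fkoo] := Foo k; split; first exact: measurableX.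
by rewrite /plane_measure product_measure1E// lte_mul_pinfty// ge0_fin_numE.
Qed.

HB.instance Definition _ := Measure_isSigmaFinite.Build _ _ _ plane_measure
  plane_sigma_finite.

Definition angles : set (mR * mR) := `[0, pi]%classic `*` `[0, 2 * pi]%classic.

(* Normalized surface measure: spherical coordinates have area element
   sin(colatitude), and the sphere has area 4 * pi. *)
Definition sphere_measure (A : set H) : \bar R :=
  (\int[plane_measure]_(t in angles `&` sphere_pt @^-1` A)
     (sin t.1 / (4 * pi))%:E)%E.

Let sphere_dens (t : mR * mR) : \bar R := (sin t.1 / (4 * pi))%:E.

Let sphere_dens_ge0 t : angles t -> (0 <= sphere_dens t)%E.
Proof.
move=> [/= t1 _]; rewrite lee_fin divr_ge0 ?mulr_ge0 ?pi_ge0//.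
by apply: sin_ge0_pi; move: t1; rewrite in_itv.
Qed.

Let measurable_sphere_dens : measurable_fun [set: mR * mR] sphere_dens.
Proof.
apply/measurable_EFinP; apply: measurable_funM => //.
apply: (measurableT_comp _ measurable_fst).
by apply: continuous_measurable_fun; exact: continuous_sin.
Qed.

Let measurable_angles A : measurable A ->
  measurable (angles `&` sphere_pt @^-1` A).
Proof.
move=> mA; apply: measurableI; first exact: measurableX.
by rewrite -[X in measurable X]setTI; exact: measurable_sphere_pt.
Qed.

Let sphere0 : sphere_measure set0 = 0%E.
Proof. by rewrite /sphere_measure preimage_set0 setI0 integral_set0. Qed.

Let sphere_ge0 A : (0 <= sphere_measure A)%E.
Proof. by apply: integral_ge0 => t [/sphere_dens_ge0]. Qed.

Let sphere_sigma_additive : semi_sigma_additive sphere_measure.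
Proof.
move=> F mF tF mUF; rewrite /sphere_measure preimage_bigcup setI_bigcupr.
rewrite ge0_integral_bigcup//=.
- by apply: is_cvg_ereal_nneg_natsum_cond => n _ _; exact: sphere_ge0.
- by move=> n; exact: measurable_angles.
- by apply: measurable_funTS; exact: measurable_sphere_dens.
- by move=> t [n _ [/sphere_dens_ge0]].
- apply/trivIsetP => i j _ _ ij; rewrite setIACA -preimage_setI.
  by move/trivIsetP : tF => /(_ _ _ _ _ ij) ->//; rewrite preimage_set0 setI0.
Qed.

HB.instance Definition _ := isMeasure.Build _ _ _ sphere_measure
  sphere0 sphere_ge0 sphere_sigma_additive.

Definition upper_half : set (H * (mR * mR)) := [set u | 0 < u.2.2].

Lemma measurable_upper_half : measurable upper_half.
Proof.
have m22 : measurable_fun [set: H * (mR * mR)] (fun u => u.2.2).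
  by apply: (measurableT_comp measurable_snd); exact: measurable_snd.
rewrite [X in measurable X](_ : _ =
  setT `&` (fun u : H * (mR * mR) => u.2.2) @^-1` `]0, +oo[%classic).
  exact: m22.
by rewrite setTI; apply/seteqP; split => u /=; rewrite in_itv/= andbT.
Qed.

Definition sphere_plane_measure : {measure set (H * (mR * mR))%type -> \bar R} :=
  (sphere_measure \x plane_measure)%E.

Definition polar_measure : {measure set (H * (mR * mR))%type -> \bar R} :=
  mrestr sphere_plane_measure measurable_upper_half.

Definition dV : set H -> \bar R :=
  pushforward polar_measure (fun u => slice_pt u.2.1 u.2.2 u.1).

HB.instance Definition _ := Measure.copy dV
  (measure_function_pushforward__canonical__measure_function_Measure
     polar_measure measurable_slice_pt).

End VolumeMeasure.

Section FockToeplitz.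
Variable R : realType.
Local Notation H := (quat R).
Variable alpha : R.

(* Integral of |f|^2 against the measure with density
   (2 alpha / pi) exp(- alpha |z|^2) with respect to dV. *)
Definition fock_sqnorm (f : H -> H) : \bar R :=
  (\int[@dV R]_z
     (2 * alpha / pi * expR (- alpha * `|z| ^+ 2) * `|f z| ^+ 2)%:E)%E.

Definition fock (f : H -> H) :=
  slice_regular f /\ (fock_sqnorm f < +oo)%E.

Definition fock_norm (f : H -> H) : R := Num.sqrt (fine (fock_sqnorm f)).

Definition fock_kernel (z w : H) : H :=
  limn (series (fun n => (alpha ^+ n / n`!%:R) *: (z ^+ n * qconj w ^+ n))).

Definition fock_nkernel (z w : H) : H :=
  expR (- (alpha * `|z| ^+ 2 / 2)) *: fock_kernel w z.

Definition kernel_span (g : H -> H) :=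
  exists n (a c : 'I_n -> H),
    g = fun z => \sum_(k < n) fock_kernel z (a k) * c k.

Section Measure.
Variable mu : {measure set H -> \bar R}.

Definition qintegral (g : H -> H) : H :=
  Quat (\int[mu]_w q0 (g w)) (\int[mu]_w q1 (g w))
       (\int[mu]_w q2 (g w)) (\int[mu]_w q3 (g w)).

Definition toeplitz (g : H -> H) (z : H) : H :=
  qintegral (fun w => expR (- alpha * `|w| ^+ 2) *: (fock_kernel z w * g w)).

(* Elements of the Fock space are genuine functions, so that [T] is a right linear
   operator on [fock]; its values outside [fock] are irrelevant. *)
Definition toeplitz_bounded :=
  exists T : (H -> H) -> (H -> H),
  [/\ forall f, fock f -> fock (T f),
      forall f g c, fock f -> fock g ->
        T (fun z => f z * c + g z) = (fun z => T f z * c + T g z),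
      exists C : R, forall f, fock f -> fock_norm (T f) <= C * fock_norm f &
      forall g, kernel_span g -> T g = toeplitz g].

Definition berezin (z : H) : \bar R :=
  (\int[mu]_w
     (`|expR (- (alpha / 2 * `|w| ^+ 2)) *: fock_nkernel z w| ^+ 2)%:E)%E.

Definition box_average (r : R) (z : H) : \bar R :=
  (mu (sym_box z r) * ((pi * r ^+ 2)^-1)%:E)%E.

End Measure.

Definition bounded_above (F : H -> \bar R) :=
  exists C : R, forall z, (F z <= C%:E)%E.

(* For [U] open, i.e. when the relatively open subsets of [U] are the open sets
   contained in [U], this says that the restriction of [mu] is Radon on [U]. *)
Definition radon_on (U : set H) (mu : set H -> \bar R) :=
  [/\ forall K, compact K -> K `<=` U -> (mu K < +oo)%E,
      forall A, measurable A -> A `<=` U ->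
        mu A = ereal_inf [set mu O | O in [set O | [/\ open O, A `<=` O & O `<=` U]]] &
      forall O, open O -> O `<=` U ->
        mu O = ereal_sup [set mu K | K in [set K | compact K /\ K `<=` O]]].

End FockToeplitz.

(* Main.v *)
(** Put [hpi (x + y I) = (x, |y|)].  For [z = x + y I] and [w = x' + y' J] the square
    [|K(z, w)|^2] is the mean of [e^(2 alpha (x x' + y y'))] and
    [e^(2 alpha (x x' - y y'))] with weights [(1 + t) / 2] and [(1 - t) / 2], where
    [t] is the inner product of [I] and [J].  So the integrand of the Berezin
    transform at [z] is at most [e^(- alpha |hpi z - hpi w|^2)], and its values at [z]
    and at the conjugate of [z] add up to at least this Gaussian: (b) says that the
    Gaussian averages of the image of [mu] under [hpi] are bounded, and this is
    equivalent to (c) for each radius, whatever the width of the Gaussian.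

    (a) implies (b): the Berezin transform at [z] is [e^(- alpha |z|^2) (T K_z)(z)],
    evaluation at [z] has norm [O(e^(alpha |z|^2 / 2))], and so has [K_z].

    (c) implies (a): each pair of components of [f] is a holomorphic function on the
    plane, and a sub-mean value inequality on boxes, applied after multiplication by
    [e^(- alpha conj(p) zeta)], gives the Carleson embedding
    [int |f|^2 e^(- alpha |w|^2) dmu <= const ||f||^2].  Then [T f] converges absolutely
    and is slice regular as the sum of the power series with coefficients
    [alpha^n / n! int conj(w)^n f(w) e^(- alpha |w|^2) dmu], and the Gaussian bound on
    [K] together with Schur's test bounds its norm. *)

(* The plane is handled as pairs of reals, so the mean value property is proved on squares: the
   imaginary part of the integral of F(zeta) / (zeta - p) along a square centred at p does not
   depend on its size, by differentiation under the integral sign. Applied to F times the conjugate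
   of F(p), with AM-GM absorbing half of the value, it gives |F(p)|^2 <= 8 int |F|^2 over the box of
   half-side 1. The factor e^(- alpha conj(p) zeta) is chosen because |e^(- alpha conj(p) zeta)|^2
   e^(alpha |p|^2) = e^(- alpha |zeta|^2) e^(alpha |zeta - p|^2), where the last factor is at most
   e^(2 alpha) on that box. Norms reach the plane through the mean over the sphere: |f0 + I f1|^2
   has mean |f0|^2 + |f1|^2, since the cross term is linear in I. Exchanging integrals with mu
   requires sigma-finiteness, which comes from the hypothesis at z = 0, where |K| = 1. Schur's test
   runs on AM-GM with a free parameter t, optimized at the end, so that only integrals of
   nonnegative functions are manipulated. *)
From HB Require Import structures.
Require Import Defs.
From mathcomp Require Import all_boot all_order all_algebra.
From mathcomp Require Import all_classical all_reals all_analysis.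
From mathcomp Require Import measurable_realfun ring lra.

Import Order.TTheory GRing.Theory Num.Theory.
Import numFieldNormedType.Exports.

Local Open Scope classical_set_scope.
Local Open Scope ring_scope.

Set Implicit Arguments.
Unset Strict Implicit.
Unset Printing Implicit Defensive.

(** * Monotonicity and additivity of nonnegative integrals *)

Section IntegralMonotone.
Local Open Scope ereal_scope.
Context d (T : measurableType d) (R : realType) (mu : {measure set T -> \bar R}).

(* No measurability is needed: the integral of a nonnegative function is a supremum
   over the simple functions below it. *)
Lemma integral_mono (D : set T) (f g : T -> \bar R) :
  (forall x, D x -> 0 <= f x) -> (forall x, D x -> f x <= g x) ->
  \int[mu]_(x in D) f x <= \int[mu]_(x in D) g x.
Proof.
move=> f0 fg; rewrite (integral_mkcond D f) (integral_mkcond D g).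
have g0 x : D x -> 0 <= g x by move=> Dx; exact: le_trans (f0 _ Dx) (fg _ Dx).
rewrite !ge0_integralTE; [|exact: erestrict_ge0..].
apply: le_ereal_sup => _ [h hf <-]; exists h => // x.
apply: le_trans (hf x) _; rewrite !patchE; case: ifPn => // xD.
by apply: fg; rewrite inE in xD.
Qed.

Lemma integral_monoT (f g : T -> \bar R) :
  (forall x, 0 <= f x) -> (forall x, f x <= g x) ->
  \int[mu]_x f x <= \int[mu]_x g x.
Proof. by move=> f0 fg; apply: integral_mono. Qed.

Lemma integral_subset (A B : set T) (f : T -> \bar R) :
  (forall x, B x -> 0 <= f x) -> A `<=` B ->
  \int[mu]_(x in A) f x <= \int[mu]_(x in B) f x.
Proof.
move=> f0 AB; rewrite (integral_mkcond A) (integral_mkcond B).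
apply: integral_monoT => x; rewrite !patchE.
  by case: ifPn => // /set_mem/AB/f0.
case: ifPn => [/set_mem/AB/mem_set ->//|_].
by case: ifPn => // /set_mem/f0.
Qed.

(** Serves the four sides of a square in [submean] and the four coordinates of a quaternion in
    [gdens_submean]. *)
Lemma ge0_integralD4 (D : set T) (f1 f2 f3 f4 : T -> \bar R) : measurable D ->
  measurable_fun D f1 -> measurable_fun D f2 -> measurable_fun D f3 ->
  measurable_fun D f4 -> (forall x, 0 <= f1 x) -> (forall x, 0 <= f2 x) ->
  (forall x, 0 <= f3 x) -> (forall x, 0 <= f4 x) ->
  \int[mu]_(x in D) (f1 x + f2 x + f3 x + f4 x) = \int[mu]_(x in D) f1 x +
    \int[mu]_(x in D) f2 x + \int[mu]_(x in D) f3 x + \int[mu]_(x in D) f4 x.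
Proof.
move=> mD m1 m2 m3 m4 h1 h2 h3 h4; have m12 := emeasurable_funD m1 m2.
rewrite (ge0_integralD mu mD (f1 := fun x => f1 x + f2 x + f3 x))//.
- rewrite (ge0_integralD mu mD (f1 := fun x => f1 x + f2 x))//.
    by rewrite ge0_integralD.
  by move=> x _; rewrite adde_ge0.
- by move=> x _; rewrite !adde_ge0.
- exact: emeasurable_funD.
Qed.

End IntegralMonotone.

(** * Integration against the image of a measure with density *)

Section IntegralTransfer.
Local Open Scope ereal_scope.
Context d1 d2 (X : measurableType d1) (Y : measurableType d2) (R : realType).
Variables (mu : {measure set X -> \bar R}) (nu : {measure set Y -> \bar R}).
Variables (D : set X) (phi : X -> Y) (g : X -> R).
Hypotheses (mD : measurable D) (mphi : measurable_fun setT phi).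
Hypotheses (mg : measurable_fun D g) (g0 : forall x, D x -> (0 <= g x)%R).
Hypothesis nuE : forall A, measurable A ->
  nu A = \int[mu]_(x in D `&` phi @^-1` A) (g x)%:E.

Import HBNNSimple.

(** Both sides agree on simple functions, level set by level set, and pass to the limit by monotone
    convergence. Used for affine substitutions, for spherical coordinates and for the restriction to
    the upper half plane. *)
Lemma ge0_integral_density (f : Y -> \bar R) :
  measurable_fun setT f -> (forall y, 0 <= f y) ->
  \int[nu]_y f y = \int[mu]_(x in D) (f (phi x) * (g x)%:E).
Proof.
move=> mf f0; pose f_ := nnsfun_approx measurableT mf.
have mfphi n : measurable_fun D (fun x => f_ n (phi x)).
  by apply: measurable_funTS; exact: measurableT_comp.
have f_0 n y : (0 <= f_ n y)%R by exact: fun_ge0.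
have f_nd y m n : (m <= n)%N -> (f_ m y <= f_ n y)%R.
  by move=> mn; exact/lefP/nd_nnsfun_approx.
have f_cvg y : EFin \o f_ ^~ y @ \oo --> f y by exact: cvg_nnsfun_approx.
have mEM (h : X -> R) : measurable_fun D h ->
    measurable_fun D (fun x => (h x * g x)%:E).
  by move=> mh; exact/measurable_EFinP/measurable_funM.
transitivity (limn (fun n => \int[nu]_x (f_ n x)%:E)).
  rewrite -monotone_convergence//.
  - by apply: eq_integral => y _; apply/esym/cvg_lim => //; exact: f_cvg.
  - by move=> n; exact/measurable_EFinP/measurable_funP.
  - by move=> n y _; rewrite lee_fin.
  - by move=> y _ m n mn; rewrite lee_fin f_nd.
transitivity (limn (fun n => \int[mu]_(x in D) (f_ n (phi x) * g x)%:E)).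
  congr (limn _); apply/funext => n.
  under eq_integral do rewrite fimfunE -fsumEFin//.
  rewrite ge0_integral_fsum//; last 2 first.
  - by move=> y; exact/measurable_EFinP/measurable_funM.
  - by move=> y x _; rewrite nnfun_muleindic_ge0.
  transitivity (\sum_(k \in range (f_ n))
      \int[mu]_(x in D) (k * \1_(f_ n @^-1` [set k]) (phi x) * g x)%:E).
    apply: eq_fsbigr => r; rewrite inE => -[y _ yr].
    have r0 : (0 <= r)%R by rewrite -yr.
    rewrite integralZl_indic_nnsfun// integral_indic// setIT nuE//.
    under [RHS]eq_integral do rewrite -mulrA EFinM.
    rewrite ge0_integralZl//; last 2 first.
    - by apply: mEM; apply: measurable_funTS; exact: measurableT_comp.
    - by move=> x Dx; rewrite lee_fin mulr_ge0 ?g0.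
    congr (_ * _); rewrite integral_mkcondr; apply: eq_integral => x _.
    rewrite patchE indicE; have [xf|xf] := boolP (x \in _).
      by rewrite mem_set ?mul1r//; move: xf; rewrite inE.
    by rewrite memNset ?mul0r//; move: xf; rewrite notin_setE.
  rewrite -ge0_integral_fsum//.
  - apply: eq_integral => x _; rewrite [in RHS]fimfunE.
    by rewrite [in RHS]fsbig_finite//= mulr_suml -fsbig_finite//= fsumEFin.
  - move=> r; apply: mEM; apply: measurable_funM => //.
    by apply: measurable_funTS; exact: measurableT_comp.
  - move=> r x Dx; rewrite lee_fin mulr_ge0 ?g0//.
    by rewrite -lee_fin nnfun_muleindic_ge0.
rewrite -monotone_convergence//.
- apply: eq_integral => x /[1!inE] Dx; apply/cvg_lim => //=.
  by under eq_fun do rewrite EFinM; apply: cvgeZr => //; exact: f_cvg.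
- by move=> n; exact: mEM.
- by move=> n x Dx; rewrite lee_fin mulr_ge0 ?g0.
- by move=> x Dx m n mn; rewrite lee_fin ler_wpM2r ?g0// f_nd.
Qed.

End IntegralTransfer.

(** * Affine substitutions on the line *)

Section LebesgueAffine.
Variable R : realType.
Local Notation mR := (measurableTypeR R).
Local Notation leb := (@lebesgue_measure R).

Definition affine (a c : R) (x : mR) : mR := (a + c * x)%R.

Lemma measurable_affine (a c : R) : measurable_fun setT (affine a c).
Proof. by apply: measurable_funD => //; apply: measurable_funM. Qed.

(** The right-hand side is a measure in A, so uniqueness of Lebesgue measure reduces the claim to
    half-open intervals. *)
Lemma lebesgue_measure_affine (a c : R) (A : set mR) : c != 0 -> measurable A ->
  leb A = (`|c|%:E * leb (affine a c @^-1` A))%E.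
Proof.
move=> c0 mA.
pose nu : {measure set mR -> \bar R} :=
  measure_function_pushforward__canonical__measure_function_Measure leb
    (measurable_affine a c).
pose m : {measure set mR -> \bar R} := mscale (NngNum (normr_ge0 c)) nu.
apply: (@lebesgue_measure_unique _ m) => // _ [[x y] _ <-] /=.
rewrite /m/= /mscale/= /pushforward.
move: c0; rewrite neq_lt => /orP[c0|c0].
(* A negative slope reverses the interval, and the closed end changes sides; the length is
   unaffected. *)
- rewrite (_ : _ @^-1` _ = `[(y - a) / c, (x - a) / c[%classic); last first.
    apply/seteqP; split => t /=; rewrite !in_itv/= /affine;
    by rewrite ler_ndivrMr// ltr_ndivlMr// andbC lerBrDl ltrBlDl (mulrC t).
  rewrite !lebesgue_measure_itv/= ltr0_norm// !lte_fin.
  rewrite ltr_nM2r ?invr_lt0// ltrD2r; case: ifPn => _; last by rewrite mule0.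
  by rewrite -!EFinD -EFinM; congr EFin; field; rewrite lt_eqF.
- rewrite (_ : _ @^-1` _ = `](x - a) / c, (y - a) / c]%classic); last first.
    apply/seteqP; split => t /=; rewrite !in_itv/= /affine;
    by rewrite ltr_pdivrMr// ler_pdivlMr// lerBrDl ltrBlDl (mulrC t).
  rewrite !lebesgue_measure_itv/= gtr0_norm// !lte_fin.
  rewrite ltr_pM2r ?invr_gt0// ltrD2r; case: ifPn => _; last by rewrite mule0.
  by rewrite -!EFinD -EFinM; congr EFin; field; rewrite gt_eqF.
Qed.

Lemma ge0_integral_affine (a c : R) (f : mR -> \bar R) : c != 0 ->
  measurable_fun setT f -> (forall x, 0 <= f x)%E ->
  (\int[leb]_x f (affine a c x) * `|c|%:E = \int[leb]_x f x)%E.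
Proof.
move=> c0 mf f0.
rewrite [RHS](@ge0_integral_density _ _ _ _ _ leb leb setT (affine a c)
  (fun=> `|c|) measurableT (measurable_affine a c))//.
  rewrite ge0_integralZr//.
  by apply: (measurableT_comp mf); exact: measurable_affine.
move=> A mA; rewrite setTI integral_cst.
  by rewrite [LHS](lebesgue_measure_affine a c0 mA).
by rewrite -[X in measurable X]setTI; exact: measurable_affine.
Qed.
End LebesgueAffine.

(** * Norms, coordinates and slices of the quaternions *)

Section QuatBasics.
Variable R : realType.
Local Notation H := (quat R).
Implicit Types (p q z w I J : H).

Lemma qnormM p q : `|p * q| = `|p| * `|q|.
Proof.
apply/eqP; rewrite -(@eqrXn2 _ 2) ?mulr_ge0//; apply/eqP.
by rewrite exprMn !qnormE2 /=; ring.
Qed.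

Lemma qnorm1 : `|1 : H| = 1.
Proof.
apply/eqP; rewrite -(@eqrXn2 _ 2)//; apply/eqP; rewrite qnormE2/=; ring.
Qed.

Lemma qnormX p n : `|p ^+ n| = `|p| ^+ n.
Proof. by elim: n => [|n ih]; rewrite ?expr0 ?qnorm1// !exprS qnormM ih. Qed.

Lemma qnorm_conj p : `|qconj p| = `|p|.
Proof.
by apply/eqP; rewrite -(@eqrXn2 _ 2)//; apply/eqP; rewrite !qnormE2 /=; ring.
Qed.

Lemma q0_le p : `|q0 p| <= `|p|.
Proof.
by apply: le_qnorm; rewrite qnormE2 -!addrA lerDl !addr_ge0// sqr_ge0.
Qed.
Lemma q1_le p : `|q1 p| <= `|p|.
Proof.
apply: le_qnorm; rewrite qnormE2.
by have := sqr_ge0 (q0 p); have := sqr_ge0 (q2 p); have := sqr_ge0 (q3 p); lra.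
Qed.
Lemma q2_le p : `|q2 p| <= `|p|.
Proof.
apply: le_qnorm; rewrite qnormE2.
by have := sqr_ge0 (q0 p); have := sqr_ge0 (q1 p); have := sqr_ge0 (q3 p); lra.
Qed.
Lemma q3_le p : `|q3 p| <= `|p|.
Proof.
apply: le_qnorm; rewrite qnormE2.
by have := sqr_ge0 (q0 p); have := sqr_ge0 (q1 p); have := sqr_ge0 (q2 p); lra.
Qed.

Lemma qnorm_le_sum p : `|p| <= `|q0 p| + `|q1 p| + `|q2 p| + `|q3 p|.
Proof.
rewrite -(@ler_pXn2r _ 2) ?nnegrE ?addr_ge0// qnormE2.
rewrite -(real_normK (num_real (q0 p))) -(real_normK (num_real (q1 p))).
rewrite -(real_normK (num_real (q2 p))) -(real_normK (num_real (q3 p))).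
have := normr_ge0 (q0 p); have := normr_ge0 (q1 p).
have := normr_ge0 (q2 p); have := normr_ge0 (q3 p).
move: `|q0 p| `|q1 p| `|q2 p| `|q3 p| => a b c d d0 c0 b0 a0; nra.
Qed.

Lemma cvg_quatP {T} {F : set_system T} {FF : Filter F} (f : T -> H) (l : H) :
  f @ F --> l <->
  [/\ q0 (f x) @[x --> F] --> q0 l, q1 (f x) @[x --> F] --> q1 l,
      q2 (f x) @[x --> F] --> q2 l & q3 (f x) @[x --> F] --> q3 l].
Proof.
split=> [fl|[h0 h1 h2 h3]].
  have tr (k : H -> R) : (forall p q, k (p - q) = k p - k q) ->
      (forall p, `|k p| <= `|p|) -> k (f x) @[x --> F] --> k l.
    move=> kB kle; apply/cvgrPdist_lt => e e0.
    move/cvgrPdist_lt : fl => /(_ _ e0); apply: filterS => t.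
    by apply: le_lt_trans; rewrite -kB.
  by split; apply: tr => //; [exact: q0_le|exact: q1_le|exact: q2_le|exact: q3_le].
apply/cvgrPdist_lt => e e0; have e4 : 0 < e / 4 by rewrite divr_gt0.
move/cvgrPdist_lt : h0 => /(_ _ e4) h0; move/cvgrPdist_lt : h1 => /(_ _ e4) h1.
move/cvgrPdist_lt : h2 => /(_ _ e4) h2; move/cvgrPdist_lt : h3 => /(_ _ e4) h3.
near=> t; apply: le_lt_trans (qnorm_le_sum _) _ => /=.
have : `|q0 l - q0 (f t)| < e / 4 by near: t.
have : `|q1 l - q1 (f t)| < e / 4 by near: t.
have : `|q2 l - q2 (f t)| < e / 4 by near: t.
have : `|q3 l - q3 (f t)| < e / 4 by near: t.
by lra.
Unshelve. all: by end_near. Qed.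

Lemma continuous_quatP {T : topologicalType} (f : T -> H) :
  continuous f <->
  [/\ continuous (fun x => q0 (f x)), continuous (fun x => q1 (f x)),
      continuous (fun x => q2 (f x)) & continuous (fun x => q3 (f x))].
Proof.
split=> [cf|[h0 h1 h2 h3] x]; last first.
  by apply/cvg_quatP; split; [exact: h0|exact: h1|exact: h2|exact: h3].
by split=> x; have /cvg_quatP[] := cf x.
Qed.

Lemma is_deriveP (V W : normedModType R) (f : V -> W) (p v : V) (l : W) :
  is_derive p v f l <-> h^-1 *: (f (h *: v + p) - f p) @[h --> 0^'] --> l.
Proof.
split=> [[dg <-]|gm]; first exact: dg.
by split; [apply/cvg_ex; exists l|exact/cvg_lim].
Qed.

Lemma is_derive_quatP (V : normedModType R) (f : V -> H) (v p : V) (l : H) :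
  is_derive p v f l <->
  [/\ is_derive p v (fun x => q0 (f x)) (q0 l),
      is_derive p v (fun x => q1 (f x)) (q1 l),
      is_derive p v (fun x => q2 (f x)) (q2 l) &
      is_derive p v (fun x => q3 (f x)) (q3 l)].
Proof.
have tr (k : H -> R) : (forall a p q, k (a *: (p - q)) = a * (k p - k q)) ->
    is_derive p v (fun x => k (f x)) (k l) <->
    k (h^-1 *: (f (h *: v + p) - f p)) @[h --> 0^'] --> k l.
  by move=> kE; rewrite is_deriveP (eq_cvg _ _ (fun h => kE _ _ _)).
rewrite is_deriveP; split=> [/cvg_quatP[h0 h1 h2 h3]|].
  by split; apply/tr.
by move=> [/tr h0 /tr h1 /tr h2 /tr h3]; apply/cvg_quatP; split;
  [exact: h0|exact: h1|exact: h2|exact: h3].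
Qed.

Lemma unit_imagP I :
  unit_imag I <-> q0 I = 0 /\ q1 I ^+ 2 + q2 I ^+ 2 + q3 I ^+ 2 = 1.
Proof.
rewrite /unit_imag/= expr2; split=> [/eqP|[I0 I1]]; last first.
  by apply: quat_eq => /=; rewrite I0 ?mul0r ?mulr0; nra.
move=> /eqP II; have h0 := congr1 (@q0 R) II; have h1 := congr1 (@q1 R) II.
have h2 := congr1 (@q2 R) II; have h3 := congr1 (@q3 R) II.
rewrite /= in h0 h1 h2 h3.
(* The imaginary coordinates of I^2 are 2 q0 q_k. A nonzero real part would make every q_k vanish,
   and then I^2 = q0^2 could not be -1. *)
have e0 : q0 I = 0.
  apply/eqP; apply: contraT => n0.
  have z (t : R) : q0 I * t = 0 -> t = 0.
    by move=> /eqP; rewrite mulf_eq0 (negbTE n0) => /eqP.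
  have a1 : q1 I = 0 by apply: z; lra.
  have a2 : q2 I = 0 by apply: z; lra.
  have a3 : q3 I = 0 by apply: z; lra.
  by move: h0; rewrite a1 a2 a3; have := sqr_ge0 (q0 I); nra.
by split => //; move: h0; rewrite e0; lra.
Qed.

Lemma q0D p q : q0 (p + q) = q0 p + q0 q. Proof. by []. Qed.
Lemma q0Z (t : R) p : q0 (t *: p) = t * q0 p. Proof. by []. Qed.
Lemma q1D p q : q1 (p + q) = q1 p + q1 q. Proof. by []. Qed.
Lemma q1Z (t : R) p : q1 (t *: p) = t * q1 p. Proof. by []. Qed.

Lemma im_normE z : im_norm z ^+ 2 = q1 z ^+ 2 + q2 z ^+ 2 + q3 z ^+ 2.
Proof. by rewrite /im_norm qnormE2 /=; ring. Qed.

Lemma im_norm_ge0 z : 0 <= im_norm z. Proof. exact: normr_ge0. Qed.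

Lemma qnorm_im z : `|z| ^+ 2 = q0 z ^+ 2 + im_norm z ^+ 2.
Proof. by rewrite im_normE qnormE2; ring. Qed.

Definition qi : H := Quat 0 1 0 0.

Lemma unit_imag_qi : unit_imag qi.
Proof. by apply/unit_imagP => /=; split=> //; ring. Qed.

Lemma unit_imagN I : unit_imag I -> unit_imag (- I).
Proof. by rewrite /unit_imag/= sqrrN. Qed.

Lemma unit_imag_sq I : unit_imag I -> I * I = - 1.
Proof. by rewrite /unit_imag/= expr2. Qed.

Lemma norm_unit_imag I : unit_imag I -> `|I| = 1.
Proof.
move=> /unit_imagP[I0 I1]; apply/eqP; rewrite -(@eqrXn2 _ 2)//.
by rewrite qnormE2 I0 expr0n/= add0r I1 expr1n.
Qed.

Lemma slice_ptP z : exists2 J, unit_imag J & z = slice_pt (q0 z) (im_norm z) J.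
Proof.
have [z0|z0] := eqVneq (im_norm z) 0.
  (* A real z lies on every slice, so any unit serves. *)
  exists qi; first exact: unit_imag_qi.
  have := im_normE z; rewrite z0 expr0n/= => /esym/eqP.
  rewrite !paddr_eq0 ?addr_ge0 ?sqr_ge0// !sqrf_eq0 => /andP[/andP[]].
  by move=> /eqP z1 /eqP z2 /eqP z3; apply: quat_eq => /=; rewrite ?z1 ?z2 ?z3; ring.
exists ((im_norm z)^-1 *: (z - (q0 z)%:A)).
  apply/unit_imagP => /=; split; first by field.
  have -> : (im_norm z)^-1 * (q1 z - q0 z * 0) = (im_norm z)^-1 * q1 z by ring.
  have -> : (im_norm z)^-1 * (q2 z - q0 z * 0) = (im_norm z)^-1 * q2 z by ring.
  have -> : (im_norm z)^-1 * (q3 z - q0 z * 0) = (im_norm z)^-1 * q3 z by ring.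
  rewrite !exprMn -!mulrDr -im_normE -exprMn mulVf// expr1n//.
by rewrite /slice_pt scalerA mulfV// scale1r addrC subrK.
Qed.

Lemma q0_slice (x y : R) I : unit_imag I -> q0 (slice_pt x y I) = x.
Proof. by move=> /unit_imagP[I0 _] /=; rewrite I0; ring. Qed.

Lemma im_norm_slice (x y : R) I : unit_imag I -> im_norm (slice_pt x y I) = `|y|.
Proof.
move=> hI; have := q0_slice x y hI; move/unit_imagP : (hI) => [I0 I1].
rewrite /im_norm => ->; rewrite /slice_pt addrAC subrr add0r normrZ.
by rewrite norm_unit_imag// mulr1.
Qed.

Lemma qnorm_slice (x y : R) I : unit_imag I -> `|slice_pt x y I| ^+ 2 = x ^+ 2 + y ^+ 2.
Proof.
by move=> hI; rewrite qnorm_im q0_slice// im_norm_slice// real_normK// num_real.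
Qed.

Lemma qconj_slice (x y : R) I : unit_imag I -> qconj (slice_pt x y I) = slice_pt x (- y) I.
Proof.
by move=> /unit_imagP[I0 I1]; apply: quat_eq => /=; rewrite ?I0; ring.
Qed.

Lemma slice_ptN (x y : R) I : slice_pt x (- y) I = slice_pt x y (- I).
Proof. by rewrite /slice_pt scaleNr scalerN. Qed.

(** Complex multiplication on pairs. Every slice is a copy of it, so powers are computed once for
    all units I. *)
Definition cmul (a b : R * R) : R * R :=
  (a.1 * b.1 - a.2 * b.2, a.1 * b.2 + a.2 * b.1).

Fixpoint cpow (a : R * R) n : R * R :=
  if n is n'.+1 then cmul a (cpow a n') else (1, 0).

Lemma slice_ptX (x y : R) I n : unit_imag I ->
  slice_pt x y I ^+ n = slice_pt (cpow (x, y) n).1 (cpow (x, y) n).2 I.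
Proof.
move=> hI; elim: n => [|n ih]; first by rewrite expr0 /slice_pt/= scale1r scale0r addr0.
rewrite exprS ih /=; move: (cpow _ _) => [a b] /=; rewrite /slice_pt.
rewrite mulrDl !mulrDr -!scalerAl -!scalerAr !mul1r mulr1 unit_imag_sq//.
rewrite !scalerA scalerDl [in RHS]scalerDl scalerN -scaleNr !addrA.
by rewrite (addrAC _ (- _ *: _)) (addrAC _ (- _ *: _)) -!addrA scaleNr.
Qed.

Lemma cpow_cmul a b n : cpow (cmul a b) n = cmul (cpow a n) (cpow b n).
Proof.
elim: n => [|n /= ->]; first by rewrite /cmul/=; congr pair; ring.
by move: (cpow a n) (cpow b n) => [c d] [e f]; rewrite /cmul/=; congr pair; ring.
Qed.

Lemma cpow_conj (x y : R) n : cpow (x, - y) n = ((cpow (x, y) n).1, - (cpow (x, y) n).2).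
Proof.
elim: n => [|n /= ->]; first by rewrite /= oppr0.
by rewrite /cmul/=; congr pair; ring.
Qed.

End QuatBasics.

(** * Limits and series of quaternions *)

Section QuatTopology.
Variable R : realType.
Local Notation H := (quat R).

Lemma cvg_qmull {T} {F : set_system T} {FF : Filter F} (c : H) (f : T -> H) (l : H) :
  f @ F --> l -> c * f x @[x --> F] --> c * l.
Proof.
move=> fl; apply/cvgrPdist_lt => e e0.
have c0 : 0 < `|c| + 1 by rewrite ltr_wpDl.
move/cvgrPdist_lt : fl => /(_ _ (divr_gt0 e0 c0)); apply: filterS => t.
rewrite ltr_pdivlMr// => h; rewrite -mulrBr qnormM.
by apply: le_lt_trans h; rewrite mulrDr mulr1 mulrC lerDl.
Qed.

Lemma cvg_qmulr {T} {F : set_system T} {FF : Filter F} (c : H) (f : T -> H) (l : H) :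
  f @ F --> l -> f x * c @[x --> F] --> l * c.
Proof.
move=> fl; apply/cvgrPdist_lt => e e0.
have c0 : 0 < `|c| + 1 by rewrite ltr_wpDl.
move/cvgrPdist_lt : fl => /(_ _ (divr_gt0 e0 c0)); apply: filterS => t.
rewrite ltr_pdivlMr// => h; rewrite -mulrBl qnormM.
by apply: le_lt_trans h; rewrite mulrDr mulr1 lerDl.
Qed.

Lemma limn_eq (u : H^nat) (l : H) : u @ \oo --> l -> limn u = l.
Proof. exact: cvg_lim. Qed.

Lemma cvg_series_quatP (s : H^nat) (l : H) : series s @ \oo --> l <->
  [/\ series (fun k => q0 (s k)) @ \oo --> q0 l,
      series (fun k => q1 (s k)) @ \oo --> q1 l,
      series (fun k => q2 (s k)) @ \oo --> q2 l &
      series (fun k => q3 (s k)) @ \oo --> q3 l].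
Proof.
rewrite cvg_quatP.
have E (k : H -> R) : k 0 = 0 -> (forall p q, k (p + q) = k p + k q) ->
    (fun n => k (series s n)) = series (fun n => k (s n)).
  move=> k0 kD; apply/funext => n; rewrite /series/=.
  by elim: n => [|n ih]; [rewrite !big_geq|rewrite !big_nat_recr//= kD ih].
by rewrite !E.
Qed.

Lemma cvgn_series_norm (a b : R^nat) : (forall n, `|a n| <= b n) ->
  cvgn (series b) -> cvgn (series a) /\ `|limn (series a)| <= limn (series b).
Proof.
move=> ab cb; have b0 n : 0 <= b n by exact: le_trans (ab n).
have ca : cvgn [normed series a].
  by apply: series_le_cvg cb => n /=.
split; first exact: normed_cvg.
by apply: le_trans (lim_series_norm ca) _; exact: lim_series_le.
Qed.

Lemma is_cvg_seriesMl (t : R) (f : R^nat) : cvgn (series f) ->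
  cvgn (series (fun n => t * f n)).
Proof. exact: is_cvg_seriesZ. Qed.

Lemma lim_seriesMl (t : R) (f : R^nat) : cvgn (series f) ->
  limn (series (fun n => t * f n)) = t * limn (series f).
Proof. exact: lim_seriesZ. Qed.

End QuatTopology.

(** * Differentiation of everywhere convergent power series *)

Section EntireSeries.
Variable R : realType.
Local Notation H := (quat R).

(** Infinite radius of convergence, in terms of norms only, so that it passes to real coordinates
    and to dominated sequences. *)
Definition entire (V : normedModType R) (a : nat -> V) :=
  forall rho : R, 0 <= rho -> cvgn (series (fun n => `|a n| * rho ^+ n)).

Lemma entire_le (V W : normedModType R) (a : nat -> V) (b : nat -> W) :
  (forall n, `|a n| <= `|b n|) -> entire b -> entire a.
Proof.
move=> ab eb rho r0; apply: series_le_cvg (eb _ r0) => n.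
- by rewrite mulr_ge0 ?exprn_ge0.
- by rewrite mulr_ge0 ?exprn_ge0.
- by rewrite ler_wpM2r ?exprn_ge0.
Qed.

Lemma natr_le_expn2 n : n%:R <= 2 ^+ n :> R.
Proof. by rewrite -natrX ler_nat ltnW// ltn_expl. Qed.

(** Doubling the radius absorbs the factor n + 1 <= 2^(n+1); taking rho + 1 instead of rho absorbs
    the shift of the exponent when rho < 1. *)
Lemma entire_deriv (a : R^nat) : entire a -> entire (fun n => a n.+1 *+ n.+1 : R).
Proof.
move=> ea rho r0; have r2 : 0 <= 2 * (rho + 1) by rewrite mulr_ge0// addr_ge0.
have c : cvgn (series (fun n => `|a n.+1| * (2 * (rho + 1)) ^+ n.+1)).
  have /cvg_ex[l] := ea _ r2; rewrite -cvg_shiftS => hl.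
  apply/cvg_ex; exists (l - `|a 0%N| * (2 * (rho + 1)) ^+ 0).
  have -> : series (fun n => `|a n.+1| * (2 * (rho + 1)) ^+ n.+1) =
     (fun n => series (fun n => `|a n| * (2 * (rho + 1)) ^+ n) n.+1 -
       `|a 0%N| * (2 * (rho + 1)) ^+ 0).
    by apply/funext => n; rewrite /series/= big_nat_recl//= addrAC subrr add0r.
  by apply: cvgB => //; exact: cvg_cst.
apply: series_le_cvg c => n.
- by rewrite mulr_ge0 ?exprn_ge0.
- by rewrite mulr_ge0 ?exprn_ge0.
rewrite normrMn -[X in X * _ <= _]mulr_natl -mulrA mulrCA ler_wpM2l//.
rewrite exprMn; apply: ler_pM; rewrite ?exprn_ge0// ?natr_le_expn2//.
apply: le_trans (_ : (rho + 1) ^+ n <= _).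
  by apply: lerXn2r; rewrite ?nnegrE ?addr_ge0// lerDl.
by rewrite exprS ler_peMl ?exprn_ge0 ?addr_ge0// lerDr.
Qed.

(** Second-order Taylor remainder of a power. The remainder for n + 1 is (p + h) times the one for n
    plus n h^2 p^(n-1), and the two bounds are equal halves of the new one. At n = 0 the exponent
    [n.-1] is harmless, as its term is taken 0 times. *)
Lemma exprD_comm_le (p h : H) n : p * h = h * p -> `|h| <= 1 ->
  `|(p + h) ^+ n - p ^+ n - h * p ^+ n.-1 *+ n| <=
    `|h| ^+ 2 * (2 * (`|p| + 1)) ^+ n.
Proof.
move=> ph h1; have p1 : 0 <= `|p| + 1 by rewrite addr_ge0.
elim: n => [|n ih]; first by rewrite !expr0 subrr mulr0n subrr normr0 mulr1 sqr_ge0.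
have -> : (p + h) ^+ n.+1 - p ^+ n.+1 - h * p ^+ n.+1.-1 *+ n.+1 =
    (p + h) * ((p + h) ^+ n - p ^+ n - h * p ^+ n.-1 *+ n) +
    h ^+ 2 * p ^+ n.-1 *+ n.
  case: n {ih} => [|n]; first by rewrite -!pred_Sn !mulr0n
    addr0 !expr0 !expr1 subrr subr0 mulr0 mulr1 mulr1n -addrA -opprD subrr.
  have e1 : (p + h) * p ^+ n.+1 = p ^+ n.+2 + h * p ^+ n.+1.
    by rewrite mulrDl -exprS.
  have e2 : (p + h) * (h * p ^+ n) = h * p ^+ n.+1 + h ^+ 2 * p ^+ n.
    by rewrite mulrDl mulrA ph -mulrA -exprS mulrA -expr2.
  rewrite -!pred_Sn [in RHS]mulrBr [in RHS]mulrBr -exprS e1 mulrnAr e2 mulrnDl.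
  by rewrite (mulrS _ n.+1) !opprD !addrA subrK.
apply: le_trans (ler_normD _ _) _.
rewrite qnormM normrMn qnormM !qnormX.
have hn : `|h| ^+ 2 * `|p| ^+ n.-1 *+ n <= `|h| ^+ 2 * (2 ^+ n * (`|p| + 1) ^+ n.+1).
  rewrite -mulrnAr ler_wpM2l ?sqr_ge0// -mulr_natl.
  apply: ler_pM; rewrite ?exprn_ge0// ?natr_le_expn2//.
  apply: le_trans (_ : (`|p| + 1) ^+ n.-1 <= _).
    by apply: lerXn2r; rewrite ?nnegrE ?lerDl.
  by rewrite ler_weXn2l ?lerDr// (leq_trans (leq_pred n)).
have hp : `|p + h| <= `|p| + 1.
  exact: le_trans (ler_normD _ _) (lerD (lexx _) h1).
apply: le_trans (lerD (ler_pM _ _ hp ih) hn) _ => //.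
rewrite !exprMn !exprS le_eqVlt; apply/orP; left; apply/eqP; ring.
Qed.

Section PowerSeries.
Variable k : H -> R.
Hypothesis kD : forall p q, k (p + q) = k p + k q.
Hypothesis kZ : forall (t : R) p, k (t *: p) = t * k p.
Hypothesis k_le : forall p, `|k p| <= `|p|.

Let kB p q : k (p - q) = k p - k q.
Proof. by rewrite -scaleN1r kD kZ mulN1r. Qed.
Let kMn p n : k (p *+ n) = k p *+ n.
Proof. by rewrite -scaler_nat kZ mulr_natl. Qed.

(** Real coefficients and a single coordinate [k] of the powers keep the series real; with k = [q0]
    or [q1] it yields the real and imaginary parts of a complex power series. *)
Definition psum (a : R^nat) (p : H) : R :=
  limn (series (fun n => a n * k (p ^+ n))).

Lemma is_cvg_psum (a : R^nat) (p : H) : entire a ->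
  cvgn (series (fun n => a n * k (p ^+ n))).
Proof.
move=> ea; have [n||//] := @cvgn_series_norm R (fun n => a n * k (p ^+ n))
  (fun n => `|a n| * `|p| ^+ n); last exact: (ea _ (normr_ge0 p)).
by rewrite normrM ler_wpM2l// -qnormX.
Qed.

Lemma psum_deriv_cvg (a : R^nat) (p h : H) : entire a ->
  series (fun n => a n * k (h * p ^+ n.-1 *+ n)) @ \oo -->
  limn (series (fun n => (a n.+1 *+ n.+1) * k (h * p ^+ n))).
Proof.
move=> ea; rewrite -cvg_shiftS.
have -> : (fun n => series (fun n => a n * k (h * p ^+ n.-1 *+ n)) n.+1) =
    series (fun n => (a n.+1 *+ n.+1) * k (h * p ^+ n)).
  apply/funext => n; rewrite /series/= big_nat_recl// mulr0n.
  rewrite -[0]/(0 : H) -[X in k X](scale0r (0 : H)) kZ mul0r mulr0 add0r.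
  by apply: eq_bigr => i _; rewrite kMn mulrnAr mulrnAl.
have [n||//] := @cvgn_series_norm R (fun n => (a n.+1 *+ n.+1) * k (h * p ^+ n))
  (fun n => `|h| * (`|a n.+1 *+ n.+1| * `|p| ^+ n)).
  by rewrite normrM [leRHS]mulrCA ler_wpM2l// -qnormX -qnormM.
apply: is_cvg_seriesMl; exact: (entire_deriv ea (normr_ge0 p)).
Qed.

(** [exprD_comm_le] summed against the coefficients. The error is quadratic in h, which gives both
    the derivative and the continuity along commuting increments. *)
Lemma psum_diff (a : R^nat) (p h : H) : entire a -> p * h = h * p -> `|h| <= 1 ->
  `|psum a (p + h) - psum a p -
     limn (series (fun n => (a n.+1 *+ n.+1) * k (h * p ^+ n)))| <=
  `|h| ^+ 2 * limn (series (fun n => `|a n| * (2 * (`|p| + 1)) ^+ n)).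
Proof.
move=> ea ph h1; have p2 : 0 <= 2 * (`|p| + 1) by rewrite mulr_ge0// addr_ge0.
have cM := ea _ p2.
rewrite -lim_seriesMl//.
pose w n := a n * k ((p + h) ^+ n - p ^+ n - h * p ^+ n.-1 *+ n).
have [n||_] := @cvgn_series_norm R w
    (fun n => `|h| ^+ 2 * (`|a n| * (2 * (`|p| + 1)) ^+ n)).
- rewrite /w normrM /= [leRHS]mulrCA ler_wpM2l//.
  by apply: le_trans (k_le _) _; exact: exprD_comm_le.
- exact: is_cvg_seriesMl.
suff -> : limn (series w) = psum a (p + h) - psum a p -
    limn (series (fun n => (a n.+1 *+ n.+1) * k (h * p ^+ n))) by [].
apply/cvg_lim => //.
have -> : series w = (fun n => series (fun n => a n * k ((p + h) ^+ n)) n -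
   series (fun n => a n * k (p ^+ n)) n -
   series (fun n => a n * k (h * p ^+ n.-1 *+ n)) n).
  apply/funext => n; rewrite /series/= -!sumrB; apply: eq_bigr => i _.
  by rewrite /w !kB !mulrBr.
by apply: cvgB; [apply: cvgB; exact: is_cvg_psum|exact: psum_deriv_cvg].
Qed.

(** Stated for a map [f] affine along v, so as to cover both directional derivatives in the plane
    ([psumq_derive]) and derivatives along real lines ([cexp_derive]). *)
Lemma psum_derive (V : normedModType R) (a : R^nat) (f : V -> H) (x v : V) (c : H) :
  entire a -> (forall t : R, f (t *: v + x) = f x + t *: c) ->
  c * f x = f x * c -> `|c| = 1 ->
  is_derive x v (fun y => psum a (f y))
    (limn (series (fun n => (a n.+1 *+ n.+1) * k (c * f x ^+ n)))).
Proof.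
move=> ea fE cf c1; set M := limn (series (fun n => `|a n| * (2 * (`|f x| + 1)) ^+ n)).
set L := limn _; pose q t := t^-1 *: (psum a (f (t *: v + x)) - psum a (f x)).
have qL : q t @[t --> 0^'] --> L.
  apply/cvgrPdist_lt => e e0.
  have M0 : 0 < `|M| + 1 by rewrite ltr_wpDl.
  near=> t.
  have t0 : t != 0 by near: t; exact: nbhs_dnbhs_neq.
  have t1 : `|t| <= 1 by near: t; apply: dnbhs0_le.
  have te : `|t| < e / (`|M| + 1) by near: t; apply: dnbhs0_lt; rewrite divr_gt0.
  have tc : f x * (t *: c) = t *: c * f x by rewrite -scalerAr -scalerAl cf.
  have tc1 : `|t *: c| <= 1 by rewrite normrZ c1 mulr1.
  have := psum_diff ea tc tc1; rewrite -/M normrZ c1 mulr1.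
  have -> : limn (series (fun n => (a n.+1 *+ n.+1) * k (t *: c * f x ^+ n))) = t * L.
    rewrite /L -[RHS]lim_seriesMl; last first.
      have [n||//] := @cvgn_series_norm R (fun n => (a n.+1 *+ n.+1) * k (c * f x ^+ n))
        (fun n => (`|a n.+1 *+ n.+1| * `|f x| ^+ n)).
        rewrite normrM ler_wpM2l// -qnormX.
        by apply: le_trans (k_le _) _; rewrite qnormM c1 mul1r.
      exact: (entire_deriv ea (normr_ge0 _)).
    congr (limn (series _)); apply/funext => n.
    by rewrite -scalerAl kZ /= mulrCA.
  move=> h; rewrite /q fE distrC.
  have -> : t^-1 *: (psum a (f x + t *: c) - psum a (f x)) - L =
      t^-1 * (psum a (f x + t *: c) - psum a (f x) - t * L).
    by rewrite mulrBr mulKf.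
  rewrite normrM normfV ltr_pdivrMl ?normr_gt0//.
  apply: le_lt_trans h _; rewrite expr2 -mulrA ltr_pM2l ?normr_gt0//.
  move: te; rewrite ltr_pdivlMr//; apply: le_lt_trans.
  by rewrite ler_wpM2l// (le_trans (ler_norm _))// lerDl.
exact/is_deriveP.
Unshelve. all: by end_near. Qed.

Lemma psum_continuous (a : R^nat) (p : H) (e : R) : entire a -> 0 < e ->
  exists2 d : R, 0 < d & forall h, p * h = h * p -> `|h| < d ->
    `|psum a (p + h) - psum a p| < e.
Proof.
move=> ea e0; set M := limn (series (fun n => `|a n| * (2 * (`|p| + 1)) ^+ n)).
set N := limn (series (fun n => `|a n.+1 *+ n.+1| * `|p| ^+ n)).
have M0 : 0 < `|M| + `|N| + 1 by rewrite ltr_wpDl// addr_ge0.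
exists (Num.min 1 (e / (`|M| + `|N| + 1))); first by rewrite lt_min ltr01 divr_gt0.
move=> h ph; rewrite lt_min => /andP[h1 he].
have := psum_diff ea ph (ltW h1); rewrite -/M; set L := limn _ => hL.
have LN : `|L| <= `|h| * N.
  rewrite /N -lim_seriesMl; last exact: (entire_deriv ea (normr_ge0 _)).
  have [n||//] := @cvgn_series_norm R (fun n => (a n.+1 *+ n.+1) * k (h * p ^+ n))
    (fun n => `|h| * (`|a n.+1 *+ n.+1| * `|p| ^+ n)).
    by rewrite normrM [leRHS]mulrCA ler_wpM2l// -qnormX -qnormM.
  apply: is_cvg_seriesMl; exact: (entire_deriv ea (normr_ge0 _)).
rewrite -[X in `|X|](subrK L); apply: le_lt_trans (ler_normD _ _) _.
apply: le_lt_trans (lerD hL LN) _.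
have h0 := normr_ge0 h.
apply: le_lt_trans (_ : `|h| * (`|M| + `|N| + 1) < _); last by rewrite -ltr_pdivlMr.
rewrite expr2 -mulrA -mulrDr ler_wpM2l//.
have := le_trans (ler_wpM2l h0 (ler_norm M)) (ler_wpM2r (normr_ge0 M) (ltW h1)).
by have := ler_norm N; lra.
Qed.

End PowerSeries.

End EntireSeries.

(** * Power series are slice regular *)

Section SlicePowerSeries.
Variable R : realType.
Local Notation H := (quat R).

(** The slice of [qi] stands in for the complex plane: its elements commute, and coordinates 0 and 1
    of their powers are the real and imaginary parts. *)
Definition zeta (u : R * R) : H := slice_pt u.1 u.2 (qi R).

Lemma zetaX (u : R * R) n : zeta u ^+ n = Quat (cpow u n).1 (cpow u n).2 0 0.
Proof.
rewrite /zeta slice_ptX; last exact: unit_imag_qi.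
by case: u => x y; apply: quat_eq => /=; ring.
Qed.

Lemma zetaD (t : R) (u v : R * R) : zeta (t *: v + u) = zeta u + t *: zeta v.
Proof.
rewrite /zeta (_ : (t *: v + u).1 = t * v.1 + u.1)//.
rewrite (_ : (t *: v + u).2 = t * v.2 + u.2)//.
by apply: quat_eq => /=; ring.
Qed.

Lemma zetaC (u v : R * R) : zeta u * zeta v = zeta v * zeta u.
Proof. by apply: quat_eq => /=; ring. Qed.

Lemma zeta_norm (u : R * R) : `|zeta u| ^+ 2 = u.1 ^+ 2 + u.2 ^+ 2.
Proof. by rewrite qnorm_slice//; exact: unit_imag_qi. Qed.

Lemma zeta10 : zeta (1, 0) = 1.
Proof. by apply: quat_eq => /=; ring. Qed.

Lemma zeta01 : zeta (0, 1) = qi R.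
Proof. by apply: quat_eq => /=; ring. Qed.

Definition psumq (k : H -> R) (a : nat -> H) (p : H) : H :=
  Quat (psum k (fun n => q0 (a n)) p) (psum k (fun n => q1 (a n)) p)
       (psum k (fun n => q2 (a n)) p) (psum k (fun n => q3 (a n)) p).

Lemma entire_coord (k : H -> R) (a : nat -> H) : (forall p, `|k p| <= `|p|) ->
  entire a -> entire (fun n => k (a n)).
Proof. by move=> k_le; apply: entire_le => n; exact: k_le. Qed.

Lemma entire_derivq (a : nat -> H) : entire a -> entire (fun n => a n.+1 *+ n.+1).
Proof.
move=> ea; apply: (@entire_le R _ _ _ (fun n => `|a n.+1| *+ n.+1 : R)).
  by move=> n; rewrite normrMn ger0_norm// mulrn_wge0.
apply: (@entire_deriv R (fun n => `|a n|)).
by apply: entire_le ea => n; rewrite normr_id.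
Qed.

Section OneCoordinate.
Variable k : H -> R.
Hypothesis kD : forall p q, k (p + q) = k p + k q.
Hypothesis kZ : forall (t : R) p, k (t *: p) = t * k p.
Hypothesis k_le : forall p, `|k p| <= `|p|.

Lemma cvg_psumq (a : nat -> H) (p : H) : entire a ->
  series (fun n => k (p ^+ n) *: a n) @ \oo --> psumq k a p.
Proof.
move=> ea; have cv (j : H -> R) : entire (fun n => j (a n) : R) ->
    series (fun n => k (p ^+ n) * j (a n)) @ \oo --> psum k (fun n => j (a n)) p.
  move=> ej; rewrite (_ : (fun n => _) = (fun n => j (a n) * k (p ^+ n))).
    exact: is_cvg_psum.
  by apply/funext => n; rewrite mulrC.
apply/cvg_series_quatP; split; apply: cv.
- exact: entire_coord (@q0_le R) ea.
- exact: entire_coord (@q1_le R) ea.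
- exact: entire_coord (@q2_le R) ea.
- exact: entire_coord (@q3_le R) ea.
Qed.

Lemma psumq_continuous (a : nat -> H) : entire a ->
  continuous (fun u => psumq k a (zeta u)).
Proof.
move=> ea; have cv (b : R^nat) : entire b -> continuous (fun u => psum k b (zeta u)).
  move=> eb u; apply/(@cvgrPdist_lt _ _ _ (nbhs u)) => e e0.
  have [d d0 hd] := psum_continuous kD kZ k_le (zeta u) eb e0.
  apply/nbhs_ballP; exists (d / 2); first by rewrite /= divr_gt0.
  move=> v [/= u1 u2]; rewrite distrC.
  have -> : zeta v = zeta u + zeta (v - u).
    by rewrite -[zeta (v - u)]scale1r -zetaD scale1r subrK.
  apply: hd; first exact: zetaC.
  rewrite -(@ltr_pXn2r _ 2) ?nnegrE ?(ltW d0)// zeta_norm/=.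
  have sq (s t : R) : ball s (d / 2) t -> (t - s) ^+ 2 < d ^+ 2 / 4.
    rewrite /ball/= distrC => h.
    have -> : d ^+ 2 / 4 = (d / 2) ^+ 2 by field.
    by rewrite -real_normK ?num_real// ltr_pXn2r ?nnegrE ?divr_ge0// ltW.
  have := sq _ _ u1; have := sq _ _ u2; have := sqr_ge0 d; lra.
apply/continuous_quatP; split; apply: cv.
- exact: entire_coord (@q0_le R) ea.
- exact: entire_coord (@q1_le R) ea.
- exact: entire_coord (@q2_le R) ea.
- exact: entire_coord (@q3_le R) ea.
Qed.

(** Differentiation along v multiplies the powers by [zeta v], and [k'] is what [k] becomes under
    this multiplication. For v = (0, 1) it is multiplication by [qi], which exchanges [q0] and [q1]
    up to sign: the Cauchy-Riemann equations. *)
Lemma psumq_derive (a : nat -> H) (k' : H -> R) (v u : R * R) : entire a ->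
  `|zeta v| = 1 -> (forall n, k (zeta v * zeta u ^+ n) = k' (zeta u ^+ n)) ->
  is_derive u v (fun w => psumq k a (zeta w))
    (psumq k' (fun n => a n.+1 *+ n.+1) (zeta u)).
Proof.
move=> ea v1 kk'.
have cv (j : H -> R) : (forall p n, j (p *+ n) = j p *+ n) ->
    entire (fun n => j (a n) : R) ->
    is_derive u v (fun w => psum k (fun n => j (a n)) (zeta w))
      (psum k' (fun n => j (a n.+1 *+ n.+1)) (zeta u)).
  move=> jMn ej.
  have := psum_derive kD kZ k_le ej (fun t => zetaD t u v) (zetaC v u) v1.
  rewrite /psum (_ : (fun n => _ * k _) =
    (fun n => j (a n.+1 *+ n.+1) * k' (zeta u ^+ n)))//.
  by apply/funext => n; rewrite jMn kk'.
apply/is_derive_quatP; split; apply: cv.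
- by move=> q n; rewrite -scaler_nat /= mulr_natl.
- exact: entire_coord (@q0_le R) ea.
- by move=> q n; rewrite -scaler_nat /= mulr_natl.
- exact: entire_coord (@q1_le R) ea.
- by move=> q n; rewrite -scaler_nat /= mulr_natl.
- exact: entire_coord (@q2_le R) ea.
- by move=> q n; rewrite -scaler_nat /= mulr_natl.
- exact: entire_coord (@q3_le R) ea.
Qed.

End OneCoordinate.

Lemma q0_qi (p : H) : q0 (qi R * p) = - q1 p.
Proof. by rewrite /=; ring. Qed.
Lemma q1_qi (p : H) : q1 (qi R * p) = q0 p.
Proof. by rewrite /=; ring. Qed.

(** [psum0] and [psum1] are the two slice components of the sum of the z^n a_n. *)
Definition psum0 (a : nat -> H) (u : R * R) := psumq (@q0 R) a (zeta u).
Definition psum1 (a : nat -> H) (u : R * R) := psumq (@q1 R) a (zeta u).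

Lemma cvg_psum0 (a : nat -> H) u : entire a ->
  series (fun n => (cpow u n).1 *: a n) @ \oo --> psum0 a u.
Proof.
move=> ea; have := cvg_psumq (@q0_le R) (p:=zeta u) ea.
by rewrite (_ : (fun n => q0 _ *: _) = (fun n => (cpow u n).1 *: a n))//;
  apply/funext => n; rewrite zetaX.
Qed.

Lemma cvg_psum1 (a : nat -> H) u : entire a ->
  series (fun n => (cpow u n).2 *: a n) @ \oo --> psum1 a u.
Proof.
move=> ea; have := cvg_psumq (@q1_le R) (p:=zeta u) ea.
by rewrite (_ : (fun n => q1 _ *: _) = (fun n => (cpow u n).2 *: a n))//;
  apply/funext => n; rewrite zetaX.
Qed.

Lemma psum0_conj (a : nat -> H) x y : entire a -> psum0 a (x, - y) = psum0 a (x, y).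
Proof.
move=> ea; have := cvg_psum0 (u:=(x, - y)) ea.
rewrite (_ : (fun n => _) = (fun n => (cpow (x, y) n).1 *: a n)); last first.
  by apply/funext => n; rewrite cpow_conj.
by move/limn_eq => <-; apply/limn_eq; exact: cvg_psum0.
Qed.

Lemma psum1_conj (a : nat -> H) x y : entire a -> psum1 a (x, - y) = - psum1 a (x, y).
Proof.
move=> ea; have := cvg_psum1 (u:=(x, - y)) ea.
rewrite (_ : (fun n => _) = - (fun n => (cpow (x, y) n).2 *: a n)); last first.
  by apply/funext => n; rewrite cpow_conj/= scaleNr.
move/limn_eq => <-; apply/limn_eq; rewrite seriesN.
by apply: cvgN; exact: cvg_psum1.
Qed.

Lemma cvg_slice_psum (a : nat -> H) x y I : entire a -> unit_imag I ->
  series (fun n => slice_pt x y I ^+ n * a n) @ \oo -->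
    psum0 a (x, y) + I * psum1 a (x, y).
Proof.
move=> ea hI.
have -> : series (fun n => slice_pt x y I ^+ n * a n) =
    (fun n => series (fun n => (cpow (x, y) n).1 *: a n) n +
      I * series (fun n => (cpow (x, y) n).2 *: a n) n).
  apply/funext => n; rewrite /series/= mulr_sumr -big_split; apply: eq_bigr => i _.
  by rewrite slice_ptX// /slice_pt mulrDl -!scalerAl mul1r -scalerAr.
by apply: cvgD; [exact: cvg_psum0|apply: cvg_qmull; exact: cvg_psum1].
Qed.

Lemma psum0_derive10 (a : nat -> H) (u : R * R) : entire a ->
  is_derive u ((1, 0) : R * R) (psum0 a) (psum0 (fun n => a n.+1 *+ n.+1) u).
Proof.
move=> ea; apply: (psumq_derive (@q0D R) (@q0Z R) (@q0_le R)) => //.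
- by rewrite zeta10 qnorm1.
- by move=> n; rewrite zeta10 mul1r.
Qed.

Lemma psum1_derive10 (a : nat -> H) (u : R * R) : entire a ->
  is_derive u ((1, 0) : R * R) (psum1 a) (psum1 (fun n => a n.+1 *+ n.+1) u).
Proof.
move=> ea; apply: (psumq_derive (@q1D R) (@q1Z R) (@q1_le R)) => //.
- by rewrite zeta10 qnorm1.
- by move=> n; rewrite zeta10 mul1r.
Qed.

Lemma psum1_derive01 (a : nat -> H) (u : R * R) : entire a ->
  is_derive u ((0, 1) : R * R) (psum1 a) (psum0 (fun n => a n.+1 *+ n.+1) u).
Proof.
move=> ea; apply: (psumq_derive (@q1D R) (@q1Z R) (@q1_le R)) => //.
- by rewrite zeta01 norm_unit_imag//; exact: unit_imag_qi.
- by move=> n; rewrite zeta01 q1_qi.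
Qed.

Lemma psum0_derive01 (a : nat -> H) (u : R * R) : entire a ->
  is_derive u ((0, 1) : R * R) (psum0 a) (- psum1 (fun n => a n.+1 *+ n.+1) u).
Proof.
move=> ea; have ea' := entire_derivq ea.
have -> : - psum1 (fun n => a n.+1 *+ n.+1) u =
    psumq (fun p => - q1 p) (fun n => a n.+1 *+ n.+1) (zeta u).
  have h : series (fun n => - q1 (zeta u ^+ n) *: (a n.+1 *+ n.+1)) @ \oo -->
      psumq (fun p => - q1 p) (fun n => a n.+1 *+ n.+1) (zeta u).
    by apply: (@cvg_psumq (fun p => - q1 p)) => // p; rewrite normrN q1_le.
  move/limn_eq : h => <-; apply/esym/limn_eq.
  rewrite (_ : series _ = - series (fun n => (cpow u n).2 *: (a n.+1 *+ n.+1))).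
    by apply: cvgN; exact: cvg_psum1.
  by rewrite -seriesN; congr series; apply/funext => n; rewrite zetaX/= scaleNr.
apply: (psumq_derive (@q0D R) (@q0Z R) (@q0_le R)) => //.
- by rewrite zeta01 norm_unit_imag//; exact: unit_imag_qi.
- by move=> n; rewrite zeta01 q0_qi.
Qed.

Lemma psum0_continuous (a : nat -> H) : entire a -> continuous (psum0 a).
Proof. exact: psumq_continuous (@q0D R) (@q0Z R) (@q0_le R) a. Qed.

Lemma psum1_continuous (a : nat -> H) : entire a -> continuous (psum1 a).
Proof. exact: psumq_continuous (@q1D R) (@q1Z R) (@q1_le R) a. Qed.

Lemma power_series_slice_regular (a : nat -> H) (f : H -> H) : entire a ->
  (forall z, series (fun n => z ^+ n * a n) @ \oo --> f z) -> slice_regular f.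
Proof.
move=> ea fE; have ea' := entire_derivq ea.
have D00 : 'D_(1, 0) (psum0 a) = psum0 (fun n => a n.+1 *+ n.+1).
  by apply/funext => u; have [_ ->] := psum0_derive10 u ea.
have D10 : 'D_(1, 0) (psum1 a) = psum1 (fun n => a n.+1 *+ n.+1).
  by apply/funext => u; have [_ ->] := psum1_derive10 u ea.
have D01 : 'D_(0, 1) (psum0 a) = (fun u => - psum1 (fun n => a n.+1 *+ n.+1) u).
  by apply/funext => u; have [_ ->] := psum0_derive01 u ea.
have D11 : 'D_(0, 1) (psum1 a) = psum0 (fun n => a n.+1 *+ n.+1).
  by apply/funext => u; have [_ ->] := psum1_derive01 u ea.
exists (psum0 a), (psum1 a); split.
- move=> x y I hI; have /limn_eq <- := fE (slice_pt x y I).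
  exact/limn_eq/cvg_slice_psum.
- by move=> x y; rewrite psum0_conj// psum1_conj.
- split; split.
  + by move=> u; have [] := psum0_derive10 u ea.
  + by rewrite D00; exact: psum0_continuous.
  + by move=> u; have [] := psum0_derive01 u ea.
  + by rewrite D01 => u; apply: cvgN; exact: psum1_continuous.
  + by move=> u; have [] := psum1_derive10 u ea.
  + by rewrite D10; exact: psum1_continuous.
  + by move=> u; have [] := psum1_derive01 u ea.
  + by rewrite D11; exact: psum0_continuous.
- move=> u; split; apply/eqP; rewrite ?subr_eq0 ?addr_eq0; apply/eqP.
    exact: etrans (congr1 (@^~ u) D00) (esym (congr1 (@^~ u) D11)).
  exact: etrans (congr1 (@^~ u) D01) (congr1 -%R (esym (congr1 (@^~ u) D10))).
Qed.

Lemma cvg_power_series (a : nat -> H) z : entire a ->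
  cvgn (series (fun n => z ^+ n * a n)).
Proof.
move=> ea; have [J hJ ->] := slice_ptP z.
by apply/cvg_ex; eexists; exact: cvg_slice_psum.
Qed.

End SlicePowerSeries.

(** * The modulus of the Fock kernel *)

Section FockKernel.
Variable R : realType.
Local Notation H := (quat R).

Lemma is_cvg_series_exp (x : R) : cvgn (series (fun n => n`!%:R^-1 * x ^+ n)).
Proof.
by have := is_cvg_series_exp_coeff x; rewrite exp_coeffE.
Qed.

Lemma entire_inv_fact : entire (fun n => n`!%:R^-1 : R).
Proof.
move=> rho r0; have := @is_cvg_series_exp rho.
rewrite (_ : (fun n => n`!%:R^-1 * _) = (fun n => `|n`!%:R^-1 : R| * rho ^+ n))//.
by apply/funext => n; rewrite ger0_norm// invr_ge0.
Qed.

(** Real and imaginary part of the complex exponential, by its series. *)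
Definition cexp0 (u : R * R) : R := psum (@q0 R) (fun n => n`!%:R^-1) (zeta u).
Definition cexp1 (u : R * R) : R := psum (@q1 R) (fun n => n`!%:R^-1) (zeta u).

Let inv_factS n : (n.+1)`!%:R^-1 *+ n.+1 = n`!%:R^-1 :> R.
Proof.
by rewrite factS natrM invfM -mulrnAl -mulr_natl mulfV ?mul1r// pnatr_eq0.
Qed.

Let cexp_derive (k k' : H -> R) (f : R -> R * R) (v : R * R) (x : R)
  (kD : forall p q : H, k (p + q) = k p + k q)
  (kZ : forall (t : R) (p : H), k (t *: p) = t * k p)
  (k_le : forall p : H, `|k p| <= `|p|) :
  (forall t, f (t + x) = t *: v + f x) -> `|zeta v| = 1 ->
  (forall p : H, k (zeta v * p) = k' p) ->
  is_derive x 1 (fun y => psum k (fun n => n`!%:R^-1) (zeta (f y)))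
    (psum k' (fun n => n`!%:R^-1) (zeta (f x))).
Proof.
move=> fE v1 kk'.
have fE' (t : R) : zeta (f (t *: (1 : R) + x)) = zeta (f x) + t *: zeta v.
  by rewrite -zetaD -fE scaler1.
have := @psum_derive R k kD kZ k_le R _ (fun y => zeta (f y)) x (1 : R) (zeta v)
  entire_inv_fact fE' (zetaC v (f x)) v1.
rewrite /psum (_ : (fun n => _ * k _) =
    (fun n => n`!%:R^-1 * k' (zeta (f x) ^+ n)))//.
by apply/funext => n; rewrite kk' inv_factS.
Qed.

Let psumN_q1 u : psum (fun p : H => - q1 p) (fun n => n`!%:R^-1) (zeta u) = - cexp1 u.
Proof.
rewrite /cexp1 /psum -lim_seriesN; last first.
  by apply: is_cvg_psum entire_inv_fact; exact: q1_le.
by congr (limn (series _)); apply/funext => n; rewrite mulrN.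
Qed.

(** The squared modulus is constant on the imaginary axis and, after division by e^(2x), on
    horizontal lines, because the derivatives vanish; at the origin it is 1. *)
Lemma cexp_sqr u : cexp0 u ^+ 2 + cexp1 u ^+ 2 = expR (2 * u.1).
Proof.
case: u => x y /=.
pose N u := cexp0 u ^+ 2 + cexp1 u ^+ 2.
have N00 : N (0, 0) = 1.
  have z0 n : zeta (0 : R, 0 : R) ^+ n = (n == 0%N)%:R.
    have -> : zeta (0 : R, 0 : R) = 0 by apply: quat_eq => /=; ring.
    by rewrite expr0n.
  have l (k : H -> R) : k 0 = 0 -> psum k (fun n => n`!%:R^-1) (zeta (0, 0)) = k 1.
    move=> kk; apply/cvg_lim => //; rewrite -cvg_shiftS.
    rewrite (_ : (fun n => _) = cst (k 1)); first exact: cvg_cst.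
    apply/funext => n; rewrite /series/= big_nat_recl// z0 eqxx.
    rewrite big1 ?addr0 ?fact0 ?invr1 ?mul1r// => i _.
    by rewrite z0 kk mulr0.
  by rewrite /N /cexp0 /cexp1 !l// /= expr0n expr1n addr0.
have N0y : N (0, y) = N (0, 0).
  apply: (@is_derive_0_is_cst R (fun t => N (0, t))) => t.
  have fE (s : R) : (0, s + t) = s *: ((0, 1) : R * R) + (0, t) :> R * R.
    by congr pair => /=; rewrite ?scaler0 ?addr0// scaler1.
  have z1 : `|zeta (0 : R, 1 : R)| = 1.
    by rewrite zeta01 norm_unit_imag//; exact: unit_imag_qi.
  have d0 : is_derive t 1 (fun s => cexp0 (0, s)) (- cexp1 (0, t)).
    rewrite -psumN_q1; apply: (cexp_derive (@q0D R) (@q0Z R) (@q0_le R) fE z1) => p.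
    by rewrite zeta01 q0_qi.
  have d1 : is_derive t 1 (fun s => cexp1 (0, s)) (cexp0 (0, t)).
    apply: (cexp_derive (@q1D R) (@q1Z R) (@q1_le R) fE z1) => p.
    by rewrite zeta01 q1_qi.
  apply: is_derive_eq.
  by rewrite /N /GRing.scale/=; ring.
have Nx : N (x, y) * expR (- (2 * x)) = N (0, y) * expR (- (2 * 0)).
  apply: (@is_derive_0_is_cst R (fun t => N (t, y) * expR (- (2 * t)))) => t.
  have fE (s : R) : (s + t, y) = s *: ((1, 0) : R * R) + (t, y) :> R * R.
    by congr pair => /=; rewrite ?scaler0 ?add0r// scaler1.
  have z1 : `|zeta (1 : R, 0 : R)| = 1 by rewrite zeta10 qnorm1.
  have d0 : is_derive t 1 (fun s => cexp0 (s, y)) (cexp0 (t, y)).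
    apply: (cexp_derive (@q0D R) (@q0Z R) (@q0_le R) fE z1) => p.
    by rewrite zeta10 mul1r.
  have d1 : is_derive t 1 (fun s => cexp1 (s, y)) (cexp1 (t, y)).
    apply: (cexp_derive (@q1D R) (@q1Z R) (@q1_le R) fE z1) => p.
    by rewrite zeta10 mul1r.
  apply: is_derive_eq.
  by rewrite /N /GRing.scale/=; ring.
move: Nx; rewrite N0y N00 mulr0 oppr0 expR0 mulr1 expRN => /(canRL (mulfVK _)).
by rewrite mul1r /N => ->//; rewrite gt_eqF ?expR_gt0.
Qed.

Lemma cvg_cexp0 u : series (fun n => n`!%:R^-1 * (cpow u n).1) @ \oo --> cexp0 u.
Proof.
rewrite (_ : (fun n => _) = (fun n => n`!%:R^-1 * q0 (zeta u ^+ n))).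
  exact: (is_cvg_psum (@q0_le R) (p:=zeta u) entire_inv_fact).
by apply/funext => n; rewrite zetaX.
Qed.

Lemma cvg_cexp1 u : series (fun n => n`!%:R^-1 * (cpow u n).2) @ \oo --> cexp1 u.
Proof.
rewrite (_ : (fun n => _) = (fun n => n`!%:R^-1 * q1 (zeta u ^+ n))).
  exact: (is_cvg_psum (@q1_le R) (p:=zeta u) entire_inv_fact).
by apply/funext => n; rewrite zetaX.
Qed.

Variable alpha : R.
Hypothesis alpha_ge0 : 0 <= alpha.

Definition kcoef (w : H) (n : nat) : H := (alpha ^+ n / n`!%:R) *: qconj w ^+ n.

Lemma entire_kcoef w : entire (kcoef w).
Proof.
move=> rho r0; have := @is_cvg_series_exp (alpha * `|w| * rho).
rewrite (_ : (fun n => n`!%:R^-1 * _) = (fun n => `|kcoef w n| * rho ^+ n))//.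
apply/funext => n; rewrite /kcoef normrZ qnormX qnorm_conj ger0_norm.
  by rewrite !exprMn; ring.
by rewrite divr_ge0 ?exprn_ge0.
Qed.

Lemma kernel_term z w n : (alpha ^+ n / n`!%:R) *: (z ^+ n * qconj w ^+ n) =
  z ^+ n * kcoef w n.
Proof. by rewrite /kcoef scalerAr. Qed.

Lemma cvg_kernel z w :
  series (fun n => z ^+ n * kcoef w n) @ \oo --> fock_kernel alpha z w.
Proof.
have h := cvg_power_series (z:=z) (@entire_kcoef w).
suff -> : fock_kernel alpha z w = limn (series (fun n => z ^+ n * kcoef w n)) by [].
by congr (limn (series _)); apply/funext => n; exact: kernel_term.
Qed.

Lemma kernel_slice_regular w : slice_regular (fun z => fock_kernel alpha z w).
Proof. by apply: (power_series_slice_regular (@entire_kcoef w)) => z; exact: cvg_kernel. Qed.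

Lemma qconjM (p q : H) : qconj (p * q) = qconj q * qconj p.
Proof. by apply: quat_eq => /=; ring. Qed.

Lemma qconjX (p : H) n : qconj (p ^+ n) = qconj p ^+ n.
Proof.
elim: n => [|n ih]; first by apply: quat_eq => /=; ring.
by rewrite exprS exprSr qconjM ih.
Qed.

Lemma qconjK (p : H) : qconj (qconj p) = p.
Proof. by apply: quat_eq => /=; ring. Qed.

Lemma qconj_sqr (p : H) : qconj p * p = (`|p| ^+ 2)%:A.
Proof. by rewrite qnormE2; apply: quat_eq => /=; ring. Qed.

Lemma kernel_conj z w : qconj (fock_kernel alpha z w) = fock_kernel alpha w z.
Proof.
apply/esym/limn_eq.
have -> : (fun n => (alpha ^+ n / n`!%:R) *: (w ^+ n * qconj z ^+ n)) =
    (fun n => qconj (z ^+ n * kcoef w n)).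
  apply/funext => n; rewrite qconjM /kcoef.
  have cZ (t : R) (p : H) : qconj (t *: p) = t *: qconj p.
    by apply: quat_eq => /=; ring.
  by rewrite cZ -scalerAl !qconjX qconjK.
have /cvg_series_quatP[h0 h1 h2 h3] := @cvg_kernel z w.
apply/cvg_series_quatP; split=> //=.
- by rewrite (_ : (fun k => _) = - (fun k => q1 (z ^+ k * kcoef w k)))// seriesN; exact: cvgN.
- by rewrite (_ : (fun k => _) = - (fun k => q2 (z ^+ k * kcoef w k)))// seriesN; exact: cvgN.
- by rewrite (_ : (fun k => _) = - (fun k => q3 (z ^+ k * kcoef w k)))// seriesN; exact: cvgN.
Qed.

Definition imdot (I J : H) : R := q1 I * q1 J + q2 I * q2 J + q3 I * q3 J.

(** The elements 1, I, J, I J have norm 1 and are orthogonal except for the pairs I, J and 1, I J,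
    whose inner products are [imdot I J] and its opposite. *)
Lemma qnorm_bilin (p q r s : R) I J : unit_imag I -> unit_imag J ->
  `|p%:A + q *: I + (r *: J + s *: (I * J))| ^+ 2 =
  p ^+ 2 + q ^+ 2 + r ^+ 2 + s ^+ 2 + 2 * imdot I J * (q * r - p * s).
Proof.
move=> /unit_imagP[I0 I1] /unit_imagP[J0 J1]; rewrite qnormE2 /imdot /= I0 J0.
transitivity (p ^+ 2 + q ^+ 2 * (q1 I ^+ 2 + q2 I ^+ 2 + q3 I ^+ 2) +
  r ^+ 2 * (q1 J ^+ 2 + q2 J ^+ 2 + q3 J ^+ 2) +
  s ^+ 2 * (q1 I ^+ 2 + q2 I ^+ 2 + q3 I ^+ 2) * (q1 J ^+ 2 + q2 J ^+ 2 + q3 J ^+ 2) +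
  2 * (q1 I * q1 J + q2 I * q2 J + q3 I * q3 J) * (q * r - p * s)); first by ring.
by rewrite I1 J1; ring.
Qed.

Let cvg_bilin (u u' v v' : R^nat) (U U' V V' : R) (I J : H) :
  u @ \oo --> U -> u' @ \oo --> U' -> v @ \oo --> V -> v' @ \oo --> V' ->
  (fun n => ((u n + u' n) / 2)%:A + ((v n + v' n) / 2) *: I +
    (((v n - v' n) / 2) *: J + ((u' n - u n) / 2) *: (I * J))) @ \oo -->
  ((U + U') / 2)%:A + ((V + V') / 2) *: I +
    (((V - V') / 2) *: J + ((U' - U) / 2) *: (I * J)).
Proof.
move=> cu cu' cv cv'.
apply: cvgD; (apply: cvgD; apply: cvgZr_tmp; apply: cvgMr_tmp).
- exact: cvgD.
- exact: cvgD.
- exact: cvgB.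
- exact: cvgB.
Qed.

Lemma imdot_le1 I J : unit_imag I -> unit_imag J -> `|imdot I J| <= 1.
Proof.
move=> /unit_imagP[_ I1] /unit_imagP[_ J1]; rewrite ler_norml /imdot.
have := sqr_ge0 (q1 I - q1 J); have := sqr_ge0 (q2 I - q2 J).
have := sqr_ge0 (q3 I - q3 J); have := sqr_ge0 (q1 I + q1 J).
have := sqr_ge0 (q2 I + q2 J); have := sqr_ge0 (q3 I + q3 J).
by move: I1 J1 => *; apply/andP; split; nra.
Qed.

(** In 1, I, J, I J the kernel has as coordinates the half-sums and half-differences of the real and
    imaginary parts of two complex exponentials; [qnorm_bilin] recombines these into the two squared
    moduli. *)
Lemma kernel_sqr x y x' y' I J : unit_imag I -> unit_imag J ->
  `|fock_kernel alpha (slice_pt x y I) (slice_pt x' y' J)| ^+ 2 =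
  (1 + imdot I J) / 2 * expR (2 * (alpha * (x * x' + y * y'))) +
  (1 - imdot I J) / 2 * expR (2 * (alpha * (x * x' - y * y'))).
Proof.
move=> hI hJ.
(* With zeta = (x, y) and omega = (x', y'), the exponents are alpha zeta conj(omega) and alpha zeta
   omega. *)
pose up := cmul (alpha * x, alpha * y) (x', - y').
pose um := cmul (alpha * x, alpha * y) (x', y').
set U := cexp0 up; set V := cexp1 up; set U' := cexp0 um; set V' := cexp1 um.
have KE : fock_kernel alpha (slice_pt x y I) (slice_pt x' y' J) =
    ((U + U') / 2)%:A + ((V + V') / 2) *: I +
    (((V - V') / 2) *: J + ((U' - U) / 2) *: (I * J)).
  apply/limn_eq.
  pose u n := n`!%:R^-1 * (cpow up n).1; pose v n := n`!%:R^-1 * (cpow up n).2.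
  pose u' n := n`!%:R^-1 * (cpow um n).1; pose v' n := n`!%:R^-1 * (cpow um n).2.
  have cu : series u @ \oo --> U by exact: cvg_cexp0.
  have cv : series v @ \oo --> V by exact: cvg_cexp1.
  have cu' : series u' @ \oo --> U' by exact: cvg_cexp0.
  have cv' : series v' @ \oo --> V' by exact: cvg_cexp1.
  rewrite (_ : series _ = (fun n =>
    ((series u n + series u' n) / 2)%:A + ((series v n + series v' n) / 2) *: I +
    (((series v n - series v' n) / 2) *: J +
      ((series u' n - series u n) / 2) *: (I * J)))).
    exact: (cvg_bilin cu cu' cv cv').
  apply/funext => n; rewrite /series/= -!big_split/= -!sumrB !mulr_suml.
  rewrite !scaler_suml -!big_split/=; apply: eq_bigr => i _.
  have aX : cpow (alpha * x, alpha * y) i =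
      (alpha ^+ i * (cpow (x, y) i).1, alpha ^+ i * (cpow (x, y) i).2).
    elim: i => [|i ih]; first by rewrite /= expr0 !mul1r.
    by rewrite /= ih /cmul/= !exprS; congr pair; ring.
  rewrite /u /v /u' /v' /up /um !cpow_cmul aX cpow_conj slice_ptX//.
  rewrite qconj_slice// slice_ptX// cpow_conj.
  move: (cpow (x, y) i) (cpow (x', y') i) => [a b] [c d].
  move: (alpha ^+ i) (i`!%:R^-1) => s t; rewrite /cmul/=.
  move: hI hJ => /unit_imagP[I0 _] /unit_imagP[J0 _].
  by apply: quat_eq => /=; rewrite I0 J0; field.
rewrite KE qnorm_bilin//.
have h : U ^+ 2 + V ^+ 2 = expR (2 * (alpha * (x * x' + y * y'))).
  by rewrite cexp_sqr; congr expR; rewrite /up/=; ring.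
have h' : U' ^+ 2 + V' ^+ 2 = expR (2 * (alpha * (x * x' - y * y'))).
  by rewrite cexp_sqr; congr expR; rewrite /um/=; ring.
by rewrite -h -h'; field.
Qed.

End FockKernel.

(** * The chain rule along lines, from continuous partial derivatives *)

Section ChainRule.
Variable R : realType.
Implicit Types (f fx fy : R * R -> R).

Definition has_partials f fx fy :=
  [/\ forall p : R * R, is_derive p ((1, 0) : R * R) f (fx p),
      forall p : R * R, is_derive p ((0, 1) : R * R) f (fy p),
      continuous fx & continuous fy].

Lemma is_derive_fst f (x y l : R) :
  is_derive x (1 : R) (fun t => f (t, y)) l <-> is_derive (x, y) ((1, 0) : R * R) f l.
Proof.
rewrite !is_deriveP.
suff -> : (fun h => h^-1 *: (f (h *: (1 : R) + x, y) - f (x, y))) =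
   (fun h => h^-1 *: (f (h *: ((1, 0) : R * R) + (x, y)) - f (x, y))) by [].
apply/funext => t; congr (_ *: (f _ - _)).
by congr pair => /=; rewrite scaler0 add0r.
Qed.

Lemma is_derive_snd f (x y l : R) :
  is_derive y (1 : R) (fun t => f (x, t)) l <-> is_derive (x, y) ((0, 1) : R * R) f l.
Proof.
rewrite !is_deriveP.
suff -> : (fun h => h^-1 *: (f (x, h *: (1 : R) + y) - f (x, y))) =
   (fun h => h^-1 *: (f (h *: ((0, 1) : R * R) + (x, y)) - f (x, y))) by [].
apply/funext => t; congr (_ *: (f _ - _)).
by congr pair => /=; rewrite scaler0 add0r.
Qed.

(** Increments have either sign, so the intermediate point is located by its distance to a. *)
Lemma MVT_unordered (g dg : R -> R) (a b : R) :
  (forall t : R, is_derive t (1 : R) g (dg t)) ->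
  exists2 c, `|c - a| <= `|b - a| & g b - g a = dg c * (b - a).
Proof.
move=> dgE; have cg : continuous g.
  by move=> t; exact/differentiable_continuous/derivable1_diffP.
have [ab|/ltW ba] := leP a b.
  have [c] := MVT_segment ab (fun t _ => dgE t) (continuous_subspaceT cg).
  rewrite in_itv/= => /andP[ac cb] ->; exists c => //.
  by rewrite !ger0_norm ?subr_ge0// lerD2r.
have [c] := MVT_segment ba (fun t _ => dgE t) (continuous_subspaceT cg).
rewrite in_itv/= => /andP[bc ca] E; exists c.
  by rewrite !ler0_norm ?subr_le0// lerN2 lerD2r.
by rewrite -opprB E -mulrN opprB.
Qed.

Lemma cvg_pair_ball (f : R * R -> R) (x y e : R) : continuous f -> 0 < e ->
  exists2 d : R, 0 < d & forall x' y', `|x' - x| < d -> `|y' - y| < d ->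
    `|f (x', y') - f (x, y)| < e.
Proof.
move=> cf e0; have := cf (x, y).
move=> /(@cvgrPdist_lt _ _ _ (nbhs (x, y))) /(_ _ e0) /nbhs_ballP[d /= d0 hd].
exists d => // x' y' hx hy; rewrite distrC; apply: hd.
by split; rewrite /ball/= distrC.
Qed.

Lemma chain_rule f fx fy (c1 c2 d1 d2 t : R) : has_partials f fx fy ->
  is_derive t (1 : R) (fun s => f (c1 + s * d1, c2 + s * d2))
    (fx (c1 + t * d1, c2 + t * d2) * d1 + fy (c1 + t * d1, c2 + t * d2) * d2).
Proof.
move=> hf; have [dfx dfy cfx cfy] := hf.
set x := c1 + t * d1; set y := c2 + t * d2.
apply/is_deriveP/cvgrPdist_lt => e e0.
have m0 : 0 < `|d1| + `|d2| + 1 by rewrite ltr_wpDl// addr_ge0.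
have em : 0 < e / (`|d1| + `|d2| + 1) by rewrite divr_gt0.
have [r1 r10 h1] := cvg_pair_ball x y cfx em.
have [r2 r20 h2] := cvg_pair_ball x y cfy em.
near=> h.
have hn0 : h != 0 by near: h; exact: nbhs_dnbhs_neq.
have hr1 : `|h| < r1 / (`|d1| + `|d2| + 1) by near: h; apply: dnbhs0_lt; rewrite divr_gt0.
have hr2 : `|h| < r2 / (`|d1| + `|d2| + 1) by near: h; apply: dnbhs0_lt; rewrite divr_gt0.
have bd r d : `|h| < r / (`|d1| + `|d2| + 1) -> `|d| <= `|d1| + `|d2| + 1 ->
    `|h * d| < r.
  rewrite ltr_pdivlMr// => hr hd; rewrite normrM; apply: le_lt_trans hr.
  by rewrite ler_wpM2l.
have d1m : `|d1| <= `|d1| + `|d2| + 1 by have := normr_ge0 d2; lra.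
have d2m : `|d2| <= `|d1| + `|d2| + 1 by have := normr_ge0 d1; lra.
have -> : c1 + (h *: (1 : R) + t) * d1 = x + h * d1 by rewrite /x scaler1; ring.
have -> : c2 + (h *: (1 : R) + t) * d2 = y + h * d2 by rewrite /y scaler1; ring.
(* The increment is split into a horizontal move at the final height and a vertical move at the
   initial abscissa, with one mean value for each. *)
have [a ha ea] := MVT_unordered (x) (x + h * d1)
  (fun s => (is_derive_fst f s (y + h * d2) _).2 (dfx _)).
have [b hb eb] := MVT_unordered (y) (y + h * d2) (fun s => (is_derive_snd f x s _).2 (dfy _)).
rewrite addrAC subrr add0r in ha ea; rewrite addrAC subrr add0r in hb eb.
have -> : f (x + h * d1, y + h * d2) - f (x, y) =
    fx (a, y + h * d2) * (h * d1) + fy (x, b) * (h * d2).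
  by rewrite -ea -eb; ring.
rewrite (_ : _ - _ = (fx (x, y) - fx (a, y + h * d2)) * d1 +
    (fy (x, y) - fy (x, b)) * d2); last by rewrite /GRing.scale/=; field.
apply: le_lt_trans (ler_normD _ _) _; rewrite !normrM.
have k1 : `|fx (x, y) - fx (a, y + h * d2)| < e / (`|d1| + `|d2| + 1).
  rewrite distrC; apply: h1; first by apply: le_lt_trans ha _; exact: bd.
  by rewrite addrAC subrr add0r; exact: bd.
have k2 : `|fy (x, y) - fy (x, b)| < e / (`|d1| + `|d2| + 1).
  rewrite distrC; apply: h2; first by rewrite subrr normr0.
  by apply: le_lt_trans hb _; exact: bd.
apply: le_lt_trans (lerD (ler_wpM2r (normr_ge0 d1) (ltW k1))
  (ler_wpM2r (normr_ge0 d2) (ltW k2))) _.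
by rewrite -mulrDr -mulrA gtr_pMr// ltr_pdivrMl// mulr1 ltrDl.
Unshelve. all: by end_near. Qed.

End ChainRule.

(** * Mean value property on squares *)

Section MeanValue.
Variable R : realType.
Local Notation leb := (@lebesgue_measure R).
Local Notation I11 := (`[(-1)%R, 1%R]%classic : set R).

Lemma continuous_partials (f fx fy : R * R -> R) : has_partials f fx fy ->
  continuous f.
Proof.
move=> [dfx dfy cfx cfy] [x y].
apply/(@cvgrPdist_lt _ _ _ (nbhs (x, y))) => e e0.
have [r1 r10 h1] := cvg_pair_ball x y cfx ltr01.
have [r2 r20 h2] := cvg_pair_ball x y cfy ltr01.
pose m := `|fx (x, y)| + `|fy (x, y)| + 2.
have m0 : 0 < m by rewrite ltr_wpDl// addr_ge0.
pose d := Num.min (Num.min r1 r2) (e / (2 * m)).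
have d0 : 0 < d by rewrite !lt_min r10 r20 divr_gt0// mulr_gt0.
apply/nbhs_ballP; exists d => // -[x' y'] [/= hx hy]; rewrite distrC.
have {hx} : `|x' - x| < d by rewrite distrC.
have {hy} : `|y' - y| < d by rewrite distrC.
rewrite !lt_min => /andP[/andP[y1 y2] y3] /andP[/andP[x1 x2] x3].
have [a ha ea] := MVT_unordered x x' (fun s => (is_derive_fst f s y' _).2 (dfx _)).
have [b hb eb] := MVT_unordered y y' (fun s => (is_derive_snd f x s _).2 (dfy _)).
have -> : f (x', y') - f (x, y) = fx (a, y') * (x' - x) + fy (x, b) * (y' - y).
  by rewrite -ea -eb; ring.
apply: le_lt_trans (ler_normD _ _) _; rewrite !normrM.
have k1 : `|fx (a, y')| <= m.
  have := h1 a y' (le_lt_trans ha x1) y1.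
  have := ler_distD (fx (x, y)) (fx (a, y')) 0; rewrite !subr0.
  by rewrite /m; have := normr_ge0 (fy (x, y)); lra.
have k2 : `|fy (x, b)| <= m.
  have := h2 x b; rewrite subrr normr0 => /(_ r20 (le_lt_trans hb y2)).
  have := ler_distD (fy (x, y)) (fy (x, b)) 0; rewrite !subr0.
  by rewrite /m; have := normr_ge0 (fx (x, y)); lra.
have -> : e = m * (e / (2 * m)) + m * (e / (2 * m)) by field; rewrite gt_eqF.
apply: ltrD.
  apply: le_lt_trans (ler_wpM2r (normr_ge0 _) k1) _; rewrite ltr_pM2l//.
apply: le_lt_trans (ler_wpM2r (normr_ge0 _) k2) _; rewrite ltr_pM2l//.
Qed.

Lemma continuous_line (f : R * R -> R) (c1 c2 e1 e2 : R) : continuous f ->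
  continuous (fun t : R => f (c1 + t * e1, c2 + t * e2)).
Proof.
move=> cf t.
have l (c e : R) : c + s * e @[s --> t] --> c + t * e.
  have h1 : (cst c : R -> R) @ t --> c by exact: cvg_cst.
  have h2 : (fun s : R => s * e) @ t --> t * e by apply: cvgMr_tmp; exact: cvg_id.
  exact: cvgD h1 h2.
have hc : (c1 + s * e1, c2 + s * e2) @[s --> t] --> (c1 + t * e1, c2 + t * e2).
  exact: (cvg_pair (l c1 e1) (l c2 e2)).
exact: (cvg_comp _ _ hc (cf _)).
Qed.

Lemma integrable_I11 (g : R -> R) : continuous g -> leb.-integrable I11 (EFin \o g).
Proof.
move=> cg; apply: continuous_compact_integrable; first exact: segment_compact.
exact: continuous_subspaceT.
Qed.

Variables (u v a b : R * R -> R).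
Hypothesis hu : has_partials u a (fun p => - b p).
Hypothesis hv : has_partials v b a.
Variables p1 p2 : R.

(* Parametrizes the side [i ^+ k * (1 + i t)], [-1 <= t <= 1], of the square of
   half-side [s] centred at [(p1, p2)]. *)
Let P0 (s t : R) := (p1 + s * 1, p2 + s * t).
Let P1 (s t : R) := (p1 + s * (- t), p2 + s * 1).
Let P2 (s t : R) := (p1 + s * -1, p2 + s * (- t)).
Let P3 (s t : R) := (p1 + s * t, p2 + s * -1).

Definition square_sum (f : R * R -> R) (s t : R) :=
  f (P0 s t) + f (P1 s t) + f (P2 s t) + f (P3 s t).

(* The integral of [h s] is the imaginary part of the integral of
   [(u + i v)(zeta) / (zeta - p)] along this square; it does not depend on [s] because
   its derivative integrand [dh s t] is the [t]-derivative of [square_sum v s t / s]. *)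
Let h (s t : R) : R :=
  (1 + t ^+ 2)^-1 * square_sum u s t + t / (1 + t ^+ 2) * square_sum v s t.
Let dh (s t : R) : R := a (P0 s t) - b (P1 s t) - a (P2 s t) + b (P3 s t).

Let t2_neq0 (t : R) : 1 + t ^+ 2 != 0.
Proof. by rewrite gt_eqF// ltr_wpDr// sqr_ge0. Qed.

Let h_derive s t : is_derive s (1 : R) (fun s => h s t) (dh s t).
Proof.
have u0 := chain_rule p1 p2 1 t s hu; have v0 := chain_rule p1 p2 1 t s hv.
have u1 := chain_rule p1 p2 (- t) 1 s hu; have v1 := chain_rule p1 p2 (- t) 1 s hv.
have u2 := chain_rule p1 p2 (- 1) (- t) s hu.
have v2 := chain_rule p1 p2 (- 1) (- t) s hv.
have u3 := chain_rule p1 p2 t (- 1) s hu; have v3 := chain_rule p1 p2 t (- 1) s hv.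
rewrite /h /square_sum /P0 /P1 /P2 /P3.
apply: is_derive_eq; rewrite /GRing.scale/= /dh /P0 /P1 /P2 /P3.
set x0 := a _; set x1 := b _; set x2 := a _; set x3 := b _.
by field.
Qed.

Let line_continuous (f : R * R -> R) s : continuous f ->
  [/\ continuous (fun t => f (P0 s t)), continuous (fun t => f (P1 s t)),
      continuous (fun t => f (P2 s t)) & continuous (fun t => f (P3 s t))].
Proof.
move=> cf; split.
- rewrite (_ : (fun t => f _) = (fun t => f (p1 + s + t * 0, p2 + t * s))).
    exact: continuous_line.
  by apply/funext => t; congr f; congr pair; ring.
- rewrite (_ : (fun t => f _) = (fun t => f (p1 + t * - s, p2 + s + t * 0))).
    exact: continuous_line.
  by apply/funext => t; congr f; congr pair; ring.
- rewrite (_ : (fun t => f _) = (fun t => f (p1 - s + t * 0, p2 + t * - s))).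
    exact: continuous_line.
  by apply/funext => t; congr f; congr pair; ring.
- rewrite (_ : (fun t => f _) = (fun t => f (p1 + t * s, p2 - s + t * 0))).
    exact: continuous_line.
  by apply/funext => t; congr f; congr pair; ring.
Qed.

Lemma continuous_square_sum (f : R * R -> R) s : continuous f ->
  continuous (square_sum f s).
Proof.
move=> cf t; have [h0 h1 h2 h3] := line_continuous s cf.
by do !apply: cvgD; [exact: h0|exact: h1|exact: h2|exact: h3].
Qed.

Let inv_continuous : continuous (fun t : R => (1 + t ^+ 2)^-1).
Proof.
move=> t; apply: cvgV => //; apply: cvgD; first exact: cvg_cst.
exact: exprn_continuous.
Qed.

Let h_continuous s : continuous (h s).
Proof.
have cu := @continuous_square_sum _ s (continuous_partials hu).
have cv := @continuous_square_sum _ s (continuous_partials hv).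
move=> t; apply: cvgD; apply: cvgM.
- exact: inv_continuous.
- exact: cu.
- by apply: cvgM; [exact: cvg_id|exact: inv_continuous].
- exact: cv.
Qed.

Let dh_continuous s : continuous (dh s).
Proof.
have [_ _ cb ca] := hv; move=> t.
have [a0 _ a2 _] := line_continuous s ca; have [_ b1 _ b3] := line_continuous s cb.
apply: cvgD; last exact: b3.
by apply: cvgB; [apply: cvgB; [exact: a0|exact: b1]|exact: a2].
Qed.

(** Supplies the dominating constant in [int_h]. *)
Lemma bounded_box (f : R * R -> R) (r : R) : continuous f -> 0 <= r ->
  exists M, forall x y, `|x - p1| <= r -> `|y - p2| <= r -> `|f (x, y)| <= M.
Proof.
move=> cf r0.
pose K := (`[p1 - r, p1 + r] `*` `[p2 - r, p2 + r])%classic : set (R * R).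
have cK : compact K by apply: compact_setX; exact: segment_compact.
have K0 : K !=set0.
  by exists (p1, p2); split; rewrite /= in_itv/=; apply/andP; split; lra.
have cnf : {within K, continuous (fun p => `|f p| : R)}.
  apply: continuous_subspaceT => p.
  exact: (cvg_comp _ _ (cf p) (@norm_continuous _ R^o (f p))).
have [c _ hc] := compact_EVT_max K0 cK cnf.
exists `|f c| => x y hx hy; apply: hc; rewrite inE; split => /=; rewrite in_itv/=.
  by move: hx; rewrite ler_norml; lra.
by move: hy; rewrite ler_norml; lra.
Qed.

Let int_dh s : \int[leb]_(t in I11) dh s t = 0.
Proof.
(* At s = 0 the four points coincide and the terms of [dh] cancel. *)
have [s0|s0] := eqVneq s 0.
  rewrite (@eq_Rintegral _ _ _ leb I11 (fun=> 0)) ?Rintegral_cst ?mul0r//.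
  by move=> t _; rewrite /dh /P0 /P1 /P2 /P3 s0 !mul0r; ring.
pose F t := s^-1 * square_sum v s t.
have dF (t : R) : is_derive t (1 : R) F (dh s t).
  have v0 := chain_rule (p1 + s) p2 0 s t hv.
  have v1 := chain_rule p1 (p2 + s) (- s) 0 t hv.
  have v2 := chain_rule (p1 - s) p2 0 (- s) t hv.
  have v3 := chain_rule p1 (p2 - s) s 0 t hv.
  have -> : F = fun t => s^-1 * (v (p1 + s + t * 0, p2 + t * s) +
      v (p1 + t * - s, p2 + s + t * 0) + v (p1 - s + t * 0, p2 + t * - s) +
      v (p1 + t * s, p2 - s + t * 0)).
    apply/funext => r; rewrite /F /square_sum; congr (_ * (v _ + v _ + v _ + v _));
    by congr pair; ring.
  apply: is_derive_eq.
  have e0 : (p1 + s + t * 0, p2 + t * s) = P0 s t by congr pair; ring.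
  have e1 : (p1 + t * - s, p2 + s + t * 0) = P1 s t by congr pair; ring.
  have e2 : (p1 - s + t * 0, p2 + t * - s) = P2 s t by congr pair; ring.
  have e3 : (p1 + t * s, p2 - s + t * 0) = P3 s t by congr pair; ring.
  rewrite e0 e1 e2 e3 /GRing.scale/= /dh; by field.
have cF : continuous F.
  by move=> t; exact/differentiable_continuous/derivable1_diffP.
have := @continuous_FTC2 R (dh s) F (-1) 1.
rewrite /Rintegral => -> //=.
(* The sides join up: the end of each at t = 1 is the start of the next at t = -1, so the primitive
   takes equal values at both ends. *)
- rewrite /F /square_sum /P0 /P1 /P2 /P3.
  by rewrite !mulrN !mulr1 !opprK; ring.
- exact/continuous_subspaceT/dh_continuous.
- split.
  + by move=> t _; have [] := dF t.
  + exact/cvg_at_right_filter/cF.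
  + exact/cvg_at_left_filter/cF.
- by move=> t _; rewrite derive1E; have [_ ->] := dF t.
Qed.

(** The derivative in s is the integral of [dh], which is 0. The constant dominating it near s comes
    from the box of half-side |s| + 1, which contains every square with half-side in ]s - 1, s +
    1[. *)
Let int_h s : \int[leb]_(t in I11) h s t = \int[leb]_(t in I11) h 0 t.
Proof.
apply: (@is_derive_0_is_cst R (fun s => \int[leb]_(t in I11) h s t)) => {}s.
have [_ _ cb ca] := hv.
have r0 : 0 <= `|s| + 1 by rewrite addr_ge0.
have [Ma hMa] := bounded_box ca r0; have [Mb hMb] := bounded_box cb r0.
have M0 : 0 <= 2 * Ma + 2 * Mb.
  have z : `|p1 - p1| <= `|s| + 1 by rewrite subrr normr0.
  have z' : `|p2 - p2| <= `|s| + 1 by rewrite subrr normr0.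
  by have := le_trans (normr_ge0 _) (hMa _ _ z z');
    have := le_trans (normr_ge0 _) (hMb _ _ z z'); lra.
have dhE x y : partial1of2 h x y = dh x y.
  by rewrite partial1of2E; have [_ ->] := h_derive x y.
have mI : measurable (I11 : set (measurableTypeR R)) by exact: measurable_itv.
have Ia : `]s - 1, s + 1[%classic s by rewrite /= in_itv/=; lra.
have hint x : `]s - 1, s + 1[%classic x -> leb.-integrable I11 (EFin \o h x).
  by move=> _; apply: integrable_I11; exact: h_continuous.
have hder x y : `]s - 1, s + 1[%classic x -> I11 y -> derivable (h^~ y) x 1.
  by move=> _ _; have [] := h_derive x y.
have Gint : leb.-integrable I11 (EFin \o (fun=> 2 * Ma + 2 * Mb)).
  by apply: integrable_I11; exact: cst_continuous.
have bd x y : `]s - 1, s + 1[%classic x -> I11 y ->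
    `|partial1of2 h x y| <= 2 * Ma + 2 * Mb.
  rewrite dhE /= !in_itv/= => hx hy.
  have xs : `|x| <= `|s| + 1.
    have := ler_normD (x - s) s; rewrite subrK.
    have : `|x - s| <= 1 by rewrite ler_norml; lra.
    lra.
  have q1 (c : R) : `|c| <= 1 -> `|x * c| <= `|s| + 1.
    by move=> c1; rewrite normrM; apply: le_trans xs; rewrite ler_piMr.
  have c1 : `|1 : R| <= 1 by rewrite normr1.
  have c2 : `|- 1 : R| <= 1 by rewrite normrN normr1.
  have c3 : `|y| <= 1 by rewrite ler_norml.
  have c4 : `|- y| <= 1 by rewrite normrN.
  have pt f M (c d : R) : (forall x y, `|x - p1| <= `|s| + 1 ->
      `|y - p2| <= `|s| + 1 -> `|f (x, y)| <= M) ->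
      `|c| <= 1 -> `|d| <= 1 -> `|f (p1 + x * c, p2 + x * d) : R| <= M.
    by move=> hM hc hd; apply: hM; rewrite addrAC subrr add0r q1.
  rewrite /dh; apply: le_trans (ler_normD _ _) _.
  have := pt _ _ _ _ hMb c3 c2; rewrite -/(P3 x y) => k3.
  have := pt _ _ _ _ hMa c2 c4; rewrite -/(P2 x y) => k2.
  have := pt _ _ _ _ hMb c4 c1; rewrite -/(P1 x y) => k1.
  have := pt _ _ _ _ hMa c1 c3; rewrite -/(P0 x y) => k0.
  have := ler_normB (a (P0 x y) - b (P1 x y)) (a (P2 x y)).
  have := ler_normB (a (P0 x y)) (b (P1 x y)).
  by lra.
split.
  exact: (derivable_under_integral mI Ia hint hder (fun=> M0) Gint bd).
have := differentiation_under_integral mI Ia hint hder (fun=> M0) Gint bd.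
rewrite derive1E => ->.
rewrite -[RHS](int_dh s); apply: eq_Rintegral => t _; exact: dhE.
Qed.

(** The square is shrunk to its centre. [square_submean] arranges v(p) = 0 by multiplying with the
    conjugate of the value at p. *)
Lemma holo_mean_value s : v (p1, p2) = 0 ->
  \int[leb]_(t in I11) ((1 + t ^+ 2)^-1 * square_sum u s t +
     t / (1 + t ^+ 2) * square_sum v s t) =
  \int[leb]_(t in I11) (4 * u (p1, p2) / (1 + t ^+ 2)).
Proof.
move=> v0; rewrite (int_h s); apply: eq_Rintegral => t _.
rewrite /h /square_sum /P0 /P1 /P2 /P3 !mul0r !addr0 v0; ring.
Qed.

End MeanValue.

(** * Open sets and continuous functions of the plane are measurable *)

Section PlaneMeasurability.
Variable R : realType.
Local Notation mR := (measurableTypeR R).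

(** The sigma-algebra here is the product one; an open set belongs to it as a countable union of
    rational boxes. *)
Lemma open_measurable_plane (O : set (R * R)) : open O ->
  measurable (O : set (mR * mR)).
Proof.
move=> oO.
pose box (c : rat * rat * nat) : set (mR * mR) :=
  ball (ratr c.1.1 : R) (c.2.+1%:R^-1) `*` ball (ratr c.1.2 : R) (c.2.+1%:R^-1).
have mbox c : measurable (box c).
  by apply: measurableX; apply: open_measurable; exact: ball_open.
rewrite [X in measurable X](_ : _ = \bigcup_(c in [set c | box c `<=` O]) box c).
  rewrite bigcup_mkcond; apply: countable_bigcupT_measurable => // c.
  by case: ifPn => // _; exact: mbox.
apply/seteqP; split=> [[x y] /= Oxy|p [c /= cO pc]]; last exact: cO.
have [e /= e0 eO] : exists2 e : R, 0 < e & ball (x, y) e `<=` O.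
  by move/nbhs_ballP : (open_nbhs_nbhs (conj oO Oxy)).
have [n n4] : exists n : nat, n.+1%:R^-1 < e / 2.
  have e4 : 0 < e / 2 by exact: divr_gt0.
  near \oo => n; exists n; near: n; exact: near_infty_natSinv_lt (PosNum e4).
have i0 : 0 < (n.+1%:R^-1 : R) by rewrite invr_gt0.
have rx (t : R) : exists q : rat, `|ratr q - t| < n.+1%:R^-1.
  have [q] : exists q, ratr q \in `]t - n.+1%:R^-1, t + n.+1%:R^-1[.
    by apply: rat_in_itvoo; rewrite ltrD2l gtrN.
  by rewrite in_itv/= => ?; exists q; rewrite distrC ltr_distlC.
have [q hq] := rx x; have [r hr] := rx y.
exists (q, r, n) => //= -[x' y'] [/=]; rewrite /ball/= => hx hy; apply: eO.
have tri (t t' s : R) : `|s - t| < n.+1%:R^-1 -> `|s - t'| < n.+1%:R^-1 ->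
    `|t - t'| < e.
  move=> h1 h2; rewrite (_ : t - t' = (s - t') - (s - t)); last by ring.
  apply: le_lt_trans (ler_normB _ _) _.
  by move: h1 h2 n4; move: (n.+1%:R^-1) => i; lra.
by split; rewrite /ball/=; [exact: tri hq hx|exact: tri hr hy].
Unshelve. all: end_near. Qed.

Lemma continuous_measurable_plane (f : R * R -> R) : continuous f ->
  measurable_fun [set: mR * mR] (f : mR * mR -> R).
Proof.
move=> cf; apply: (measurability _ (RGenOpens.measurableE R)) => /=.
move=> _ [_ [a [b ->]] <-]; rewrite setTI.
apply: open_measurable_plane; apply: open_comp => [p _|]; first exact: cf.
exact: interval_open.
Qed.

Definition sbox (s : R) (p : R * R) : set (mR * mR) :=
  [set n | `|n.1 - p.1| <= s /\ `|n.2 - p.2| <= s].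

Lemma sboxE s p : sbox s p = (`[p.1 - s, p.1 + s] `*` `[p.2 - s, p.2 + s])%classic.
Proof.
apply/seteqP; split => -[x y] [/=].
  by rewrite !ler_norml => h1 h2; split; rewrite /= in_itv/=; lra.
by rewrite !in_itv/= => h1 h2; split; rewrite /= ler_norml; lra.
Qed.

Lemma measurable_sbox s p : measurable (sbox s p).
Proof. by rewrite sboxE; apply: measurableX; exact: measurable_itv. Qed.

End PlaneMeasurability.

(** * Sub-mean value inequality on boxes *)

Section SubMeanValue.
Variable R : realType.
Local Notation mR := (measurableTypeR R).
Local Notation leb := (@lebesgue_measure R).
Local Notation plane := (@plane_measure R).
Local Notation I11 := (`[(-1)%R, 1%R]%classic : set R).

Lemma has_partials_lin (f g fx gx fy gy : R * R -> R) (c d : R) :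
  has_partials f fx fy -> has_partials g gx gy ->
  has_partials (fun p => c * f p + d * g p) (fun p => c * fx p + d * gx p)
    (fun p => c * fy p + d * gy p).
Proof.
move=> [f1 f2 cfx cfy] [g1 g2 cgx cgy].
have dl (v p : R * R) l l' : is_derive p v f l -> is_derive p v g l' ->
    is_derive p v (fun p => c * f p + d * g p) (c * l + d * l').
  by move=> hf hg; apply: is_derive_eq; rewrite /GRing.scale/=; ring.
split=> [p|p|p|p]; [exact: dl|exact: dl| |].
  by apply: cvgD; apply: cvgMl_tmp; [exact: cfx|exact: cgx].
by apply: cvgD; apply: cvgMl_tmp; [exact: cfy|exact: cgy].
Qed.

(** F in the coordinates (s, t) of the point c + s (e1, e2 t), with the Jacobian |s|; fixing s and
    letting t run over [-1, 1] traces one side of a square. *)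
Let cone (F : mR * mR -> \bar R) (c1 c2 e1 e2 : R) (m : mR * mR) : \bar R :=
  (`|m.1|%:E * F ((c1 + m.1 * e1)%R, (c2 + m.1 * (e2 * m.2))%R))%E.

Let measurable_cone F c1 c2 e1 e2 : measurable_fun setT F ->
  measurable_fun setT (cone F c1 c2 e1 e2).
Proof.
move=> mF; apply: emeasurable_funM.
  by apply/measurable_EFinP; apply: measurableT_comp => //; exact: measurable_fst.
apply: (measurableT_comp mF); apply: measurable_fun_pair => /=.
  by apply: measurable_funD => //; apply: measurable_funM => //; exact: measurable_fst.
apply: measurable_funD => //; apply: measurable_funM; first exact: measurable_fst.
by apply: measurable_funM => //; exact: measurable_snd.
Qed.

Let cone_ge0 F c1 c2 e1 e2 m : (forall p, 0 <= F p)%E -> (0 <= cone F c1 c2 e1 e2 m)%E.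
Proof. by move=> F0; rewrite mule_ge0// lee_fin. Qed.

(** Substitute y = c2 + s e2 t for fixed s, then x = c1 + s e1. Stating an inequality disposes of s
    = 0, where the left integrand vanishes. *)
Let integral_cone_le (F : mR * mR -> \bar R) (c1 c2 e1 e2 : R) :
  measurable_fun setT F -> (forall p, 0 <= F p)%E -> `|e1| = 1 -> `|e2| = 1 ->
  (\int[plane]_m cone F c1 c2 e1 e2 m <= \int[leb]_x \int[leb]_y F (x, y))%E.
Proof.
move=> mF F0 e11 e21.
rewrite [leLHS](fubini_tonelli1 _ (measurable_cone _ _ _ _ mF)) => [|m]; last exact: cone_ge0.
rewrite /fubini_F /cone /=.
have e10 : e1 != 0 by rewrite -normr_gt0 e11.
have mF2 x : measurable_fun [set: mR] (fun y => F (x, y)).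
  exact: (measurableT_comp mF (measurable_pair1 x)).
have mPsi : measurable_fun [set: mR] (fun x => \int[leb]_y F (x, y))%E.
  exact: (measurable_fun_fubini_tonelli_F F mF F0).
rewrite -[leRHS](@ge0_integral_affine R c1 e1)//; last first.
  by move=> x; exact: integral_ge0.
rewrite e11 mule1; apply: integral_monoT => s.
  by apply: integral_ge0 => t _; rewrite mule_ge0// lee_fin.
have [->|sn0] := eqVneq s 0.
  under eq_integral do rewrite normr0 mul0e.
  by rewrite integral0; exact: integral_ge0.
have se : s * e2 != 0 by rewrite mulf_neq0// -normr_gt0 e21.
rewrite -(ge0_integral_affine c2 se (mF2 _))//.
rewrite normrM e21 mulr1 muleC -ge0_integralZl ?lee_fin//; last first.
  exact: (measurableT_comp (mF2 _) (measurable_affine _ _)).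
rewrite le_eqVlt; apply/orP; left; apply/eqP; apply: eq_integral => t _.
by rewrite /affine (mulrC e1) mulrA.
Qed.

Variables (u v a b : R * R -> R).
Hypothesis hu : has_partials u a (fun p => - b p).
Hypothesis hv : has_partials v b a.

Let W p := u p ^+ 2 + v p ^+ 2.

Let continuousW : continuous W.
Proof.
have cu := continuous_partials hu; have cv := continuous_partials hv.
move=> p; apply: cvgD.
  exact: (cvg_comp _ _ (cu p) (@exprn_continuous _ 2 (u p))).
exact: (cvg_comp _ _ (cv p) (@exprn_continuous _ 2 (v p))).
Qed.

Let sum4 (w x0 x1 x2 x3 y0 y1 y2 y3 : R) : x0 <= w / 4 + y0 -> x1 <= w / 4 + y1 ->
  x2 <= w / 4 + y2 -> x3 <= w / 4 + y3 -> x0 + x1 + x2 + x3 <= w + (y0 + y1 + y2 + y3).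
Proof. lra. Qed.

Let absorb (w y : R) : 2 * w * 2 <= w * 2 + y -> 2 * w <= y.
Proof. lra. Qed.

(** The mean value property for F = u + i v times the conjugate of F(p), whose imaginary part
    vanishes at p and whose real part there is W(p). Integrated over [-1, 1], it reads 4 W(p) <= 2
    W(p) + int W, and half of the left side is absorbed. *)
Lemma square_submean p1 p2 s :
  2 * W (p1, p2) <= \int[leb]_(t in I11) square_sum p1 p2 W s t.
Proof.
pose u0 := u (p1, p2); pose v0 := v (p1, p2); pose w0 := W (p1, p2).
have w00 : 0 <= w0 by rewrite addr_ge0 ?sqr_ge0.
have hm := has_partials_lin u0 v0 hu hv.
have hn := has_partials_lin u0 (- v0) hv hu.
have := @holo_mean_value R (fun p => u0 * u p + v0 * v p)
  (fun p => u0 * v p + - v0 * u p) (fun p => u0 * a p + v0 * b p)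
  (fun p => u0 * b p + - v0 * a p) _ _ p1 p2 s.
have E1 : (fun p => u0 * (- b p) + v0 * a p) = (fun p => - (u0 * b p + - v0 * a p)).
  by apply/funext => p; ring.
have E2 : (fun p => u0 * a p + - v0 * (- b p)) = (fun p => u0 * a p + v0 * b p).
  by apply/funext => p; ring.
rewrite -E1 => /(_ hm); rewrite -{1}E2 => /(_ hn) /=.
have -> : u0 * v (p1, p2) + - v0 * u (p1, p2) = 0 by rewrite /u0 /v0; ring.
move=> /(_ erefl); set m := (fun p => u0 * u p + v0 * v p).
set n := (fun p => u0 * v p + - v0 * u p) => E.
have cW := @continuous_square_sum R p1 p2 W s continuousW.
have mI : measurable (I11 : set mR) by exact: measurable_itv.
have lI : fine (leb I11) = 2.
  by rewrite lebesgue_measure_itv/= lte_fin ifT; [rewrite -EFinD/=; lra|lra].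
have cinv : continuous (fun t : R => (1 + t ^+ 2)^-1).
  move=> t; apply: cvgV; first by rewrite gt_eqF// ltr_wpDr// sqr_ge0.
  by apply: cvgD; [exact: cvg_cst|exact: exprn_continuous].
have cm : continuous m by exact: continuous_partials hm.
have cn : continuous n by exact: continuous_partials hn.
pose f2 t := (1 + t ^+ 2)^-1 * square_sum p1 p2 m s t +
  t / (1 + t ^+ 2) * square_sum p1 p2 n s t.
have cf2 : continuous f2.
  move=> t; apply: cvgD; apply: cvgM.
  - exact: cinv.
  - exact: continuous_square_sum.
  - by apply: cvgM; [exact: cvg_id|exact: cinv].
  - exact: continuous_square_sum.
have t1_gt0 (t : R) : 0 < 1 + t ^+ 2 by rewrite ltr_wpDr// sqr_ge0.
(* On [-1, 1] the weight 4 / (1 + t^2) is at least 2. *)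
have ge2 : \int[leb]_(t in I11) (2 * w0) <=
    \int[leb]_(t in I11) (4 * m (p1, p2) / (1 + t ^+ 2)).
  apply: le_Rintegral => //.
  - by apply: integrable_I11; exact: cst_continuous.
  - by apply: integrable_I11 => t; apply: cvgM; [exact: cvg_cst|exact: cinv].
  - move=> t; rewrite /= in_itv/= => /andP[t1 t2].
    have -> : m (p1, p2) = w0 by rewrite /m /w0 /W -/u0 -/v0; ring.
    rewrite ler_pdivlMr//.
    have : t ^+ 2 <= 1 by nra.
    by move=> t21; have := ler_wpM2l w00 t21; lra.
(* AM-GM with weight 1/4 per side, so that the four sides together cost a single w0 against the
   lower bound 2 w0. *)
have pt (t x y : R) : (1 + t ^+ 2)^-1 * (u0 * x + v0 * y) +
    t / (1 + t ^+ 2) * (u0 * y + - v0 * x) <= w0 / 4 + (x ^+ 2 + y ^+ 2).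
  have -> : (1 + t ^+ 2)^-1 * (u0 * x + v0 * y) +
    t / (1 + t ^+ 2) * (u0 * y + - v0 * x) =
    (u0 * (x + t * y) + v0 * (y - t * x)) / (1 + t ^+ 2).
    by field; rewrite gt_eqF.
  rewrite ler_pdivrMr//.
  have h1 := sqr_ge0 (u0 / 2 - (x + t * y)); have h2 := sqr_ge0 (v0 / 2 - (y - t * x)).
  have h3 : 0 <= w0 * t ^+ 2 by rewrite mulr_ge0// sqr_ge0.
  have e0 : w0 = u0 ^+ 2 + v0 ^+ 2 by [].
  have e : (w0 / 4 + (x ^+ 2 + y ^+ 2)) * (1 + t ^+ 2) -
      (u0 * (x + t * y) + v0 * (y - t * x)) =
      (u0 / 2 - (x + t * y)) ^+ 2 + (v0 / 2 - (y - t * x)) ^+ 2 + w0 * t ^+ 2 / 4.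
    by rewrite e0; field.
  by rewrite -subr_ge0 e !addr_ge0// divr_ge0.
have le3 : \int[leb]_(t in I11) f2 t <=
    \int[leb]_(t in I11) (w0 + square_sum p1 p2 W s t).
  apply: le_Rintegral => //.
  - exact: integrable_I11.
  - by apply: integrable_I11 => t; apply: cvgD; [exact: cvg_cst|exact: cW].
  - move=> t _; rewrite /f2 /square_sum /m /n.
    set q0 := (_, _); set q1 := (_, _); set q2 := (_, _); set q3 := (_, _).
    apply: le_trans (sum4 (pt t (u q0) (v q0)) (pt t (u q1) (v q1))
      (pt t (u q2) (v q2)) (pt t (u q3) (v q3))).
    by rewrite le_eqVlt; apply/orP; left; apply/eqP; ring.
move: ge2; rewrite -E => /le_trans/(_ le3).
rewrite RintegralD//; last 2 first.
- by apply: integrable_I11; exact: cst_continuous.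
- exact: integrable_I11.
by rewrite !Rintegral_cst// lI -/w0; exact: absorb.
Qed.

(** Integrate s times [square_submean] over 1/2 <= s <= 1, the factor s being the Jacobian of
    [cone]. Each of the four sides contributes at most the integral over the box, so W(p) / 2 is at
    most four times that integral, whence 8. *)
Lemma submean p :
  ((W p)%:E <= 8%:E * \int[@plane_measure R]_(m in sbox 1 p) (W m)%:E)%E.
Proof.
case: p => p1 p2.
pose F : mR * mR -> \bar R := (fun m => (W m)%:E) \_ (sbox 1 (p1, p2)).
have W0 m : 0 <= W m by rewrite addr_ge0 ?sqr_ge0.
have mF : measurable_fun setT F.
  apply/(measurable_restrictT _ (measurable_sbox _ _)).
  apply: measurable_funTS; apply/measurable_EFinP.
  exact: continuous_measurable_plane.
have F0 m : (0 <= F m)%E by apply: erestrict_ge0 => ? _; rewrite lee_fin.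
rewrite integral_mkcond -/F.
set J := (\int[@plane_measure R]_m F m)%E.
have J1 : J = (\int[leb]_x \int[leb]_y F (x, y))%E.
  exact: (fubini_tonelli1 F mF F0).
have J2 : J = (\int[leb]_y \int[leb]_x F (x, y))%E.
  exact: (fubini_tonelli2 F mF F0).
(* On the two horizontal sides it is the second coordinate that depends on s alone, hence the
   exchange. *)
pose F' : mR * mR -> \bar R := fun m => F (m.2, m.1).
have mF' : measurable_fun setT F'.
  apply: (measurableT_comp mF).
  by apply: measurable_fun_pair; [exact: measurable_snd|exact: measurable_fst].
have F0' m : (0 <= F' m)%E by exact: F0.
have n1 : `|1 : R| = 1 by exact: normr1.
have n2 : `|-1 : R| = 1 by rewrite normrN normr1.
have mC c1 c2 e1 e2 := measurable_cone c1 c2 e1 e2 mF.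
have mC' c1 c2 e1 e2 := measurable_cone c1 c2 e1 e2 mF'.
have C0 c1 c2 e1 e2 m := cone_ge0 c1 c2 e1 e2 m F0.
have C0' c1 c2 e1 e2 m := cone_ge0 c1 c2 e1 e2 m F0'.
pose S m := (cone F p1 p2 1%R 1%R m + cone F' p2 p1 1%R (-1)%R m +
  cone F p1 p2 (-1)%R (-1)%R m + cone F' p2 p1 (-1)%R 1%R m)%E.
have S0 m : (0 <= S m)%E.
  exact: adde_ge0 (adde_ge0 (adde_ge0 (C0 _ _ _ _ _) (C0' _ _ _ _ _)) (C0 _ _ _ _ _))
    (C0' _ _ _ _ _).
have mS : measurable_fun setT S.
  exact: (emeasurable_funD (emeasurable_funD (emeasurable_funD (mC _ _ _ _)
    (mC' _ _ _ _)) (mC _ _ _ _)) (mC' _ _ _ _)).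
have SJ : (\int[leb]_s \int[leb]_t S (s, t) <= 4%:E * J)%E.
  have <- : (\int[plane]_m S m = \int[leb]_s \int[leb]_t S (s, t))%E.
    exact: (fubini_tonelli1 S mS S0).
  rewrite /S ge0_integralD4//.
  apply: (@le_trans _ _ (J + J + J + J)%E).
    by apply: leeD; [apply: leeD; [apply: leeD|]|]; [rewrite J1|rewrite J2|rewrite J1|rewrite J2];
      exact: integral_cone_le.
  have J0 : (0 <= J)%E by exact: integral_ge0.
  rewrite (_ : 4 = 1 + 1 + 1 + 1); last by ring.
  by rewrite !EFinD !ge0_muleDl ?lee_fin// ?mul1e.
(* For s >= 1/2 the bound s times 2 W(p) is at least W(p), and [1/2, 1] has length 1/2. *)
have WS : ((W (p1, p2) / 2)%:E <= \int[leb]_s \int[leb]_t S (s, t))%E.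
  apply: (@le_trans _ _ (\int[leb]_(s in `[2^-1%R, 1%R]) (W (p1, p2))%:E)%E).
    rewrite integral_cst//= lebesgue_measure_itv/= lte_fin ifT; last by lra.
    by rewrite -EFinD -EFinM lee_fin; lra.
  apply: (@le_trans _ _ (\int[leb]_(s in `[2^-1%R, 1%R]) \int[leb]_t S (s, t))%E); last first.
    by apply: integral_subset => // s _; exact: integral_ge0.
  apply: integral_mono => [s _|s /=]; first by rewrite lee_fin.
  rewrite in_itv/= => /andP[s2 s1].
  apply: (@le_trans _ _ (\int[leb]_(t in I11) S (s, t))%E); last first.
    exact: integral_subset.
  have cW := @continuous_square_sum R p1 p2 W s continuousW.
  have iW := integrable_I11 cW.
  have SS0 t : 0 <= square_sum p1 p2 W s t.
    by rewrite /square_sum !addr_ge0// ?sqr_ge0.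
  have s0 : 0 <= s by lra.
  apply: (@le_trans _ _ (\int[leb]_(t in I11) (s * square_sum p1 p2 W s t)%:E)%E).
    under eq_integral do rewrite EFinM.
    have mQ : measurable_fun I11 (fun t => (square_sum p1 p2 W s t)%:E).
      by have /integrableP[] := iW.
    have Q0 t : I11 t -> (0 <= (square_sum p1 p2 W s t)%:E)%E.
      by move=> _; rewrite lee_fin SS0.
    rewrite [leRHS](_ : _ =
        s%:E * \int[leb]_(t in I11) (square_sum p1 p2 W s t)%:E)%E; last first.
      by apply: ge0_integralZl => //; rewrite lee_fin.
    have := square_submean p1 p2 s.
    rewrite -lee_fin /Rintegral fineK; last exact: integrable_fin_num.
    move=> h; apply: le_trans (lee_wpmul2l _ h); last by rewrite lee_fin.
    by rewrite -EFinM lee_fin; have := W0 (p1, p2); nra.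
  apply: integral_mono => t /=.
    by rewrite lee_fin mulr_ge0.
  rewrite in_itv/= => /andP[t1 t2].
  have ts : `|s * t| <= 1
    by rewrite normrM (ger0_norm s0); have : `|t| <= 1 by [rewrite ler_norml t1|]; nra.
  rewrite /square_sum mulrDr mulrDr mulrDr.
  have FE x y : `|x - p1| <= 1 -> `|y - p2| <= 1 -> F (x, y) = (W (x, y))%:E.
    by move=> hx hy; rewrite /F patchE mem_set.
  have sh (c e : R) : `|s * e| <= 1 -> `|c + s * e - c| <= 1.
    by rewrite addrAC subrr add0r.
  have hs1 : `|s * 1| <= 1 by rewrite mulr1 ger0_norm.
  have hs2 : `|s * -1| <= 1 by rewrite mulrN1 normrN ger0_norm.
  have hs4 : `|s * - t| <= 1 by rewrite mulrN normrN.
  rewrite /S /cone /F' /= !mul1r !mulN1r !FE ?sh// (ger0_norm s0).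
  by rewrite -!EFinM -!EFinD.
have := le_trans WS SJ; rewrite -(@lee_pmul2l _ 2%:E)// ?lte_fin// muleA -!EFinM.
by rewrite mulrC divfK// -natrM.
Qed.

End SubMeanValue.

(** * Integration against the sphere measure and [dV] *)

Section SphereIntegral.
Variable R : realType.
Local Notation H := (quat R).
Local Notation mR := (measurableTypeR R).
Local Notation leb := (@lebesgue_measure R).
Local Notation plane := (@plane_measure R).
Local Notation angles := (@angles R).

Lemma measurable_angles : measurable angles.
Proof. by apply: measurableX; exact: measurable_itv. Qed.

Definition sphere_dens (t : mR * mR) : R := sin t.1 / (4 * pi).

Lemma sphere_dens_ge0 t : angles t -> 0 <= sphere_dens t.
Proof.
move=> [/= t1 _]; rewrite divr_ge0 ?mulr_ge0 ?pi_ge0//.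
by apply: sin_ge0_pi; move: t1; rewrite in_itv.
Qed.

Lemma measurable_sphere_dens : measurable_fun [set: mR * mR] sphere_dens.
Proof.
apply: measurable_funM => //.
apply: (measurableT_comp _ measurable_fst).
by apply: continuous_measurable_fun; exact: continuous_sin.
Qed.

Lemma ge0_integral_sphere (g : H -> \bar R) : measurable_fun setT g ->
  (forall I, 0 <= g I)%E ->
  (\int[@sphere_measure R]_I g I =
   \int[plane]_(t in angles) (g (sphere_pt t) * (sphere_dens t)%:E))%E.
Proof.
apply: ge0_integral_density.
- exact: measurable_angles.
- exact: measurable_sphere_pt.
- by apply: measurable_funTS; exact: measurable_sphere_dens.
- exact: sphere_dens_ge0.
- by [].
Qed.

Lemma sphere_measure_fin : (@sphere_measure R setT < +oo)%E.
Proof.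
rewrite /sphere_measure setIT.
apply: (@le_lt_trans _ _ (\int[plane]_(t in angles) (1 / (4 * pi))%:E)%E).
  apply: integral_mono => t ta; first by rewrite lee_fin; exact: sphere_dens_ge0.
  by rewrite lee_fin ler_wpM2r ?invr_ge0 ?mulr_ge0 ?pi_ge0// sin_le1.
rewrite integral_cst; last exact: measurable_angles.
apply: lte_mul_pinfty => //; first by rewrite lee_fin divr_ge0 ?mulr_ge0 ?pi_ge0.
rewrite -[X in (X < _)%E]/((leb \x leb)%E
  (`[0%R, pi]%classic `*` `[0%R, (2 * pi)%R]%classic))
  product_measure1E//; [|exact: measurable_itv..].
rewrite /= !lebesgue_measure_itv/=; case: ifPn => _; case: ifPn => _ //;
  by rewrite ?mule0 ?mul0e// -?EFinD -?EFinM ltry.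
Qed.

Let sphere_sigma_finite : sigma_finite setT (@sphere_measure R).
Proof.
exists (fun=> setT); first by rewrite bigcup_const.
by move=> _; split => //; exact: sphere_measure_fin.
Qed.

HB.instance Definition _ := Measure_isSigmaFinite.Build _ _ _ (@sphere_measure R)
  sphere_sigma_finite.

Lemma unit_imag_sphere_pt (t : mR * mR) : unit_imag (sphere_pt t).
Proof.
apply/unit_imagP => /=; split => //; have h1 := cos2Dsin2 t.1; have h2 := cos2Dsin2 t.2.
rewrite !exprMn -mulrDr h2 mulr1 addrC//.
Qed.

Definition upper : set (mR * mR) := [set m | 0 < m.2].

Lemma measurable_upper : measurable upper.
Proof.
rewrite (_ : upper = (setT `*` `]0, +oo[)%classic).
  by apply: measurableX => //; exact: measurable_itv.
by apply/seteqP; split => m /=; rewrite in_itv/= andbT => //; case.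
Qed.

(** Undo the pushforward, view the restriction to the upper half as the density 1 there, and apply
    Tonelli with the sphere as the inner variable. *)
Lemma ge0_integral_dV (h : H -> \bar R) : measurable_fun setT h ->
  (forall z, 0 <= h z)%E ->
  (\int[@dV R]_z h z = \int[plane]_(m in upper) \int[plane]_(t in angles)
     (h (slice_pt m.1 m.2 (sphere_pt t)) * (sphere_dens t)%:E))%E.
Proof.
move=> mh h0; pose phi (u : H * (mR * mR)) := slice_pt u.2.1 u.2.2 u.1.
have mphi := @measurable_slice_pt R.
have mhphi : measurable_fun setT (h \o phi) by exact: measurableT_comp.
transitivity (\int[@polar_measure R]_u h (phi u))%E.
  by rewrite /dV ge0_integral_pushforward//; move=> z _; exact: h0.
transitivity (\int[@sphere_plane_measure R]_(u in @upper_half R) h (phi u))%E.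
  have nuE A : measurable A -> @polar_measure R A =
      (\int[@sphere_plane_measure R]_(u in @upper_half R `&` id @^-1` A) 1%:E)%E.
    move=> mA; rewrite integral_cst; last first.
      by apply: measurableI; [exact: measurable_upper_half|exact: mA].
    by rewrite mul1e setIC; reflexivity.
  have := ge0_integral_density (@measurable_upper_half R) (@measurable_id _ _ setT)
    (@measurable_cst _ _ _ _ _ (1 : R)) (fun _ _ => ler01 : 0 <= (1 : R)) nuE
    mhphi (fun u => h0 _).
  move=> E; apply: (etrans E); clear E; apply: eq_integral => u _; exact: mule1.
rewrite integral_mkcond.
pose F := (h \o phi) \_ (@upper_half R).
have mF : measurable_fun setT F.
  apply/(measurable_restrictT _ (@measurable_upper_half R)).
  exact: measurable_funTS.
have F0 u : (0 <= F u)%E by apply: erestrict_ge0 => ? _; exact: h0.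
rewrite [LHS](fubini_tonelli2 F mF F0)/= [RHS]integral_mkcond.
apply: eq_integral => m _; rewrite patchE.
case: ifPn => [|]; rewrite /fubini_G.
  rewrite inE => m0.
  rewrite -(ge0_integral_sphere (g := fun I => h (slice_pt m.1 m.2 I))) //.
    apply: eq_integral => I _; rewrite /F patchE mem_set//.
  exact: (measurableT_comp mhphi (measurable_pair2 m)).
rewrite notin_setE => m0; apply: integral0_eq => I _.
by rewrite /F patchE memNset.
Qed.

End SphereIntegral.

(** * Measurability and spherical means of slice functions *)

Section SliceFunctions.
Variable R : realType.
Local Notation H := (quat R).
Local Notation mR := (measurableTypeR R).
Local Notation leb := (@lebesgue_measure R).
Local Notation plane := (@plane_measure R).
Local Notation angles := (@angles R).

Lemma measurable_inv : measurable_fun [set: mR] (fun x : R => x^-1).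
Proof.
rewrite (_ : [set: mR] = [set~ (0 : R)] `|` [set (0 : R)]); last first.
  by rewrite setUC setUv.
apply/measurable_funU; [exact: measurableC|exact: measurable_set1|split].
  apply: open_continuous_measurable_fun.
    by apply: closed_openC; exact: closed_eq.
  by move=> x; rewrite inE/= => /eqP x0; exact: inv_continuous.
exact: measurable_fun_set1.
Qed.

Definition hpi (z : H) : mR * mR := (q0 z, im_norm z).

Lemma measurable_im_norm : measurable_fun [set: H] (@im_norm R).
Proof.
rewrite (_ : @im_norm R = Num.sqrt \o (fun z => q1 z ^+ 2 + q2 z ^+ 2 + q3 z ^+ 2)).
  apply: measurableT_comp.
    by apply: continuous_measurable_fun; exact: sqrt_continuous.
  by do ![apply: measurable_funD]; apply: measurable_funX;
    [exact: measurable_q1|exact: measurable_q2|exact: measurable_q3].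
apply/funext => z /=; rewrite -im_normE sqrtr_sqr ger0_norm//.
exact: im_norm_ge0.
Qed.

Lemma measurable_hpi : measurable_fun [set: H] hpi.
Proof.
by apply: measurable_fun_pair; [exact: measurable_q0|exact: measurable_im_norm].
Qed.

Definition is_slice (f : H -> H) (f0 f1 : R * R -> H) :=
  [/\ forall x y I, unit_imag I -> f (slice_pt x y I) = f0 (x, y) + I * f1 (x, y),
      forall x y, f0 (x, - y) = f0 (x, y) /\ f1 (x, - y) = - f1 (x, y),
      continuous f0 & continuous f1].

(** At a real z this is 0, by the convention for the inverse of 0. A measurable choice of the unit
    of z, which makes slice functions measurable through [slice_eval]. *)
Definition imdir (z : H) : H := (im_norm z)^-1 *: (z - (q0 z)%:A).

Lemma slice_eval (f : H -> H) (f0 f1 : R * R -> H) z : is_slice f f0 f1 ->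
  f z = f0 (hpi z) + imdir z * f1 (hpi z).
Proof.
move=> [fE par _ _]; have [J hJ zJ] := slice_ptP z.
rewrite {1}zJ fE//; have [z0|z0] := eqVneq (im_norm z) 0.
  (* On the real axis oddness forces f1 = 0, so the choice of the unit does not matter. *)
  rewrite /hpi z0; have [_] := par (q0 z) 0; rewrite oppr0.
  move=> /eqP; rewrite -addr_eq0 -mulr2n -scaler_nat scaler_eq0 pnatr_eq0/=.
  by move=> /eqP ->; rewrite !mulr0.
suff -> : imdir z = J by [].
rewrite /imdir {2}zJ /slice_pt addrAC subrr add0r scalerA mulVf// scale1r//.
Qed.

Lemma measurable_qcoords d (T : measurableType d) (g : T -> H) :
  measurable_fun setT g <->
  [/\ measurable_fun setT (fun t => q0 (g t)), measurable_fun setT (fun t => q1 (g t)),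
      measurable_fun setT (fun t => q2 (g t)) & measurable_fun setT (fun t => q3 (g t))].
Proof.
split=> [mg|[m0 m1 m2 m3]]; last exact: measurable_quat.
split.
- exact: measurableT_comp (@measurable_q0 R) mg.
- exact: measurableT_comp (@measurable_q1 R) mg.
- exact: measurableT_comp (@measurable_q2 R) mg.
- exact: measurableT_comp (@measurable_q3 R) mg.
Qed.

Lemma measurable_qmul d (T : measurableType d) (g h : T -> H) :
  measurable_fun setT g -> measurable_fun setT h ->
  measurable_fun setT (fun t => g t * h t).
Proof.
move=> /measurable_qcoords[g0 g1 g2 g3] /measurable_qcoords[h0 h1 h2 h3].
apply/measurable_qcoords; split => /=.
- by do ![apply: measurable_funB]; exact: measurable_funM.
- by apply: measurable_funB; do ?[apply: measurable_funD]; exact: measurable_funM.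
- by apply: measurable_funD; [apply: measurable_funD; [apply: measurable_funB|]|];
    exact: measurable_funM.
- by apply: measurable_funD; [apply: measurable_funB; [apply: measurable_funD|]|];
    exact: measurable_funM.
Qed.

Lemma measurable_qadd d (T : measurableType d) (g h : T -> H) :
  measurable_fun setT g -> measurable_fun setT h ->
  measurable_fun setT (fun t => g t + h t).
Proof.
move=> /measurable_qcoords[g0 g1 g2 g3] /measurable_qcoords[h0 h1 h2 h3].
by apply/measurable_qcoords; split => /=; exact: measurable_funD.
Qed.

Lemma measurable_qscale d (T : measurableType d) (a : T -> R) (h : T -> H) :
  measurable_fun setT a -> measurable_fun setT h ->
  measurable_fun setT (fun t => a t *: h t).
Proof.
move=> ma /measurable_qcoords[h0 h1 h2 h3].
by apply/measurable_qcoords; split => /=; exact: measurable_funM.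
Qed.

Lemma measurable_qconj : measurable_fun [set: H] (@qconj R).
Proof.
apply/measurable_qcoords; split => /=; first exact: measurable_q0.
- by apply: measurableT_comp => //; exact: measurable_q1.
- by apply: measurableT_comp => //; exact: measurable_q2.
- by apply: measurableT_comp => //; exact: measurable_q3.
Qed.

Lemma measurable_qnorm : measurable_fun [set: H] (fun z => `|z| : R).
Proof.
rewrite (_ : (fun z => _) = Num.sqrt \o
    (fun z => q0 z ^+ 2 + q1 z ^+ 2 + q2 z ^+ 2 + q3 z ^+ 2)).
  apply: measurableT_comp.
    by apply: continuous_measurable_fun; exact: sqrt_continuous.
  by do ![apply: measurable_funD]; apply: measurable_funX;
    [exact: measurable_q0|exact: measurable_q1|exact: measurable_q2|exact: measurable_q3].
by apply/funext => z /=; rewrite -qnormE2 sqrtr_sqr normr_id.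
Qed.

Lemma continuous_measurable_planeq (f : R * R -> H) : continuous f ->
  measurable_fun [set: mR * mR] (f : mR * mR -> H).
Proof.
move=> /continuous_quatP[f0 f1 f2 f3].
by apply/measurable_qcoords; split; exact: continuous_measurable_plane.
Qed.

Lemma measurable_imdir : measurable_fun setT imdir.
Proof.
apply: measurable_qscale; first exact: measurableT_comp measurable_inv measurable_im_norm.
by apply/measurable_qcoords; split => /=; apply: measurable_funB => //;
  (try apply: measurable_funM => //);
  by [exact: measurable_q0|exact: measurable_q1|exact: measurable_q2|exact: measurable_q3].
Qed.

Lemma measurable_slice_fun (f : H -> H) f0 f1 : is_slice f f0 f1 ->
  measurable_fun setT f.
Proof.
move=> hf; have [_ _ cf0 cf1] := hf.
rewrite (_ : f = fun z => f0 (hpi z) + imdir z * f1 (hpi z)); last first.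
  by apply/funext => z; exact: slice_eval.
have mi := measurable_imdir.
have m (g : R * R -> H) : continuous g -> measurable_fun setT (fun z => g (hpi z)).
  move=> cg; exact: measurableT_comp (continuous_measurable_planeq cg) measurable_hpi.
by apply: measurable_qadd; [exact: m|apply: measurable_qmul; [|exact: m]].
Qed.

Definition wnorm (f0 f1 : R * R -> H) (m : R * R) : R := `|f0 m| ^+ 2 + `|f1 m| ^+ 2.

Lemma integral_sin_pi (A B : R) : (forall t, 0 <= A + B * cos t) ->
  (\int[leb]_(t in `[0%R, pi]) (sin t * (A + B * cos t))%:E = (2 * A)%:E)%E.
Proof.
move=> AB0; rewrite (@continuous_FTC2 R _ (fun t => - A * cos t + B / 2 * sin t ^+ 2)).
- by rewrite cos0 sin0 cospi sinpi -EFinB; congr EFin; ring.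
- exact: pi_gt0.
- apply: continuous_subspaceT => t; apply: cvgM; first exact: continuous_sin.
  apply: cvgD; first exact: cvg_cst.
  by apply: cvgMl_tmp; exact: continuous_cos.
- have d t : derivable (fun t : R => - A * cos t + B / 2 * sin t ^+ 2) t 1 by [].
  have c : continuous (fun t : R => - A * cos t + B / 2 * sin t ^+ 2).
    by move=> t; exact/differentiable_continuous/derivable1_diffP.
  split => [t _//||]; [exact/cvg_at_right_filter/c|exact/cvg_at_left_filter/c].
- by move=> t _; rewrite derive1E derive_val /GRing.scale/=; field.
Qed.

Lemma integral_2pi (X Y Z : R) :
  (\int[leb]_(t in `[0%R, (2 * pi)%R]) (X + Y * cos t + Z * sin t)%:E =
   (2 * pi * X)%:E)%E.
Proof.
have d t : is_derive t (1 : R) (fun t : R => X * t + Y * sin t - Z * cos t)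
    (X + Y * cos t + Z * sin t).
  by apply: is_derive_eq; rewrite /GRing.scale/=; ring.
rewrite (@continuous_FTC2 R _ (fun t => X * t + Y * sin t - Z * cos t)).
- rewrite cos0 sin0 mulr_natl cos2pi sin2pi.
  by rewrite -EFinB; congr EFin; ring.
- by rewrite mulr_gt0// pi_gt0.
- apply: continuous_subspaceT => t; apply: cvgD; first apply: cvgD.
  + exact: cvg_cst.
  + by apply: cvgMl_tmp; exact: continuous_cos.
  + by apply: cvgMl_tmp; exact: continuous_sin.
- have c : continuous (fun t : R => X * t + Y * sin t - Z * cos t).
    by move=> t; have := d t; move=> dt; exact/differentiable_continuous/derivable1_diffP.
  split => [t _||]; [by have [] := d t|exact/cvg_at_right_filter/c|exact/cvg_at_left_filter/c].
- by move=> t _; rewrite derive1E; have [_ ->] := d t.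
Qed.

(** The coefficients of the cross term, twice the inner product of p and I q, as a linear form in
    I. *)
Let l1 (p q : H) := 2 * (q1 p * q0 q - q0 p * q1 q - q2 p * q3 q + q3 p * q2 q).
Let l2 (p q : H) := 2 * (q1 p * q3 q - q0 p * q2 q + q2 p * q0 q - q3 p * q1 q).
Let l3 (p q : H) := 2 * (q3 p * q0 q - q0 p * q3 q - q1 p * q2 q + q2 p * q1 q).

Let qnorm_slice_sum (p q I : H) : unit_imag I -> `|p + I * q| ^+ 2 =
  `|p| ^+ 2 + `|q| ^+ 2 + l1 p q * q1 I + l2 p q * q2 I + l3 p q * q3 I.
Proof.
move=> /unit_imagP[I0 I1]; rewrite !qnormE2 /= I0 /l1 /l2 /l3.
transitivity (q0 p ^+ 2 + q1 p ^+ 2 + q2 p ^+ 2 + q3 p ^+ 2 +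
  (q0 q ^+ 2 + q1 q ^+ 2 + q2 q ^+ 2 + q3 q ^+ 2) *
    (q1 I ^+ 2 + q2 I ^+ 2 + q3 I ^+ 2) + l1 p q * q1 I + l2 p q * q2 I + l3 p q * q3 I).
  by rewrite /l1 /l2 /l3; ring.
by rewrite I1 mulr1 /l1 /l2 /l3.
Qed.

(** The cross term is linear in I: the azimuth kills its first two coordinates, the colatitude the
    third. *)
Lemma sphere_average (p q : H) (c : R) : 0 <= c ->
  (\int[plane]_(t in angles)
    ((c * `|p + sphere_pt t * q| ^+ 2)%:E * (sphere_dens t)%:E) =
   (c * (`|p| ^+ 2 + `|q| ^+ 2))%:E)%E.
Proof.
move=> c0; pose M := `|p| ^+ 2 + `|q| ^+ 2.
(* At the two poles M + l3 and M - l3 are squared norms, and cos t lies between -1 and 1. *)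
have M3 t : 0 <= M + l3 p q * cos t.
  have hk : unit_imag (Quat 0 0 0 1 : H) by apply/unit_imagP => /=; split => //; ring.
  have := sqr_ge0 `|p + Quat 0 0 0 1 * q|; have := sqr_ge0 `|p + (- Quat 0 0 0 1) * q|.
  rewrite qnorm_slice_sum; last exact: unit_imagN.
  rewrite qnorm_slice_sum// -/M /= !oppr0 !mulr0 !addr0 mulr1 mulrN1.
  have := cos_le1 t; have := cos_geN1 t; move: (cos t) (l3 p q) M => x y z; nra.
pose F : mR * mR -> \bar R := (fun t : mR * mR =>
  ((c * `|p + sphere_pt t * q| ^+ 2)%:E * (sphere_dens t)%:E)%E) \_ angles.
have mF : measurable_fun setT F.
  apply/(measurable_restrictT _ (@measurable_angles R)); apply: measurable_funTS.
  apply: emeasurable_funM; apply/measurable_EFinP; last exact: measurable_sphere_dens.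
  apply: measurable_funM => //; apply: measurable_funX.
  apply: (measurableT_comp measurable_qnorm).
  apply: measurable_qadd; first exact: measurable_cst.
  apply: measurable_qmul; first exact: measurable_sphere_pt.
  exact: measurable_cst.
have F0 t : (0 <= F t)%E.
  apply: erestrict_ge0 => s sa; rewrite -EFinM lee_fin mulr_ge0//.
    by rewrite mulr_ge0// sqr_ge0.
  exact: sphere_dens_ge0.
rewrite integral_mkcond [LHS](fubini_tonelli1 F mF F0).
have pi0 := pi_gt0 R.
transitivity (\int[leb]_(x in `[0%R, pi]) ((c / 2)%:E * (sin x * (M + l3 p q * cos x))%:E))%E.
  rewrite [RHS]integral_mkcond; apply: eq_integral => x _; rewrite /fubini_F patchE.
  case: ifPn => [|] xI.
    rewrite inE in xI.
    transitivity (\int[leb]_(t in `[0%R, (2 * pi)%R])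
      (c * (sin x / (4 * pi)) * (M + l3 p q * cos x) +
       c * (sin x / (4 * pi)) * (l1 p q * sin x) * cos t +
       c * (sin x / (4 * pi)) * (l2 p q * sin x) * sin t)%:E)%E.
      rewrite [RHS]integral_mkcond; apply: eq_integral => y _; rewrite patchE /F patchE.
      have -> : ((x, y) \in angles) = (y \in `[0%R, (2 * pi)%R]%classic).
        by apply/idP/idP; rewrite !inE; [case|split].
      case: ifPn => yI //.
        rewrite qnorm_slice_sum; last exact: unit_imag_sphere_pt.
        by rewrite -EFinM /sphere_dens -/M /=; congr EFin; ring.
    rewrite integral_2pi -EFinM; congr EFin.
    have pn0 : @pi R != 0 by rewrite gt_eqF.
    by move: (@pi R) pn0 => P Pn0; field.
  apply: integral0_eq => y _; rewrite /F patchE memNset// => -[/= xx _].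
  by rewrite notin_setE in xI.
rewrite ge0_integralZl//; last 3 first.
- apply/measurable_EFinP; apply: measurable_funTS; apply: measurable_funM.
    by apply: continuous_measurable_fun; exact: continuous_sin.
  apply: measurable_funD => //; apply: measurable_funM => //.
  by apply: continuous_measurable_fun; exact: continuous_cos.
- move=> x /=; rewrite in_itv/= => xI; rewrite lee_fin mulr_ge0//.
  exact: sin_ge0_pi.
- by rewrite lee_fin divr_ge0.
by rewrite integral_sin_pi// -EFinM; congr EFin; rewrite /M; field.
Qed.

End SliceFunctions.

(** * Holomorphic pairs and the Gaussian weight *)

Section HoloPairs.
Variable R : realType.
Local Notation mR := (measurableTypeR R).
Local Notation plane := (@plane_measure R).

Lemma has_partialsI (f fx fy : R * R -> R) :
  (forall x y : R, is_derive x (1 : R) (fun t => f (t, y)) (fx (x, y))) ->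
  (forall x y : R, is_derive y (1 : R) (fun t => f (x, t)) (fy (x, y))) ->
  continuous fx -> continuous fy -> has_partials f fx fy.
Proof.
by move=> h1 h2 c1 c2; split => // -[x y]; [exact/is_derive_fst|exact/is_derive_snd].
Qed.

(* [u + i v] is holomorphic with derivative [a + i b]. *)
Definition holo (u v a b : R * R -> R) :=
  has_partials u a (fun p => - b p) /\ has_partials v b a.

Lemma holo_mul u v a b u' v' a' b' : holo u v a b -> holo u' v' a' b' ->
  holo (fun p => u p * u' p - v p * v' p) (fun p => u p * v' p + v p * u' p)
    (fun p => a p * u' p - b p * v' p + (u p * a' p - v p * b' p))
    (fun p => a p * v' p + b p * u' p + (u p * b' p + v p * a' p)).
Proof.
move=> [hu hv] [hu' hv'].
have cu := continuous_partials hu; have cv := continuous_partials hv.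
have cu' := continuous_partials hu'; have cv' := continuous_partials hv'.
have [u1 u2 _ _] := hu; have [v1 v2 cb ca] := hv.
have [u1' u2' _ _] := hu'; have [v1' v2' cb' ca'] := hv'.
have cA : continuous (fun p => a p * u' p - b p * v' p + (u p * a' p - v p * b' p)).
  move=> p; apply: cvgD; apply: cvgB; apply: cvgM;
    by [exact: ca|exact: cu'|exact: cb|exact: cv'|exact: cu|exact: ca'|exact: cv|exact: cb'].
have cB : continuous (fun p => a p * v' p + b p * u' p + (u p * b' p + v p * a' p)).
  move=> p; apply: cvgD; apply: cvgD; apply: cvgM;
    by [exact: ca|exact: cu'|exact: cb|exact: cv'|exact: cu|exact: ca'|exact: cv|exact: cb'].
split; split => //.
- move=> p; have := u1 p; have := v1 p; have := u1' p; have := v1' p => *.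
  by apply: is_derive_eq; rewrite /GRing.scale/=; ring.
- move=> p; have := u2 p; have := v2 p; have := u2' p; have := v2' p => *.
  by apply: is_derive_eq; rewrite /GRing.scale/=; ring.
- by move=> p; apply: cvgN; exact: cB.
- move=> p; have := u1 p; have := v1 p; have := u1' p; have := v1' p => *.
  by apply: is_derive_eq; rewrite /GRing.scale/=; ring.
- move=> p; have := u2 p; have := v2 p; have := u2' p; have := v2' p => *.
  by apply: is_derive_eq; rewrite /GRing.scale/=; ring.
Qed.

Variable alpha : R.

(** [C] and [S] are the real and imaginary parts of e^(- alpha conj(p) zeta). *)
Let C (p m : R * R) := expR (- (alpha * (p.1 * m.1 + p.2 * m.2))) *
  cos (alpha * (p.1 * m.2 - p.2 * m.1)).
Let S (p m : R * R) := - (expR (- (alpha * (p.1 * m.1 + p.2 * m.2))) *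
  sin (alpha * (p.1 * m.2 - p.2 * m.1))).

Let CS_sqr p m : C p m ^+ 2 + S p m ^+ 2 =
  expR (- (2 * alpha * (p.1 * m.1 + p.2 * m.2))).
Proof.
rewrite /C /S sqrrN !exprMn -mulrDr cos2Dsin2 mulr1 expr2 -expRD; congr expR; ring.
Qed.

Let lin_continuous (c d : R) : continuous (fun m : R * R => c * m.1 + d * m.2).
Proof.
move=> m; apply: cvgD; apply: cvgMl_tmp; [exact: cvg_fst|exact: cvg_snd].
Qed.

Let C_continuous p : continuous (C p).
Proof.
move=> m; apply: cvgM.
  apply: (cvg_comp (fun m : R * R => - (alpha * (p.1 * m.1 + p.2 * m.2))) expR);
    last exact: continuous_expR.
  by apply: cvgN; apply: cvgMl_tmp; exact: lin_continuous.
apply: (cvg_comp (fun m : R * R => alpha * (p.1 * m.2 - p.2 * m.1)) cos);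
  last exact: continuous_cos.
apply: cvgMl_tmp; rewrite (_ : (fun m : R * R => p.1 * m.2 - p.2 * m.1) =
  (fun m : R * R => - p.2 * m.1 + p.1 * m.2)); last by apply/funext => k; ring.
rewrite (_ : p.1 * m.2 - _ = - p.2 * m.1 + p.1 * m.2); last by ring.
exact: lin_continuous.
Qed.

Let S_continuous p : continuous (S p).
Proof.
move=> m; apply: cvgN; apply: cvgM.
  apply: (cvg_comp (fun m : R * R => - (alpha * (p.1 * m.1 + p.2 * m.2))) expR);
    last exact: continuous_expR.
  by apply: cvgN; apply: cvgMl_tmp; exact: lin_continuous.
apply: (cvg_comp (fun m : R * R => alpha * (p.1 * m.2 - p.2 * m.1)) sin);
  last exact: continuous_sin.
apply: cvgMl_tmp; rewrite (_ : (fun m : R * R => p.1 * m.2 - p.2 * m.1) =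
  (fun m : R * R => - p.2 * m.1 + p.1 * m.2)); last by apply/funext => k; ring.
rewrite (_ : p.1 * m.2 - _ = - p.2 * m.1 + p.1 * m.2); last by ring.
exact: lin_continuous.
Qed.

Let d_lin (c d x : R) : is_derive x (1 : R) (fun t : R => c + d * t) d.
Proof. by apply: is_derive_eq; rewrite /GRing.scale/=; ring. Qed.

Let d_CS (c d c' d' x : R) :
  is_derive x (1 : R) (fun t => expR (c + d * t) * cos (c' + d' * t))
    (d * (expR (c + d * x) * cos (c' + d' * x)) -
     d' * (expR (c + d * x) * sin (c' + d' * x))) /\
  is_derive x (1 : R) (fun t => - (expR (c + d * t) * sin (c' + d' * t)))
    (- (d * (expR (c + d * x) * sin (c' + d' * x)) +
     d' * (expR (c + d * x) * cos (c' + d' * x)))).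
Proof.
have he : is_derive x (1 : R) (fun t => expR (c + d * t)) (expR (c + d * x) * d).
  exact: (is_derive1_comp (is_derive_expR _) (d_lin c d x)).
have hc : is_derive x (1 : R) (fun t => cos (c' + d' * t)) (- sin (c' + d' * x) * d').
  exact: (is_derive1_comp (is_derive_cos _) (d_lin c' d' x)).
have hs : is_derive x (1 : R) (fun t => sin (c' + d' * t)) (cos (c' + d' * x) * d').
  exact: (is_derive1_comp (is_derive_sin _) (d_lin c' d' x)).
move: (fun t => expR (c + d * t)) (fun t => cos _) (fun t => sin _) he hc hs.
move=> f g h he hc hs.
by split; apply: is_derive_eq; rewrite /GRing.scale/=; ring.
Qed.

Let holo_CS p : holo (C p) (S p)
  (fun m => - alpha * (p.1 * C p m + p.2 * S p m))
  (fun m => - alpha * (p.1 * S p m - p.2 * C p m)).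
Proof.
have cC := @C_continuous p; have cS := @S_continuous p.
have cA : continuous (fun m => - alpha * (p.1 * C p m + p.2 * S p m)).
  by move=> m; apply: cvgMl_tmp; apply: cvgD; apply: cvgMl_tmp; [exact: cC|exact: cS].
have cB : continuous (fun m => - alpha * (p.1 * S p m - p.2 * C p m)).
  by move=> m; apply: cvgMl_tmp; apply: cvgB; apply: cvgMl_tmp; [exact: cS|exact: cC].
(* With one variable frozen, the exponent and the angle are affine in the other, as [d_CS]
   expects. *)
have e1 t y : - (alpha * (p.1 * t + p.2 * y)) = - (alpha * p.2 * y) + - (alpha * p.1) * t :> R.
  by ring.
have e2 t y : alpha * (p.1 * y - p.2 * t) = alpha * p.1 * y + - (alpha * p.2) * t :> R.
  by ring.
have e3 t y : - (alpha * (p.1 * y + p.2 * t)) = - (alpha * p.1 * y) + - (alpha * p.2) * t :> R.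
  by ring.
have e4 t y : alpha * (p.1 * t - p.2 * y) = - (alpha * p.2 * y) + (alpha * p.1) * t :> R.
  by ring.
split.
  apply: has_partialsI.
  - move=> x y; have [h _] := d_CS (- (alpha * p.2 * y)) (- (alpha * p.1))
      (alpha * p.1 * y) (- (alpha * p.2)) x.
    rewrite /C /S /=; under eq_fun do rewrite e1 e2.
    rewrite e1 e2; apply: is_derive_eq h _; ring.
  - move=> x y; have [h _] := d_CS (- (alpha * p.1 * x)) (- (alpha * p.2))
      (- (alpha * p.2 * x)) (alpha * p.1) y.
    rewrite /C /S /=; under eq_fun do rewrite e3 e4.
    rewrite e3 e4; apply: is_derive_eq h _; ring.
  - exact: cA.
  - by move=> m; apply: cvgN; exact: cB.
apply: has_partialsI.
- move=> x y; have [_ h] := d_CS (- (alpha * p.2 * y)) (- (alpha * p.1))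
    (alpha * p.1 * y) (- (alpha * p.2)) x.
  rewrite /C /S /=; under eq_fun do rewrite e1 e2.
  rewrite e1 e2; apply: is_derive_eq h _; ring.
- move=> x y; have [_ h] := d_CS (- (alpha * p.1 * x)) (- (alpha * p.2))
    (- (alpha * p.2 * x)) (alpha * p.1) y.
  rewrite /C /S /=; under eq_fun do rewrite e3 e4.
  rewrite e3 e4; apply: is_derive_eq h _; ring.
- exact: cB.
- exact: cA.
Qed.

Definition gauss (m : R * R) : R := expR (- (alpha * (m.1 ^+ 2 + m.2 ^+ 2))).

(** The difference of the two sides is c (2 - |m - p|^2). *)
Let gauss_expo_le (c p1 p2 m1 m2 : R) : 0 <= c -> `|m1 - p1| <= 1 ->
  `|m2 - p2| <= 1 -> c * (p1 ^+ 2 + p2 ^+ 2) - 2 * c * (p1 * m1 + p2 * m2) <=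
  2 * c - c * (m1 ^+ 2 + m2 ^+ 2).
Proof.
move=> c0 h1 h2.
have s (t : R) : `|t| <= 1 -> t ^+ 2 <= 1.
  by move=> t1; rewrite -real_normK ?num_real// expr_le1.
rewrite -subr_ge0 (_ : _ - _ = c * (2 - ((m1 - p1) ^+ 2 + (m2 - p2) ^+ 2))).
  by rewrite mulr_ge0// subr_ge0; have := s _ h1; have := s _ h2; lra.
by ring.
Qed.

(** [submean] for the product with e^(- alpha conj(p) zeta), multiplied by e^(alpha |p|^2): the
    resulting weight equals [gauss] at p and exceeds it by at most e^(2 alpha) on the box. *)
Lemma weighted_submean u v a b p : 0 <= alpha -> holo u v a b ->
  (((u p ^+ 2 + v p ^+ 2) * gauss p)%:E <= (8 * expR (2 * alpha))%:E *
   \int[plane]_(m in sbox 1 p) ((u m ^+ 2 + v m ^+ 2) * gauss m)%:E)%E.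
Proof.
move=> a0 h; have [hU hV] := holo_mul h (holo_CS p).
have := submean hU hV p.
have WE m : (u m * C p m - v m * S p m) ^+ 2 + (u m * S p m + v m * C p m) ^+ 2 =
    (u m ^+ 2 + v m ^+ 2) * expR (- (2 * alpha * (p.1 * m.1 + p.2 * m.2))).
  by rewrite -CS_sqr; ring.
rewrite WE; under eq_integral do rewrite WE.
pose k := expR (alpha * (p.1 ^+ 2 + p.2 ^+ 2)).
have k0 : (0 <= k%:E)%E by rewrite lee_fin expR_ge0.
move=> /(lee_wpmul2l k0); rewrite -EFinM.
have -> : k * ((u p ^+ 2 + v p ^+ 2) * expR (- (2 * alpha * (p.1 * p.1 + p.2 * p.2)))) =
    (u p ^+ 2 + v p ^+ 2) * gauss p.
  by rewrite mulrCA -expRD /gauss; congr (_ * expR _); ring.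
move=> /le_trans; apply.
have [cu cv] : continuous u /\ continuous v.
  by case: h => hu hv; split; [exact: continuous_partials hu|exact: continuous_partials hv].
have mW : measurable_fun setT (fun m : mR * mR => u m ^+ 2 + v m ^+ 2).
  by apply: measurable_funD; apply: measurable_funX; exact: continuous_measurable_plane.
have mlin (c d : R) : measurable_fun setT (fun m : mR * mR => c * m.1 + d * m.2).
  exact: (continuous_measurable_plane (@lin_continuous c d)).
have mexp (g : mR * mR -> R) : measurable_fun setT g ->
    measurable_fun setT (fun m => expR (g m)).
  by move=> mg; exact: measurableT_comp (@measurable_expR R) mg.
have m1 : measurable_fun setT (fun m : mR * mR => m.1) by exact: measurable_fst.
have m2 : measurable_fun setT (fun m : mR * mR => m.2) by exact: measurable_snd.
rewrite muleCA EFinM -muleA; apply: lee_wpmul2l => //.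
have mg1 : measurable_fun (sbox 1 p) (fun m : mR * mR =>
    ((u m ^+ 2 + v m ^+ 2) * expR (- (2 * alpha * (p.1 * m.1 + p.2 * m.2))))%:E).
  apply/measurable_EFinP; apply: measurable_funTS; apply: measurable_funM => //.
  apply: mexp; apply: measurableT_comp => //.
  by apply: measurable_funM => //; exact: mlin.
have mg2 : measurable_fun (sbox 1 p) (fun m : mR * mR =>
    ((u m ^+ 2 + v m ^+ 2) * gauss m)%:E).
  apply/measurable_EFinP; apply: measurable_funTS; apply: measurable_funM => //.
  apply: mexp; apply: measurableT_comp => //.
  by apply: measurable_funM => //; apply: measurable_funD; exact: measurable_funX.
have g10 m : (0 <= ((u m ^+ 2 + v m ^+ 2) *
    expR (- (2 * alpha * (p.1 * m.1 + p.2 * m.2))))%:E)%E.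
  by rewrite lee_fin mulr_ge0 ?addr_ge0 ?sqr_ge0// expR_ge0.
have g20 m : (0 <= ((u m ^+ 2 + v m ^+ 2) * gauss m)%:E)%E.
  by rewrite lee_fin mulr_ge0 ?addr_ge0 ?sqr_ge0// expR_ge0.
rewrite -(ge0_integralZl _ _ mg1 (fun m _ => g10 m) k0); last exact: measurable_sbox.
rewrite -(ge0_integralZl _ _ mg2 (fun m _ => g20 m)); last 2 first.
- exact: measurable_sbox.
- by rewrite lee_fin expR_ge0.
apply: integral_mono => m.
  by move=> _; rewrite mule_ge0// lee_fin mulr_ge0 ?addr_ge0 ?sqr_ge0// expR_ge0.
move=> [hm1 hm2]; rewrite -!EFinM lee_fin mulrCA [leRHS]mulrCA.
rewrite ler_wpM2l ?addr_ge0 ?sqr_ge0// /k /gauss -!expRD ler_expR.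
exact: gauss_expo_le.
Qed.

End HoloPairs.

(** * Fock norms as plane integrals and the pointwise bound *)

Section FockFunctions.
Variable R : realType.
Local Notation H := (quat R).
Local Notation mR := (measurableTypeR R).
Local Notation plane := (@plane_measure R).
Local Notation angles := (@angles R).

(** The Cauchy-Riemann system is real-linear, so it splits into one holomorphic pair for each real
    coordinate. *)
Definition holoq (f0 f1 : R * R -> H) :=
  [/\ exists a b, holo (fun p => q0 (f0 p)) (fun p => q0 (f1 p)) a b,
      exists a b, holo (fun p => q1 (f0 p)) (fun p => q1 (f1 p)) a b,
      exists a b, holo (fun p => q2 (f0 p)) (fun p => q2 (f1 p)) a b &
      exists a b, holo (fun p => q3 (f0 p)) (fun p => q3 (f1 p)) a b].

Lemma slice_regularP (f : H -> H) : slice_regular f ->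
  exists f0 f1, is_slice f f0 f1 /\ holoq f0 f1.
Proof.
move=> [f0 [f1 [fE par [[d1 c1 d2 c2] [d3 c3 d4 c4]] CR]]]; exists f0, f1.
pose A := 'D_(1, 0) f0; pose B := 'D_(1, 0) f1.
have f0x (p : R * R) : is_derive p ((1, 0) : R * R) f0 (A p) by split; [exact: d1|].
have f1x (p : R * R) : is_derive p ((1, 0) : R * R) f1 (B p) by split; [exact: d3|].
have f1y (p : R * R) : is_derive p ((0, 1) : R * R) f1 (A p).
  by split; [exact: d4|have [/eqP + _] := CR p; rewrite subr_eq0 => /eqP].
have f0y (p : R * R) : is_derive p ((0, 1) : R * R) f0 (- B p).
  by split; [exact: d2|have [_ /eqP] := CR p; rewrite addr_eq0 => /eqP].
have /continuous_quatP[A0 A1 A2 A3] := c1; have /continuous_quatP[B0 B1 B2 B3] := c3.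
have h (k : H -> R) :
    (forall p : R * R, is_derive p ((1, 0) : R * R) (fun p => k (f0 p)) (k (A p))) ->
    (forall p : R * R, is_derive p ((0, 1) : R * R) (fun p => k (f0 p)) (k (- B p))) ->
    (forall p : R * R, is_derive p ((1, 0) : R * R) (fun p => k (f1 p)) (k (B p))) ->
    (forall p : R * R, is_derive p ((0, 1) : R * R) (fun p => k (f1 p)) (k (A p))) ->
    (forall p, k (- B p) = - k (B p)) ->
    continuous (fun p => k (A p)) -> continuous (fun p => k (B p)) ->
    exists a b, holo (fun p => k (f0 p)) (fun p => k (f1 p)) a b.
  move=> h1 h2 h3 h4 kN kA kB; exists (fun p => k (A p)), (fun p => k (B p)).
  by split; split => // p; [rewrite -kN|apply: cvgN; exact: kB].
have hq : holoq f0 f1.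
  split; apply: h => // p;
    first [by have /is_derive_quatP[] := f0x p|by have /is_derive_quatP[] := f0y p
          |by have /is_derive_quatP[] := f1x p|by have /is_derive_quatP[] := f1y p].
have [[a0 [b0 [h0 h0']]] [a1 [b1 [h1 h1']]] [a2 [b2 [h2 h2']]] [a3 [b3 [h3 h3']]]] := hq.
split => //; split => //; apply/continuous_quatP; split.
- exact: continuous_partials h0.
- exact: continuous_partials h1.
- exact: continuous_partials h2.
- exact: continuous_partials h3.
- exact: continuous_partials h0'.
- exact: continuous_partials h1'.
- exact: continuous_partials h2'.
- exact: continuous_partials h3'.
Qed.

Variable alpha : R.
Hypothesis alpha_gt0 : 0 < alpha.
Let alpha_ge0 : 0 <= alpha := ltW alpha_gt0.

Definition gdens (f0 f1 : R * R -> H) (m : R * R) : R :=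
  wnorm f0 f1 m * gauss alpha m.

Lemma gdens_ge0 f0 f1 m : 0 <= gdens f0 f1 m.
Proof. by rewrite mulr_ge0 ?expR_ge0// addr_ge0 ?sqr_ge0. Qed.

Lemma gauss_continuous : continuous (gauss alpha).
Proof.
move=> m; apply: (cvg_comp (fun m : R * R => - (alpha * (m.1 ^+ 2 + m.2 ^+ 2))) expR);
  last exact: continuous_expR.
apply: cvgN; apply: cvgMl_tmp; apply: cvgD.
  apply: (cvg_comp (fun m : R * R => m.1) (fun t : R => t ^+ 2));
    [exact: cvg_fst|exact: exprn_continuous].
apply: (cvg_comp (fun m : R * R => m.2) (fun t : R => t ^+ 2));
  [exact: cvg_snd|exact: exprn_continuous].
Qed.

Lemma gdens_continuous f0 f1 : continuous f0 -> continuous f1 ->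
  continuous (gdens f0 f1).
Proof.
move=> c0 c1 m; apply: cvgM; last exact: gauss_continuous.
have n (f : R * R -> H) : continuous f -> (fun m => `|f m| ^+ 2) @ m --> `|f m| ^+ 2.
  move=> cf; apply: (cvg_comp (fun m => `|f m|) (fun t : R => t ^+ 2)).
    exact: (cvg_comp _ _ (cf m) (@norm_continuous _ _ (f m))).
  exact: exprn_continuous.
by apply: cvgD; exact: n.
Qed.

Lemma measurable_gdens f0 f1 : continuous f0 -> continuous f1 ->
  measurable_fun [set: mR * mR] (fun m => (gdens f0 f1 m)%:E).
Proof.
move=> c0 c1; apply/measurable_EFinP.
by apply: continuous_measurable_plane; exact: gdens_continuous.
Qed.

Let sum4_mul (e x0 x1 x2 x3 y0 y1 y2 y3 : \bar R) :
  (0 <= x0 -> 0 <= x1 -> 0 <= x2 -> 0 <= x3 ->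
  y0 <= e * x0 -> y1 <= e * x1 -> y2 <= e * x2 -> y3 <= e * x3 ->
  y0 + y1 + y2 + y3 <= e * (x0 + x1 + x2 + x3))%E.
Proof.
move=> h0 h1 h2 h3 *; rewrite !ge0_muleDr ?adde_ge0//.
by rewrite !leeD.
Qed.

Lemma gdens_submean f0 f1 p : holoq f0 f1 -> continuous f0 -> continuous f1 ->
  ((gdens f0 f1 p)%:E <= (8 * expR (2 * alpha))%:E *
     \int[plane]_(m in sbox 1 p) (gdens f0 f1 m)%:E)%E.
Proof.
move=> [[a0 [b0 h0]] [a1 [b1 h1]] [a2 [b2 h2]] [a3 [b3 h3]]] c0 c1.
pose g (k : H -> R) m := (k (f0 m) ^+ 2 + k (f1 m) ^+ 2) * gauss alpha m.
have gE m : gdens f0 f1 m = g (@q0 R) m + g (@q1 R) m + g (@q2 R) m + g (@q3 R) m.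
  by rewrite /gdens /wnorm /g !qnormE2; ring.
have g0 k m : (0 <= (g k m)%:E)%E.
  by rewrite lee_fin mulr_ge0 ?expR_ge0// addr_ge0 ?sqr_ge0.
have mg k : continuous (fun m => k (f0 m)) -> continuous (fun m => k (f1 m)) ->
    measurable_fun (sbox 1 p) (fun m : mR * mR => (g k m)%:E).
  move=> k0 k1; apply: measurable_funTS; apply/measurable_EFinP.
  apply: measurable_funM; last exact: (continuous_measurable_plane gauss_continuous).
  by apply: measurable_funD; apply: measurable_funX; exact: continuous_measurable_plane.
have /continuous_quatP[c00 c01 c02 c03] := c0.
have /continuous_quatP[c10 c11 c12 c13] := c1.
have mq := measurable_sbox 1 p.
rewrite gE.
under eq_integral do rewrite gE !EFinD.
rewrite ge0_integralD4//; [|exact: mg..].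
have e0 : (0 <= (8 * expR (2 * alpha))%:E)%E by rewrite lee_fin mulr_ge0// expR_ge0.
have i0 k : (0 <= \int[plane]_(m in sbox 1 p) (g k m)%:E)%E by exact: integral_ge0.
rewrite !EFinD; apply: sum4_mul => //.
- exact: (weighted_submean p alpha_ge0 h0).
- exact: (weighted_submean p alpha_ge0 h1).
- exact: (weighted_submean p alpha_ge0 h2).
- exact: (weighted_submean p alpha_ge0 h3).
Qed.

(** On each sphere x + y S the weight is constant and [sphere_average] removes the cross term. *)
Lemma fock_sqnormE f f0 f1 : is_slice f f0 f1 ->
  (fock_sqnorm alpha f =
   (2 * alpha / pi)%:E * \int[plane]_(m in @upper R) (gdens f0 f1 m)%:E)%E.
Proof.
move=> hf; have [fE _ c0 c1] := hf.
have mf := measurable_slice_fun hf.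
have k0 : 0 <= 2 * alpha / pi by rewrite divr_ge0 ?mulr_ge0// pi_ge0.
have mnq : measurable_fun [set: H] (fun z => `|z| : R) := @measurable_qnorm R.
rewrite /fock_sqnorm ge0_integral_dV; last 2 first.
- apply/measurable_EFinP; apply: measurable_funM; last first.
    by apply: measurable_funX; exact: measurableT_comp mnq mf.
  apply: measurable_funM; first exact: measurable_cst.
  apply: (measurableT_comp (@measurable_expR R)); apply: measurable_funM.
    exact: measurable_cst.
  exact: measurable_funX.
- by move=> z; rewrite lee_fin mulr_ge0 ?sqr_ge0// mulr_ge0// expR_ge0.
rewrite -(ge0_integralZl _ (@measurable_upper R)); last 3 first.
- by apply: measurable_funTS; exact: measurable_gdens.
- by move=> m _; rewrite lee_fin gdens_ge0.
- by rewrite lee_fin.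
apply: eq_integral => m _.
transitivity (\int[plane]_(t in angles) ((2 * alpha / pi * gauss alpha m *
   `|f0 m + sphere_pt t * f1 m| ^+ 2)%:E * (sphere_dens t)%:E))%E.
  apply: eq_integral => t _; have hI := unit_imag_sphere_pt t.
  rewrite qnorm_slice// fE// -surjective_pairing /gauss.
  by rewrite mulNr.
rewrite sphere_average; last by rewrite mulr_ge0// expR_ge0.
rewrite -EFinM /gdens /wnorm; congr EFin; rewrite -!mulrA.
by congr (_ * (_ * (_ * _))); rewrite mulrC.
Qed.

(** The parities of f0 and f1 make the density even in y, so the plane gives twice the upper half.
    The whole plane is wanted because boxes around points near the real axis cross it. *)
Lemma integral_gdens f f0 f1 : is_slice f f0 f1 ->
  (\int[plane]_m (gdens f0 f1 m)%:E = (pi / alpha)%:E * fock_sqnorm alpha f)%E.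
Proof.
move=> hf; have [fE par c0 c1] := hf; rewrite (fock_sqnormE hf).
have mg := measurable_gdens c0 c1.
have g0 m : (0 <= (gdens f0 f1 m)%:E)%E by rewrite lee_fin gdens_ge0.
have -> : (\int[plane]_m (gdens f0 f1 m)%:E =
    2%:E * \int[plane]_(m in @upper R) (gdens f0 f1 m)%:E)%E; last first.
  rewrite muleA -EFinM; congr (_ * _)%E; congr EFin.
  have := pi_gt0 R; move: (@pi R) => P P0; field.
  by rewrite !gt_eqF.
pose F := (fun m : mR * mR => (gdens f0 f1 m)%:E) \_ (@upper R).
have mF : measurable_fun setT F.
  by apply/(measurable_restrictT _ (@measurable_upper R)); exact: measurable_funTS.
have F0 m : (0 <= F m)%E by apply: erestrict_ge0 => ? _.
rewrite [in RHS]integral_mkcond.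
rewrite [in RHS](fubini_tonelli1 F mF F0) [LHS](fubini_tonelli1 _ mg g0).
rewrite -ge0_integralZl//; last 2 first.
- exact: measurable_fun_fubini_tonelli_F.
- by move=> x _; exact: integral_ge0.
apply: eq_integral => x _; rewrite /fubini_F.
rewrite ge0_symfun_integralT; last 3 first.
- by move=> y; exact: gdens_ge0.
- have := continuous_line (c1 := x) (c2 := 0) (e1 := 0) (e2 := 1) (gdens_continuous c0 c1).
  rewrite (_ : (fun t => gdens f0 f1 _) = (fun t => gdens f0 f1 (x, t)))//.
  by apply/funext => t; congr (gdens f0 f1 (_, _)); ring.
- move=> y /=; rewrite /gdens /wnorm /gauss /=; have [-> ->] := par x y.
  by rewrite normrN sqrrN.
congr (_ * _)%E.
(* The symmetric integral yields the closed half-line, [upper] the open one; the endpoint is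
   null. *)
rewrite -set_itvcy -integral_itv_obnd_cbnd; last first.
  apply: measurable_funTS; exact: (measurableT_comp mg (measurable_pair1 x)).
rewrite [LHS]integral_mkcond; apply: eq_integral => y _; rewrite /F !patchE.
suff -> : ((x, y) \in @upper R) = (y \in `]0, +oo[%classic) by [].
by apply/idP/idP; rewrite !inE/= in_itv/= andbT.
Qed.

Lemma slice_le_gdens f f0 f1 z : is_slice f f0 f1 ->
  `|f z| ^+ 2 * expR (- alpha * `|z| ^+ 2) <= 2 * gdens f0 f1 (hpi z).
Proof.
move=> [fE _ _ _]; have [J hJ zJ] := slice_ptP z.
rewrite (qnorm_im z) /gdens /wnorm /gauss /hpi/= mulNr [leRHS]mulrA.
rewrite ler_wpM2r ?expR_ge0//.
rewrite {1}zJ fE//; set p := f0 _; set q := f1 _.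
have : `|p + J * q| <= `|p| + `|q|.
  by apply: le_trans (ler_normD _ _) _; rewrite qnormM norm_unit_imag// mul1r.
have := normr_ge0 (p + J * q); have := sqr_ge0 (`|p| - `|q|).
move: `|p + J * q| `|p| `|q| => x y t; nra.
Qed.

Lemma fock_sqnorm_ge0 f : (0 <= fock_sqnorm alpha f)%E.
Proof.
apply: integral_ge0 => z _; rewrite lee_fin mulr_ge0 ?sqr_ge0//.
by rewrite mulr_ge0 ?expR_ge0// divr_ge0 ?mulr_ge0// pi_ge0.
Qed.

(** The product of 2 from [slice_le_gdens], 8 e^(2 alpha) from [gdens_submean] and pi / alpha from
    [integral_gdens]. *)
Definition pw_const : R := 16 * expR (2 * alpha) * (pi / alpha).

Lemma pw_const_ge0 : 0 <= pw_const.
Proof. by rewrite !mulr_ge0 ?expR_ge0 ?pi_ge0 ?invr_ge0. Qed.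

Lemma fock_pointwise f z : slice_regular f ->
  ((`|f z| ^+ 2 * expR (- alpha * `|z| ^+ 2))%:E <=
   pw_const%:E * fock_sqnorm alpha f)%E.
Proof.
move=> /slice_regularP[f0 [f1 [hf hq]]]; have [fE par c0 c1] := hf.
apply: (@le_trans _ _ (2%:E * (gdens f0 f1 (hpi z))%:E)%E).
  by rewrite -EFinM lee_fin slice_le_gdens.
apply: (@le_trans _ _ (2%:E * ((8 * expR (2 * alpha))%:E *
    \int[plane]_(m in sbox 1 (hpi z)) (gdens f0 f1 m)%:E))%E).
  by apply: lee_wpmul2l => //; exact: gdens_submean.
apply: (@le_trans _ _ (2%:E * ((8 * expR (2 * alpha))%:E *
    \int[plane]_m (gdens f0 f1 m)%:E))%E).
  apply: lee_wpmul2l => //; apply: lee_wpmul2l.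
    by rewrite lee_fin mulr_ge0// expR_ge0.
  by apply: integral_subset => // m _; rewrite lee_fin gdens_ge0.
rewrite (integral_gdens hf) !muleA -!EFinM /pw_const le_eqVlt; apply/orP; left.
by apply/eqP; congr (_%:E * _)%E; ring.
Qed.

End FockFunctions.

(** * Symmetric boxes as disks in the plane, and Gaussian integrals *)

Section PlaneGeometry.
Variable R : realType.
Local Notation H := (quat R).
Local Notation mR := (measurableTypeR R).
Local Notation leb := (@lebesgue_measure R).
Local Notation plane := (@plane_measure R).

Definition dist2 (m n : R * R) : R := (m.1 - n.1) ^+ 2 + (m.2 - n.2) ^+ 2.

Definition hball (s : R) (m : R * R) : set H := [set w | dist2 m (hpi w) < s ^+ 2].

Lemma slice_ptB (a b x y : R) (I : H) :
  slice_pt a b I - slice_pt x y I = slice_pt (a - x) (b - y) I.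
Proof. by rewrite /slice_pt opprD addrACA !scalerBl. Qed.

(** A slice disk may cross the real axis, but reflecting a point into the upper half plane does not
    move it away from the centre, whose height is nonnegative. *)
Lemma sym_boxE (z : H) (r : R) : 0 < r -> sym_box z r = hball r (hpi z).
Proof.
move=> r0; apply/seteqP; split=> w.
- move=> [I hI [[[a b] _ <-]]]; rewrite /hball/mkset => h.
  have -> : hpi (slice_pt a b I) = (a, `|b|) by rewrite /hpi q0_slice// im_norm_slice.
  move: h; rewrite /dist2/hpi/fst/snd => h.
  have hsub : slice_pt a b I - slice_pt (q0 z) (im_norm z) I =
      slice_pt (a - q0 z) (b - im_norm z) I by exact: slice_ptB.
  rewrite /= hsub in h; have : `|slice_pt (a - q0 z) (b - im_norm z) I| ^+ 2 < r ^+ 2.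
    by rewrite ltr_pXn2r ?nnegrE ?(ltW r0).
  rewrite qnorm_slice//; apply: le_lt_trans.
  have y0 := im_norm_ge0 z; have b0 := normr_ge0 b; have bb := ler_norm b.
  have b2 : `|b| ^+ 2 = b ^+ 2 by rewrite real_normK ?num_real.
  by move: (im_norm z) (q0 z) `|b| y0 b0 bb b2 => y x c *; nra.
- rewrite /hball/= => h; have [J hJ wJ] := slice_ptP w.
  exists J => //; split; first by exists (q0 w, im_norm w).
  have hsub : w - slice_pt (q0 z) (im_norm z) J =
      slice_pt (q0 w - q0 z) (im_norm w - im_norm z) J.
    by rewrite {1}wJ slice_ptB.
  rewrite /= hsub -(@ltr_pXn2r _ 2) ?nnegrE ?(ltW r0)// qnorm_slice//.
  by apply: le_lt_trans h; rewrite /dist2/= le_eqVlt; apply/orP; left; apply/eqP; ring.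
Qed.

Lemma continuous_dist2 m : continuous (dist2 m).
Proof.
move=> n; have sq (k : R * R -> R) c : k @ n --> k n ->
    (fun n => (c - k n) ^+ 2) @ n --> (c - k n) ^+ 2.
  move=> ck; apply: (cvg_comp (fun n => c - k n) (fun t : R => t ^+ 2)).
    have h1 : (fun=> c) @ n --> c by exact: cvg_cst.
    exact: cvgB h1 ck.
  exact: exprn_continuous.
by apply: cvgD; apply: sq; [exact: cvg_fst|exact: cvg_snd].
Qed.

Lemma measurable_dist2 m : measurable_fun [set: mR * mR] (dist2 m).
Proof. by apply: continuous_measurable_plane; exact: continuous_dist2. Qed.

Lemma measurable_gauss_dist2 (b : R) m :
  measurable_fun setT (fun n : mR * mR => expR (- (b * dist2 m n))).
Proof.
apply: (measurableT_comp (@measurable_expR R)); apply: measurableT_comp => //.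
by apply: measurable_funM => //; exact: measurable_dist2.
Qed.

Lemma measurable_hball s m : measurable (hball s m).
Proof.
have mf : measurable_fun [set: H] (fun w => dist2 m (hpi w) : mR).
  exact: measurableT_comp (measurable_dist2 m) (@measurable_hpi R).
rewrite (_ : hball s m = setT `&` (fun w => dist2 m (hpi w)) @^-1` `]-oo, s ^+ 2[%classic).
  exact: mf.
by rewrite setTI; apply/seteqP; split => w /=; rewrite in_itv.
Qed.

Definition sgraph (s : R) : set (H * (mR * mR)) := [set u | sbox s (hpi u.1) u.2].

Lemma measurable_sgraph s : measurable (sgraph s).
Proof.
have m21 : measurable_fun [set: H * (mR * mR)] (fun u => u.2.1).
  by apply: (measurableT_comp measurable_fst); exact: measurable_snd.
have m22 : measurable_fun [set: H * (mR * mR)] (fun u => u.2.2).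
  by apply: (measurableT_comp measurable_snd); exact: measurable_snd.
have m11 : measurable_fun [set: H * (mR * mR)] (fun u => q0 u.1 : mR).
  by apply: (measurableT_comp (@measurable_q0 R)); exact: measurable_fst.
have m12 : measurable_fun [set: H * (mR * mR)] (fun u => im_norm u.1 : mR).
  by apply: (measurableT_comp (@measurable_im_norm R)); exact: measurable_fst.
have mset (f : H * (mR * mR) -> R) : measurable_fun setT f ->
    measurable [set u | `|f u| <= s].
  move=> mf; rewrite (_ : [set _ | _] = setT `&` f @^-1` `[- s, s]%classic).
    exact: mf.
  by rewrite setTI; apply/seteqP; split => u /=; rewrite in_itv/= ler_norml.
rewrite (_ : sgraph s = [set u : H * (mR * mR) | `|u.2.1 - q0 u.1| <= s] `&`
    [set u : H * (mR * mR) | `|u.2.2 - im_norm u.1| <= s]).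
  by apply: measurableI; apply: mset; exact: measurable_funB.
by [].
Qed.

Lemma sbox_measure s p : 0 <= s -> (plane (sbox s p) = (4 * s ^+ 2)%:E)%E.
Proof.
move=> s0.
rewrite sboxE -[LHS]/((leb \x leb)%E _) product_measure1E//; [|exact: measurable_itv..].
rewrite /= !lebesgue_measure_itv/= !lte_fin.
move: s0; rewrite le_eqVlt => /orP[/eqP <-|s0].
  by rewrite !ifF ?mul0e ?expr0n ?mulr0// subr0 addr0 ltxx.
rewrite !ifT; [|by lra|by lra].
by rewrite -!EFinD -EFinM; congr EFin; ring.
Qed.

Lemma gauss_line (b c : R) : 0 < b ->
  (\int[leb]_x (expR (- (b * (c - x) ^+ 2)))%:E = (Num.sqrt (pi / b))%:E)%E.
Proof.
move=> b0; have sb : 0 < Num.sqrt b by rewrite sqrtr_gt0.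
have := @ge0_integral_affine R (- Num.sqrt b * c) (Num.sqrt b)
  (fun x => (gauss_fun x)%:E) (lt0r_neq0 sb) _ _.
rewrite integralT_gauss gtr0_norm// => E.
have {E} : (\int[leb]_x (gauss_fun (affine (- Num.sqrt b * c) (Num.sqrt b) x))%:E *
    (Num.sqrt b)%:E = (Num.sqrt pi)%:E)%E.
  apply: E => [|x]; last by rewrite lee_fin expR_ge0.
  by apply/measurable_EFinP; exact: measurable_gauss_fun.
have -> : (fun x => (gauss_fun (affine (- Num.sqrt b * c) (Num.sqrt b) x))%:E) =
    (fun x => (expR (- (b * (c - x) ^+ 2)))%:E).
  apply/funext => x; rewrite /gauss_fun /affine; congr (expR _)%:E; congr (- _).
  rewrite (_ : _ + _ = Num.sqrt b * (x - c)); last by ring.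
  by rewrite exprMn sqr_sqrtr ?(ltW b0)//; ring.
move=> E; rewrite sqrtrM ?pi_ge0// sqrtrV ?(ltW b0)// EFinM -E -muleA -EFinM.
by rewrite mulfV ?mule1// gt_eqF.
Qed.

Lemma gauss_plane (b : R) (m : R * R) : 0 < b ->
  (\int[plane]_n (expR (- (b * dist2 m n)))%:E = (pi / b)%:E)%E.
Proof.
move=> b0; have mF : measurable_fun setT (fun n : mR * mR => (expR (- (b * dist2 m n)))%:E).
  by apply/measurable_EFinP; exact: measurable_gauss_dist2.
rewrite [LHS](fubini_tonelli1 _ mF); last by move=> n; rewrite lee_fin expR_ge0.
rewrite /fubini_F /dist2 /=.
have mg c : measurable_fun [set: mR] (fun x => (expR (- (b * (c - x) ^+ 2)))%:E).
  apply/measurable_EFinP; apply: (measurableT_comp (@measurable_expR R)).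
  apply: measurableT_comp => //; apply: measurable_funM => //.
  by apply: measurable_funX; exact: measurable_funB.
transitivity (\int[leb]_x ((expR (- (b * (m.1 - x) ^+ 2)))%:E * (Num.sqrt (pi / b))%:E))%E.
  apply: eq_integral => x _.
  rewrite -(gauss_line m.2 b0) -(ge0_integralZl _ measurableT (mg m.2)); last 2 first.
  - by move=> y _; rewrite lee_fin expR_ge0.
  - by rewrite lee_fin expR_ge0.
  by apply: eq_integral => y _; rewrite -EFinM -expRD; congr (expR _)%:E; ring.
rewrite (ge0_integralZr _ measurableT (mg m.1)); last 2 first.
- by move=> y _; rewrite lee_fin expR_ge0.
- by rewrite lee_fin sqrtr_ge0.
by rewrite gauss_line// -EFinM -expr2 sqr_sqrtr// divr_ge0 ?pi_ge0// ltW.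
Qed.

End PlaneGeometry.

(** * Sigma-finiteness as a structure *)

Section SigmaFiniteCopy.
Context d (T : measurableType d) (R : realType).
Variable mu : {measure set T -> \bar R}.

(** The same measure, indexed by the proof of sigma-finiteness so that Tonelli can find it. *)
Definition sf_copy (sf : sigma_finite setT mu) : set T -> \bar R := mu.
HB.instance Definition _ sf := Measure.on (sf_copy sf).
HB.instance Definition _ sf := Measure_isSigmaFinite.Build _ _ _ (sf_copy sf) sf.

End SigmaFiniteCopy.

(** * Box bounds and Gaussian averages of mu *)

Section MuIntegrals.
Variable R : realType.
Local Notation H := (quat R).
Local Notation mR := (measurableTypeR R).
Local Notation plane := (@plane_measure R).
Variable mu : {measure set H -> \bar R}.
Hypothesis mu_sf : sigma_finite setT mu.

Lemma tonelli_mu (F : H * (mR * mR) -> \bar R) : measurable_fun setT F ->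
  (forall u, 0 <= F u)%E ->
  (\int[mu]_w \int[plane]_n F (w, n) = \int[plane]_n \int[mu]_w F (w, n))%E.
Proof.
move=> mF F0.
pose nu : {sigma_finite_measure set H -> \bar R} :=
  sf_copy mu_sf.
have E (D : set H) (f : H -> \bar R) : (\int[mu]_(w in D) f w = \int[nu]_(w in D) f w)%E.
  by apply: eq_measure_integral.
rewrite E; transitivity (\int[plane]_n \int[nu]_w F (w, n))%E.
  exact: (fubini_tonelli F mF F0).
by apply: eq_integral => n _; rewrite -E.
Qed.

Lemma measurable_mu_integral (F : H * (mR * mR) -> \bar R) : measurable_fun setT F ->
  (forall u, 0 <= F u)%E -> measurable_fun setT (fun n => \int[mu]_w F (w, n))%E.
Proof.
move=> mF F0.
pose nu : {sigma_finite_measure set H -> \bar R} :=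
  sf_copy mu_sf.
have -> : (fun n => \int[mu]_w F (w, n))%E = (fun n => \int[nu]_w F (w, n))%E.
  by apply/funext => n; apply: eq_measure_integral.
exact: (measurable_fun_fubini_tonelli_G F mF F0).
Qed.

(** The form of (c) suited to Tonelli: n is any point of the plane, and w varies over the points
    whose box contains it. *)
Definition box_bounded (s C : R) := forall n : R * R,
  (mu [set w | sbox s (hpi w) n] <= C%:E)%E.

Lemma box_bounded_ge0 s C : box_bounded s C -> 0 <= C.
Proof. by move=> bC; rewrite -lee_fin; apply: le_trans (bC (0, 0)). Qed.

Lemma measurable_sbox_section s (n : R * R) : measurable [set w : H | sbox s (hpi w) n].
Proof.
rewrite (_ : [set _ | _] = ysection (@sgraph R s) n).
  exact: measurable_ysection (measurable_sgraph s).
by apply/seteqP; split => w; rewrite /ysection/= inE.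
Qed.

(** After exchanging the integrals, each n is counted with the mass of the w whose box contains
    n. *)
Lemma integral_sbox_le (s C : R) (Psi : R * R -> R) : box_bounded s C ->
  measurable_fun [set: mR * mR] (Psi : mR * mR -> R) -> (forall n, 0 <= Psi n) ->
  (\int[mu]_w \int[plane]_(n in sbox s (hpi w)) (Psi n)%:E <=
   C%:E * \int[plane]_n (Psi n)%:E)%E.
Proof.
move=> bC mPsi Psi0.
have C0 : (0 <= C%:E)%E by rewrite lee_fin (box_bounded_ge0 bC).
pose F := (fun u : H * (mR * mR) => (Psi u.2)%:E) \_ (@sgraph R s).
have mF : measurable_fun setT F.
  apply/(measurable_restrictT _ (measurable_sgraph s)); apply: measurable_funTS.
  by apply/measurable_EFinP; apply: (measurableT_comp mPsi); exact: measurable_snd.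
have F0 u : (0 <= F u)%E by apply: erestrict_ge0 => ? _; rewrite lee_fin.
have -> : (\int[mu]_w \int[plane]_(n in sbox s (hpi w)) (Psi n)%:E =
    \int[mu]_w \int[plane]_n F (w, n))%E.
  apply: eq_integral => w _; rewrite integral_mkcond; apply: eq_integral => n _.
  rewrite /F !patchE; suff -> : ((w, n) \in @sgraph R s) = (n \in sbox s (hpi w)) by [].
  by apply/idP/idP; rewrite !inE.
rewrite tonelli_mu//.
rewrite -(ge0_integralZl _ measurableT); last 3 first.
- exact/measurable_EFinP.
- by move=> n _; rewrite lee_fin.
- by [].
apply: integral_monoT => n; first exact: integral_ge0.
rewrite muleC; apply: le_trans (lee_wpmul2l _ (bC n)); last by rewrite lee_fin.
rewrite -integral_cst; last exact: measurable_sbox_section.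
rewrite [leRHS]integral_mkcond; apply: integral_monoT => w //.
Qed.

Definition gauss_mu (b : R) (m : R * R) : \bar R :=
  (\int[mu]_w (expR (- (b * dist2 m (hpi w))))%:E)%E.

(** The Gaussian at [hpi w] is replaced by its mean over the box around [hpi w], of area 4 s^2. On
    the box |m - n|^2 <= 2 |m - hpi w|^2 + 4 s^2, so halving the exponent and paying e^(2 b s^2)
    makes it a function of n, of total integral 2 pi / b. *)
Lemma gauss_mu_bounded (s C b : R) (m : R * R) : 0 < s -> 0 < b -> box_bounded s C ->
  (gauss_mu b m <= ((4 * s ^+ 2)^-1 * expR (2 * b * s ^+ 2) * C * (2 * pi / b))%:E)%E.
Proof.
move=> s0 b0 bC; pose k := (4 * s ^+ 2)^-1 * expR (2 * b * s ^+ 2).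
have s20 : 0 < 4 * s ^+ 2 by rewrite mulr_gt0// exprn_gt0.
have k0 : 0 <= k by rewrite mulr_ge0 ?expR_ge0// invr_ge0 ltW.
pose Psi n := k * expR (- (b / 2 * dist2 m n)).
have mexp := @measurable_gauss_dist2 R (b / 2) m.
have mPsi : measurable_fun [set: mR * mR] (Psi : mR * mR -> R).
  exact: measurable_funM.
have Psi0 n : 0 <= Psi n by rewrite mulr_ge0// expR_ge0.
apply: (@le_trans _ _ (\int[mu]_w \int[plane]_(n in sbox s (hpi w)) (Psi n)%:E)%E).
  apply: integral_monoT => w; first by rewrite lee_fin expR_ge0.
  have -> : (expR (- (b * dist2 m (hpi w))))%:E =
      (\int[plane]_(n in sbox s (hpi w)) ((4 * s ^+ 2)^-1 * expR (- (b * dist2 m (hpi w))))%:E)%E.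
    rewrite integral_cst; last exact: measurable_sbox.
    rewrite [X in (_ * X)%E](sbox_measure _ (ltW s0)) -EFinM mulrAC mulVf ?mul1r//.
    by rewrite gt_eqF.
  apply: integral_mono => n.
    by rewrite lee_fin mulr_ge0 ?expR_ge0// invr_ge0 ltW.
  move=> [n1 n2]; rewrite lee_fin /Psi /k -mulrA ler_wpM2l ?invr_ge0 ?(ltW s20)//.
  rewrite -expRD ler_expR.
  have sq (t : R) : `|t| <= s -> t ^+ 2 <= s ^+ 2.
    by move=> ts; rewrite -real_normK ?num_real// lerXn2r ?nnegrE// ltW.
  have tri (x y z : R) : (z - y) ^+ 2 <= s ^+ 2 -> (x - z) ^+ 2 <= 2 * (x - y) ^+ 2 + 2 * s ^+ 2.
    move=> h; have := sqr_ge0 ((x - y) + (z - y)); move: h; nra.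
  have t1 := tri m.1 _ _ (sq _ n1); have t2 := tri m.2 _ _ (sq _ n2).
  have {t1 t2} t : dist2 m n <= 2 * dist2 m (hpi w) + 4 * s ^+ 2.
    by rewrite /dist2; lra.
  have := ler_wpM2l (ltW b0) t; lra.
apply: le_trans (integral_sbox_le bC mPsi Psi0) _.
rewrite /Psi; under eq_integral do rewrite EFinM.
rewrite (ge0_integralZl _ measurableT); last 3 first.
- exact/measurable_EFinP.
- by move=> n _; rewrite lee_fin expR_ge0.
- by rewrite lee_fin.
rewrite gauss_plane; last by rewrite divr_gt0.
rewrite -!EFinM lee_fin le_eqVlt; apply/orP; left; apply/eqP.
by rewrite -/k; move: (@pi R) => P; field; rewrite gt_eqF.
Qed.

(** A box of half-side r / 2 lies in the disk of radius r. *)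
Lemma box_bounded_of_average (r : R) : 0 < r -> bounded_above (box_average mu r) ->
  exists C, box_bounded (r / 2) C.
Proof.
move=> r0 [C hC]; exists (C * (pi * r ^+ 2)) => n.
(* A point n below the axis is reflected to a centre of a symmetric box; this does not increase the
   distance of the heights to any [im_norm w]. *)
pose z := slice_pt n.1 `|n.2| (qi R).
have hz : hpi z = (n.1, `|n.2|).
  rewrite /hpi q0_slice ?im_norm_slice ?normr_id//; exact: unit_imag_qi.
have pr : 0 < pi * r ^+ 2 by rewrite mulr_gt0 ?pi_gt0// exprn_gt0.
apply: (@le_trans _ _ (mu (sym_box z r))).
  apply: le_measure; rewrite ?inE.
  - exact: measurable_sbox_section.
  - by rewrite sym_boxE//; exact: measurable_hball.
  rewrite sym_boxE// => w [/= h1 h2]; rewrite /hball/= hz /dist2/=.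
  have sq (t : R) : `|t| <= r / 2 -> t ^+ 2 <= (r / 2) ^+ 2.
    by move=> ts; rewrite -real_normK ?num_real// lerXn2r ?nnegrE// divr_ge0// ltW.
  have h3 := le_trans (ler_dist_dist n.2 (im_norm w)) h2.
  rewrite (ger0_norm (im_norm_ge0 w)) in h3.
  have := sq _ h1; have := sq _ h3; have : 0 < r ^+ 2 by rewrite exprn_gt0.
  by move: (r ^+ 2) (expr_div_n r 2 2) => r2 ->; lra.
have := hC z; rewrite /box_average.
by rewrite -(@lee_pmul2r _ (pi * r ^+ 2)%:E)// ?lte_fin// -muleA -EFinM mulVf ?mule1// gt_eqF.
Qed.

(** Chebyshev: on the box of radius r the Gaussian is at least e^(- b r^2). The radius is arbitrary,
    which yields (c) for every r. *)
Lemma gauss_mu_average (b C r : R) : 0 < r -> 0 < b ->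
  (forall m : R * R, 0 <= m.2 -> (gauss_mu b m <= C%:E)%E) ->
  bounded_above (box_average mu r).
Proof.
move=> r0 b0 hC; exists (expR (b * r ^+ 2) * C * (pi * r ^+ 2)^-1) => z.
rewrite /box_average EFinM; apply: lee_wpmul2r.
  by rewrite lee_fin invr_ge0 mulr_ge0 ?pi_ge0// sqr_ge0.
have e0 : (0 <= (expR (b * r ^+ 2))%:E)%E by rewrite lee_fin expR_ge0.
have := lee_wpmul2l e0 (hC (hpi z) (im_norm_ge0 z)); rewrite -EFinM.
apply: le_trans; rewrite sym_boxE//.
have mh := measurable_hball r (hpi z).
rewrite /gauss_mu -(ge0_integralZl _ measurableT); last 3 first.
- apply/measurable_EFinP.
  exact: measurableT_comp (measurable_gauss_dist2 _ _) (@measurable_hpi R).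
- by move=> w _; rewrite lee_fin expR_ge0.
- by [].
apply: (@le_trans _ _ (\int[mu]_(w in hball r (hpi z)) 1%:E)%E).
  by rewrite integral_cst// mul1e.
apply: (@le_trans _ _ (\int[mu]_(w in hball r (hpi z))
    ((expR (b * r ^+ 2))%:E * (expR (- (b * dist2 (hpi z) (hpi w))))%:E))%E).
  apply: integral_mono => w; first by rewrite lee_fin.
  rewrite /hball/= => h; rewrite -EFinM lee_fin -expRD -[leLHS]expR0 ler_expR.
  by rewrite subr_ge0 ler_wpM2l// ltW.
by apply: integral_subset => // w _; rewrite mule_ge0// lee_fin expR_ge0.
Qed.

End MuIntegrals.

(** * The Berezin transform and the Carleson embedding *)

Section BerezinCarleson.
Variable R : realType.
Local Notation H := (quat R).
Local Notation mR := (measurableTypeR R).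
Local Notation plane := (@plane_measure R).
Variable alpha : R.
Hypothesis alpha_gt0 : 0 < alpha.
Let alpha_ge0 : 0 <= alpha := ltW alpha_gt0.
Local Notation K := (fock_kernel alpha).

Lemma kernel_normC z w : `|K z w| = `|K w z|.
Proof. by rewrite -(kernel_conj alpha_ge0) qnorm_conj. Qed.

(** Conjugating z replaces its unit I by -I, hence t by -t, and the two weights change places. *)
Let kernel_split z w : exists t : R, [/\ `|t| <= 1,
  `|K w z| ^+ 2 = (1 + t) / 2 * expR (2 * (alpha * (q0 w * q0 z + im_norm w * im_norm z))) +
    (1 - t) / 2 * expR (2 * (alpha * (q0 w * q0 z - im_norm w * im_norm z))) &
  `|K w (qconj z)| ^+ 2 =
    (1 - t) / 2 * expR (2 * (alpha * (q0 w * q0 z + im_norm w * im_norm z))) +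
    (1 + t) / 2 * expR (2 * (alpha * (q0 w * q0 z - im_norm w * im_norm z)))].
Proof.
have [I hI zI] := slice_ptP z; have [J hJ wJ] := slice_ptP w.
exists (imdot J I); split; first exact: imdot_le1.
  by rewrite {1}zI {1}wJ kernel_sqr.
rewrite {1}zI {1}wJ qconj_slice// slice_ptN kernel_sqr//; last exact: unit_imagN.
have -> : imdot J (- I) = - imdot J I by rewrite /imdot /=; ring.
by rewrite opprK.
Qed.

Let expo_le z w : expR (2 * (alpha * (q0 w * q0 z - im_norm w * im_norm z))) <=
  expR (2 * (alpha * (q0 w * q0 z + im_norm w * im_norm z))).
Proof.
rewrite ler_expR ler_wpM2l// ler_wpM2l// lerD2l.
have := mulr_ge0 (im_norm_ge0 w) (im_norm_ge0 z); lra.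
Qed.

Lemma kernel_le z w :
  `|K w z| ^+ 2 <= expR (2 * (alpha * (q0 w * q0 z + im_norm w * im_norm z))).
Proof.
have [t [t1 e1 _]] := kernel_split z w.
rewrite {}e1; have := expo_le z w.
move: (expR _) (expR _) (expR_ge0 (2 * (alpha * (q0 w * q0 z - im_norm w * im_norm z)))).
by move: t1; rewrite ler_norml => /andP[t1 t2] x y y0 xy; nra.
Qed.

Lemma kernel_add_ge z w :
  expR (2 * (alpha * (q0 w * q0 z + im_norm w * im_norm z))) <=
  `|K w z| ^+ 2 + `|K w (qconj z)| ^+ 2.
Proof.
have [t [t1 e1 e2]] := kernel_split z w.
rewrite [leRHS](congr2 +%R e1 e2) => {e1 e2}.
set x := expR _; set y := expR (2 * (alpha * (_ - _))).
rewrite (_ : _ + _ = x + y); last by field.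
by rewrite lerDl expR_ge0.
Qed.

Let gauss_expo z w : expR (- (alpha * `|w| ^+ 2)) * expR (- (alpha * `|z| ^+ 2)) *
  expR (2 * (alpha * (q0 w * q0 z + im_norm w * im_norm z))) =
  expR (- (alpha * dist2 (hpi z) (hpi w))).
Proof.
by rewrite -!expRD (qnorm_im w) (qnorm_im z) /dist2 /hpi/=; congr expR; ring.
Qed.

Definition ker_dens (z w : H) : R :=
  expR (- (alpha * `|w| ^+ 2)) * expR (- (alpha * `|z| ^+ 2)) * `|K w z| ^+ 2.

Lemma ker_dens_ge0 z w : 0 <= ker_dens z w.
Proof. by rewrite !mulr_ge0 ?expR_ge0 ?sqr_ge0. Qed.

Lemma ker_dens_le z w : ker_dens z w <= expR (- (alpha * dist2 (hpi z) (hpi w))).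
Proof. by rewrite -gauss_expo ler_wpM2l ?mulr_ge0 ?expR_ge0// kernel_le. Qed.

Lemma qnorm_qconj_sqr (z : H) : `|qconj z| ^+ 2 = `|z| ^+ 2.
Proof. by rewrite qnorm_conj. Qed.

Lemma ker_dens_add_ge z w : expR (- (alpha * dist2 (hpi z) (hpi w))) <=
  ker_dens z w + ker_dens (qconj z) w.
Proof.
rewrite -gauss_expo /ker_dens qnorm_qconj_sqr -mulrDr.
by rewrite ler_wpM2l ?mulr_ge0 ?expR_ge0// kernel_add_ge.
Qed.

Lemma slice_of_regular (f : H -> H) : slice_regular f -> measurable_fun setT f.
Proof. by move=> /slice_regularP[f0 [f1 [hf _]]]; exact: measurable_slice_fun hf. Qed.

Lemma measurable_qnorm_sqr (f : H -> H) : measurable_fun setT f ->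
  measurable_fun setT (fun w => `|f w| ^+ 2 : R).
Proof.
by move=> mf; apply: measurable_funX; exact: measurableT_comp (@measurable_qnorm R) mf.
Qed.

Lemma measurable_gauss_qnorm (b : R) :
  measurable_fun [set: H] (fun w => expR (- (b * `|w| ^+ 2))).
Proof.
apply: (measurableT_comp (@measurable_expR R)); apply: measurableT_comp => //.
apply: measurable_funM => //; apply: measurable_funX; exact: measurable_qnorm.
Qed.

Lemma measurable_fock_weight :
  measurable_fun [set: H] (fun w => expR (- alpha * `|w| ^+ 2)).
Proof. by under eq_fun do rewrite mulNr; exact: measurable_gauss_qnorm. Qed.

Lemma measurable_ker_dens z : measurable_fun [set: H] (ker_dens z).
Proof.
apply: measurable_funM.
  by apply: measurable_funM => //; exact: measurable_gauss_qnorm.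
by apply: measurable_qnorm_sqr; apply: slice_of_regular; exact: kernel_slice_regular.
Qed.

Variable mu : {measure set H -> \bar R}.

Lemma berezinE z : berezin alpha mu z = (\int[mu]_w (ker_dens z w)%:E)%E.
Proof.
apply: eq_integral => w _; congr EFin; rewrite /fock_nkernel scalerA normrZ exprMn.
rewrite ger0_norm ?mulr_ge0 ?expR_ge0// /ker_dens; congr (_ * _).
by rewrite exprMn !expr2 -!expRD; congr expR; field.
Qed.

Lemma berezin_le z : (berezin alpha mu z <= gauss_mu mu alpha (hpi z))%E.
Proof.
rewrite berezinE; apply: integral_monoT => w; first by rewrite lee_fin ker_dens_ge0.
by rewrite lee_fin ker_dens_le.
Qed.

Lemma berezin_ge z :
  (gauss_mu mu alpha (hpi z) <= berezin alpha mu z + berezin alpha mu (qconj z))%E.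
Proof.
rewrite !berezinE -ge0_integralD//; last 4 first.
- by move=> w _; rewrite lee_fin ker_dens_ge0.
- by apply/measurable_EFinP; exact: measurable_ker_dens.
- by move=> w _; rewrite lee_fin ker_dens_ge0.
- by apply/measurable_EFinP; exact: measurable_ker_dens.
by apply: integral_monoT => w; rewrite lee_fin ?expR_ge0// ker_dens_add_ge.
Qed.

Lemma hpi_surj (m : R * R) : 0 <= m.2 -> exists z : H, hpi z = m.
Proof.
case: m => x y /= y0; exists (slice_pt x y (qi R)).
by rewrite /hpi q0_slice ?im_norm_slice ?ger0_norm//; exact: unit_imag_qi.
Qed.

Lemma gauss_mu_of_berezin : bounded_above (berezin alpha mu) ->
  exists C, forall m : R * R, 0 <= m.2 -> (gauss_mu mu alpha m <= C%:E)%E.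
Proof.
move=> [C hC]; exists (C + C) => m /hpi_surj[z <-].
by apply: le_trans (berezin_ge z) _; rewrite EFinD; apply: leeD; exact: hC.
Qed.

Lemma kernel0 w : `|K 0 w| ^+ 2 = 1.
Proof.
apply: etrans (congr1 (fun x => x ^+ 2) (kernel_normC 0 w)) _.
have [t [_ e _]] := kernel_split 0 w; apply: etrans e _.
have -> : im_norm (0 : H) = 0 by rewrite /im_norm /= scale0r subrr normr0.
by rewrite !mulr0 addr0 subr0 !mulr0 expR0; field.
Qed.

(** Since |K(0, w)| = 1, the hypothesis at 0 says that e^(- alpha |w|^2) is integrable; so balls
    about 0 have finite mass. *)
Lemma sigma_finite_mu : (forall z : H, (\int[mu]_w (`|K z w| ^+ 2
    * expR (- alpha * `|w| ^+ 2))%:E < +oo)%E) -> sigma_finite setT mu.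
Proof.
move=> hK; have h0 := hK 0.
exists (fun n => [set w : H | `|w| <= n%:R]).
  apply/seteqP; split => // w _; exists (Num.bound `|w|) => //=.
  exact/ltW/archi_boundP.
move=> n; have mB : measurable [set w : H | `|w| <= n%:R].
  rewrite (_ : [set _ | _] = setT `&` (fun w : H => `|w| : R) @^-1` `]-oo, n%:R]%classic).
    exact: (@measurable_qnorm R).
  by rewrite setTI; apply/seteqP; split => w /=; rewrite in_itv.
split => //.
have e0 : 0 < expR (- (alpha * n%:R ^+ 2)) by exact: expR_gt0.
suff : ((expR (- (alpha * n%:R ^+ 2)))%:E * mu [set w : H | (`|w| <= n%:R)%R] < +oo)%E.
  move=> h; have : ((expR (- (alpha * n%:R ^+ 2)))^-1%:E *
    ((expR (- (alpha * n%:R ^+ 2)))%:E * mu [set w : H | (`|w| <= n%:R)%R]) < +oo)%E.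
    by apply: lte_mul_pinfty => //; rewrite lee_fin invr_ge0 ltW.
  by rewrite muleA -EFinM mulVf ?mul1e// gt_eqF.
apply: le_lt_trans h0; rewrite -integral_cst//.
apply: (@le_trans _ _ (\int[mu]_(w in [set w : H | (`|w| <= n%:R)%R])
  (`|K 0 w| ^+ 2 * expR (- alpha * `|w| ^+ 2))%:E)%E).
  apply: integral_mono => w; first by rewrite lee_fin ltW.
  move=> /= wn; rewrite lee_fin kernel0 mul1r ler_expR mulNr lerN2 ler_wpM2l//.
  by rewrite lerXn2r ?nnegrE.
by apply: integral_subset => // w _; rewrite lee_fin mulr_ge0 ?sqr_ge0 ?expR_ge0.
Qed.

Hypothesis mu_sf : sigma_finite setT mu.

Definition carleson_const (C : R) := 16 * expR (2 * alpha) * C * (pi / alpha).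

(** The bound of |f(w)|^2 by an integral over the box at [hpi w] is integrated against mu before the
    box is enlarged, so [integral_sbox_le] costs only the factor C. *)
Lemma carleson (C : R) (f : H -> H) : box_bounded mu 1 C -> slice_regular f ->
  (\int[mu]_w (`|f w| ^+ 2 * expR (- alpha * `|w| ^+ 2))%:E <=
   (carleson_const C)%:E * fock_sqnorm alpha f)%E.
Proof.
move=> bC /slice_regularP[f0 [f1 [hf hq]]]; have [fE par c0 c1] := hf.
pose k := 16 * expR (2 * alpha).
have k0 : 0 <= k by rewrite mulr_ge0// expR_ge0.
pose Psi n := k * gdens alpha f0 f1 n.
have mg : measurable_fun [set: mR * mR] (gdens alpha f0 f1 : mR * mR -> R).
  by apply: continuous_measurable_plane; exact: gdens_continuous.
have mPsi : measurable_fun [set: mR * mR] (Psi : mR * mR -> R) by exact: measurable_funM.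
have Psi0 n : 0 <= Psi n by rewrite mulr_ge0// gdens_ge0.
apply: (@le_trans _ _ (\int[mu]_w \int[plane]_(n in sbox 1 (hpi w)) (Psi n)%:E)%E).
  apply: integral_monoT => w; first by rewrite lee_fin mulr_ge0 ?sqr_ge0 ?expR_ge0.
  apply: (@le_trans _ _ (2%:E * (gdens alpha f0 f1 (hpi w))%:E)%E).
    by rewrite -EFinM lee_fin slice_le_gdens.
  apply: (@le_trans _ _ (2%:E * ((8 * expR (2 * alpha))%:E *
      \int[plane]_(m in sbox 1 (hpi w)) (gdens alpha f0 f1 m)%:E))%E).
    by apply: lee_wpmul2l => //; exact: gdens_submean.
  rewrite muleA -EFinM mulrA -natrM -/k.
  rewrite -(ge0_integralZl _ (@measurable_sbox R _ _)); last 3 first.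
  - by apply: measurable_funTS; exact/measurable_EFinP.
  - by move=> m _; rewrite lee_fin gdens_ge0.
  - by rewrite lee_fin.
  by [].
apply: le_trans (integral_sbox_le mu_sf bC mPsi Psi0) _.
rewrite /Psi; under eq_integral do rewrite EFinM.
rewrite (ge0_integralZl _ measurableT); last 3 first.
- exact/measurable_EFinP.
- by move=> n _; rewrite lee_fin gdens_ge0.
- by rewrite lee_fin.
rewrite (integral_gdens alpha_gt0 hf) !muleA -!EFinM le_eqVlt; apply/orP; left.
by apply/eqP; congr (_%:E * _)%E; rewrite /k /carleson_const; ring.
Qed.

Lemma carleson_fin (C : R) (f : H -> H) : box_bounded mu 1 C -> slice_regular f ->
  (fock_sqnorm alpha f < +oo)%E ->
  (\int[mu]_w (`|f w| ^+ 2 * expR (- alpha * `|w| ^+ 2))%:E < +oo)%E.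
Proof.
move=> bC f_reg f_fin; apply: le_lt_trans (carleson bC f_reg) _.
apply: lte_mul_pinfty => //; rewrite lee_fin /carleson_const.
by rewrite !mulr_ge0 ?expR_ge0 ?pi_ge0 ?invr_ge0// (box_bounded_ge0 bC).
Qed.

End BerezinCarleson.

(** * The Berezin transform through the Toeplitz operator *)

Section BerezinToeplitz.
Variable R : realType.
Local Notation H := (quat R).
Local Notation mR := (measurableTypeR R).
Local Notation plane := (@plane_measure R).

Lemma integral_dV_hpi (psi : mR * mR -> R) : measurable_fun setT psi ->
  (forall m, 0 <= psi m) ->
  (\int[@dV R]_z (psi (hpi z))%:E = \int[plane]_(m in @upper R) (psi m)%:E)%E.
Proof.
move=> mpsi psi0; rewrite ge0_integral_dV; last 2 first.
- by apply/measurable_EFinP; exact: measurableT_comp mpsi (@measurable_hpi R).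
- by move=> z; rewrite lee_fin.
apply: eq_integral => m; rewrite inE => m0.
(* With p = 1 and q = 0 this says that the sphere has mass 1. *)
have h := @sphere_average R 1 0 (psi m) (psi0 m).
rewrite normr0 qnorm1 expr1n expr0n/= addr0 mulr1 in h.
rewrite -[RHS]h; apply: eq_integral => t _.
have hI := unit_imag_sphere_pt t.
rewrite mulr0 addr0 qnorm1 expr1n mulr1 /hpi q0_slice// im_norm_slice//.
by rewrite gtr0_norm// -surjective_pairing.
Qed.

Lemma integral_dV_hpi_le (psi : mR * mR -> R) : measurable_fun setT psi ->
  (forall m, 0 <= psi m) ->
  (\int[@dV R]_z (psi (hpi z))%:E <= \int[plane]_m (psi m)%:E)%E.
Proof.
move=> mpsi psi0; rewrite integral_dV_hpi//.
by apply: integral_subset => // m _; rewrite lee_fin.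
Qed.

Variable alpha : R.
Hypothesis alpha_gt0 : 0 < alpha.
Let alpha_ge0 : 0 <= alpha := ltW alpha_gt0.
Local Notation K := (fock_kernel alpha).
Local Opaque fock_kernel.

(** Integrates the Gaussian bound of [ker_dens_le]; the 2 comes from enlarging the half plane to the
    plane. *)
Lemma kernel_sqnorm_le z :
  (fock_sqnorm alpha (fun w => K w z) <= (2 * expR (alpha * `|z| ^+ 2))%:E)%E.
Proof.
pose k := 2 * alpha / pi * expR (alpha * `|z| ^+ 2).
have k0 : 0 <= k by rewrite mulr_ge0 ?expR_ge0// divr_ge0 ?mulr_ge0// pi_ge0.
pose psi n := k * expR (- (alpha * dist2 (hpi z) n)).
have mg := @measurable_gauss_dist2 R alpha (hpi z).
have mpsi : measurable_fun [set: mR * mR] (psi : mR * mR -> R).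
  exact: measurable_funM.
have psi0 m : 0 <= psi m by rewrite mulr_ge0 ?expR_ge0.
apply: (@le_trans _ _ (\int[@dV R]_w (psi (hpi w))%:E)%E).
  apply: integral_monoT => w; rewrite lee_fin.
    by rewrite mulr_ge0 ?sqr_ge0// mulr_ge0 ?expR_ge0// divr_ge0 ?mulr_ge0// pi_ge0.
  apply: le_trans (ler_wpM2l k0 (ker_dens_le alpha_gt0 z w)).
  rewrite /k /ker_dens mulNr; move: (`|K w z| ^+ 2) => x.
  rewrite le_eqVlt; apply/orP; left; apply/eqP.
  rewrite (expRN (alpha * `|z| ^+ 2)); have := expR_gt0 (alpha * `|z| ^+ 2).
  have := pi_gt0 R; move: (@pi R) (expR _) (expR _) => P e1 e2 P0 e20.
  by field; rewrite !gt_eqF.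
apply: le_trans (integral_dV_hpi_le mpsi psi0) _.
rewrite /psi; under eq_integral do rewrite EFinM.
rewrite (ge0_integralZl _ measurableT); last 3 first.
- exact/measurable_EFinP.
- by move=> n _; rewrite lee_fin expR_ge0.
- by rewrite lee_fin.
rewrite gauss_plane// -EFinM lee_fin le_eqVlt; apply/orP; left; apply/eqP.
rewrite /k; have := pi_gt0 R; move: (@pi R) (expR _) => P e1 P0.
by field; rewrite !gt_eqF.
Qed.

Lemma fock_norm_sqr f : fock alpha f ->
  ((fock_norm alpha f ^+ 2)%:E = fock_sqnorm alpha f)%E.
Proof.
move=> [_ h]; have h0 := fock_sqnorm_ge0 alpha_gt0 f.
rewrite sqr_sqrtr ?fine_ge0// fineK// ge0_fin_numE//.
Qed.

Lemma fock_kernel_fock z : fock alpha (fun w => K w z).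
Proof.
split; first exact: kernel_slice_regular.
exact: le_lt_trans (kernel_sqnorm_le z) (ltry _).
Qed.

Lemma kernel_mul_conj z w : K z w * K w z = (`|K w z| ^+ 2)%:A.
Proof.
apply: etrans (congr1 (fun x => x * K w z) (esym (kernel_conj alpha_ge0 w z))) _.
exact: qconj_sqr.
Qed.

Variable mu : {measure set H -> \bar R}.
Hypothesis kernel_sq_int : forall z : H,
  (\int[mu]_w (`|K z w| ^+ 2 * expR (- alpha * `|w| ^+ 2))%:E < +oo)%E.

Let kernel_dens_int z :
  (\int[mu]_w (expR (- alpha * `|w| ^+ 2) * `|K w z| ^+ 2)%:E < +oo)%E.
Proof.
apply: le_lt_trans (kernel_sq_int z); apply: integral_monoT => w.
  by rewrite lee_fin mulr_ge0 ?sqr_ge0 ?expR_ge0.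
rewrite lee_fin mulrC [in leLHS](kernel_normC alpha_gt0 w z); exact: lexx.
Qed.

(** K(z, w) K(w, z) = |K(w, z)|^2 is real, so only the coordinate [q0] enters; the kernel hypothesis
    makes its integral finite, so nothing is lost in the real-valued integral. *)
Lemma berezin_toeplitz z : berezin alpha mu z =
  (expR (- (alpha * `|z| ^+ 2)) * q0 (toeplitz alpha mu (fun w => K w z) z))%:E.
Proof.
rewrite berezinE EFinM /toeplitz /=.
have -> : (\int[mu]_w (expR (- alpha * `|w| ^+ 2) * q0 (K z w * K w z)))%R =
    (\int[mu]_w (expR (- alpha * `|w| ^+ 2) * `|K w z| ^+ 2))%R.
  by apply: eq_Rintegral => w _; rewrite kernel_mul_conj/= mulr1.
rewrite /Rintegral fineK; last first.
  rewrite ge0_fin_numE//; apply: integral_ge0 => w _.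
  by rewrite lee_fin mulr_ge0 ?sqr_ge0 ?expR_ge0.
rewrite -(ge0_integralZl _ measurableT); last 3 first.
- apply/measurable_EFinP; apply: measurable_funM.
    exact: measurable_fock_weight.
  by apply: measurable_qnorm_sqr; apply: slice_of_regular; exact: kernel_slice_regular.
- by move=> w _; rewrite lee_fin mulr_ge0 ?sqr_ge0 ?expR_ge0.
- by rewrite lee_fin expR_ge0.
apply: eq_integral => w _; rewrite -EFinM /ker_dens mulNr.
by rewrite [in RHS]mulrA (mulrC (expR (- (alpha * `|w| ^+ 2)))).
Qed.

Lemma berezin_bounded_of_toeplitz : toeplitz_bounded alpha mu ->
  bounded_above (berezin alpha mu).
Proof.
(* The estimates bound the square of a value x; the bound x <= 1 + x^2 saves taking a root. *)
move=> [T [Tf _ [C hC] Tg]]; exists (1 + pw_const alpha * (C ^+ 2 * 2)) => z.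
set f := fun w => K w z.
have ff : fock alpha f by exact: fock_kernel_fock.
have fs : kernel_span alpha f.
  exists 1%N, (fun=> z), (fun=> 1); apply/funext => w.
  by rewrite big_ord1 mulr1.
have [rT nT] := Tf _ ff.
have h1 := fock_pointwise alpha_gt0 z rT.
have h2 : fock_norm alpha (T f) ^+ 2 <= C ^+ 2 * fock_norm alpha f ^+ 2.
  by rewrite -exprMn lerXn2r ?nnegrE ?sqrtr_ge0 ?hC// (le_trans _ (hC _ ff))// sqrtr_ge0.
have h3 : fock_norm alpha f ^+ 2 <= 2 * expR (alpha * `|z| ^+ 2).
  by rewrite -lee_fin (fock_norm_sqr ff) kernel_sqnorm_le.
rewrite -(fock_norm_sqr (Tf _ ff)) -EFinM lee_fin in h1.
rewrite berezin_toeplitz -(Tg _ fs) lee_fin.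
have h4 := q0_le (T f z).
have h5 := pw_const_ge0 alpha_gt0.
rewrite mulNr expRN in h1; rewrite expRN.
move: h1 h2 h3 h4 h5 (expR_gt0 (alpha * `|z| ^+ 2)) (ler_norm (q0 (T f z))) (normr_ge0 (T f z)).
move: (fock_norm alpha (T f) ^+ 2) (fock_norm alpha f ^+ 2) (q0 (T f z)) `|q0 (T f z)|.
move: `|T f z| (expR _) (pw_const alpha) => X e A n1 n2 q q' h1 h2 h3 h4 h5 e0 h6 X0.
(* One e = e^(alpha |z|^2) comes from evaluation at z, the other from the norm of K_z. *)
have h7 : X ^+ 2 <= A * (C ^+ 2 * 2) * e ^+ 2.
  move: h1; rewrite ler_pdivrMr// => h1; apply: le_trans h1 _.
  have -> : A * (C ^+ 2 * 2) * e ^+ 2 = A * (C ^+ 2 * (2 * e)) * e by ring.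
  rewrite ler_wpM2r ?(ltW e0)// ler_wpM2l//; apply: le_trans h2 _.
  by rewrite ler_wpM2l ?sqr_ge0.
have h8 : e^-1 * q <= e^-1 * X by rewrite ler_wpM2l ?invr_ge0 ?(ltW e0)//; lra.
apply: le_trans h8 _; have h9 : (e^-1 * X) ^+ 2 <= A * (C ^+ 2 * 2).
  by rewrite exprMn exprVn mulrC ler_pdivrMr ?exprn_gt0.
move: h9; move: (e^-1 * X) (A * _) => x y; have := sqr_ge0 (x - 1); nra.
Qed.

Let mu_sf : sigma_finite setT mu := sigma_finite_mu alpha_gt0 kernel_sq_int.

Lemma average_of_berezin (r : R) : 0 < r -> bounded_above (berezin alpha mu) ->
  bounded_above (box_average mu r).
Proof.
by move=> r0 /(gauss_mu_of_berezin alpha_gt0)[C hC]; exact: gauss_mu_average alpha_gt0 hC.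
Qed.

Lemma berezin_of_average (r : R) : 0 < r -> bounded_above (box_average mu r) ->
  bounded_above (berezin alpha mu).
Proof.
move=> r0 /(box_bounded_of_average r0)[C hC].
have r2 : 0 < r / 2 by exact: divr_gt0.
eexists => z; apply: le_trans (berezin_le alpha_gt0 mu z) _.
exact: (gauss_mu_bounded mu_sf (hpi z) r2 alpha_gt0 hC).
Qed.

End BerezinToeplitz.

(** * Integrals of quaternion-valued functions *)

Section QuaternionicIntegral.
Variable R : realType.
Local Notation H := (quat R).
Variable mu : {measure set H -> \bar R}.

Definition qintegrable (G : H -> H) :=
  measurable_fun setT G /\ (\int[mu]_w (`|G w|)%:E < +oo)%E.

Lemma integrable_qnorm G : qintegrable G -> mu.-integrable setT (fun w => (`|G w|)%:E).
Proof.
move=> [mG fG]; apply/integrableP; split.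
  by apply/measurable_EFinP; exact: measurableT_comp (@measurable_qnorm R) mG.
apply: le_lt_trans fG; apply: integral_monoT => w //.
by rewrite /= normr_id.
Qed.

Lemma integrable_qcoord (k : H -> R) G : (forall p, `|k p| <= `|p|) ->
  measurable_fun setT (fun w => k (G w)) -> qintegrable G ->
  mu.-integrable setT (EFin \o (fun w => k (G w))).
Proof.
move=> kle mk /integrable_qnorm; apply: le_integrable => //.
  exact/measurable_EFinP.
by move=> w _ /=; rewrite lee_fin normr_id.
Qed.

Lemma qintegrableP G : qintegrable G ->
  [/\ mu.-integrable setT (EFin \o (fun w => q0 (G w))),
      mu.-integrable setT (EFin \o (fun w => q1 (G w))),
      mu.-integrable setT (EFin \o (fun w => q2 (G w))) &
      mu.-integrable setT (EFin \o (fun w => q3 (G w)))].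
Proof.
move=> iG; have [/measurable_qcoords[m0 m1 m2 m3] _] := iG.
split; apply: integrable_qcoord iG => //.
- exact: q0_le.
- exact: q1_le.
- exact: q2_le.
- exact: q3_le.
Qed.

Lemma qintegrable_le (G : H -> H) (B : H -> R) : measurable_fun setT G ->
  (forall w, `|G w| <= B w) -> (\int[mu]_w (B w)%:E < +oo)%E -> qintegrable G.
Proof.
by move=> mG GB fB; split => //; apply: le_lt_trans fB; apply: integral_monoT.
Qed.

(** The 4 comes from bounding the four coordinates separately. *)
Lemma qnorm_integral_le G (B : R) : qintegrable G ->
  (\int[mu]_w (`|G w|)%:E <= B%:E)%E -> `|qintegral mu G| <= 4 * B.
Proof.
move=> iG GB; have [i0 i1 i2 i3] := qintegrableP iG.
have iN := integrable_qnorm iG.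
have le (k : H -> R) : (forall p, `|k p| <= `|p|) ->
    mu.-integrable setT (EFin \o (fun w => k (G w))) ->
    `|(\int[mu]_w (k (G w)))%R| <= B.
  move=> kle ik; rewrite -lee_fin EFin_normr_Rintegral//.
  apply: le_trans (le_abse_integral _ _ _) _ => //.
    by have /integrableP[] := ik.
  by apply: le_trans GB; apply: integral_monoT => w /=; rewrite ?lee_fin.
apply: le_trans (qnorm_le_sum _) _ => /=.
have := le _ (@q0_le R) i0; have := le _ (@q1_le R) i1.
have := le _ (@q2_le R) i2; have := le _ (@q3_le R) i3; lra.
Qed.

Lemma qintegrableD G1 G2 : qintegrable G1 -> qintegrable G2 ->
  qintegrable (fun w => G1 w + G2 w).
Proof.
move=> i1 i2; have [m1 f1] := i1; have [m2 f2] := i2.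
apply: (@qintegrable_le _ (fun w => `|G1 w| + `|G2 w|)).
- exact: measurable_qadd.
- by move=> w; exact: ler_normD.
under eq_integral do rewrite EFinD.
rewrite ge0_integralD//; first by rewrite lte_add_pinfty.
- by have /integrableP[] := integrable_qnorm i1.
- by have /integrableP[] := integrable_qnorm i2.
Qed.

Let integral_normM_fin G (c : R) : 0 <= c -> qintegrable G ->
  (\int[mu]_w (c * `|G w|)%:E < +oo)%E.
Proof.
move=> c0 iG; under eq_integral do rewrite EFinM.
rewrite (ge0_integralZl _ measurableT); last 3 first.
- by have /integrableP[] := integrable_qnorm iG.
- by move=> w _; rewrite lee_fin.
- by rewrite lee_fin.
by apply: lte_mul_pinfty => //; have [] := iG.
Qed.

Lemma qintegrableMr G c : qintegrable G -> qintegrable (fun w => G w * c).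
Proof.
move=> iG; have [mG fG] := iG; apply: (@qintegrable_le _ (fun w => `|c| * `|G w|)).
- by apply: measurable_qmul.
- by move=> w; rewrite qnormM mulrC.
- exact: integral_normM_fin.
Qed.

Lemma qintegrableMl G c : qintegrable G -> qintegrable (fun w => c * G w).
Proof.
move=> iG; have [mG fG] := iG; apply: (@qintegrable_le _ (fun w => `|c| * `|G w|)).
- by apply: measurable_qmul.
- by move=> w; rewrite qnormM.
- exact: integral_normM_fin.
Qed.

Lemma qintegralD G1 G2 : qintegrable G1 -> qintegrable G2 ->
  qintegral mu (fun w => G1 w + G2 w) = qintegral mu G1 + qintegral mu G2.
Proof.
move=> /qintegrableP[a0 a1 a2 a3] /qintegrableP[b0 b1 b2 b3].
by apply: quat_eq; rewrite /= -RintegralD.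
Qed.

Let integrableZ (c : R) (f : H -> R) : mu.-integrable setT (EFin \o f) ->
  mu.-integrable setT (EFin \o (fun w => c * f w)).
Proof.
move=> hf; have := integrableZl measurableT c hf.
by apply: eq_integrable.
Qed.

(** Each coordinate of G(w) c is a real linear combination of the coordinates of G(w). *)
Let Rintegral4 (a b c d : R) G : qintegrable G ->
  (\int[mu]_w (a * q0 (G w) + b * q1 (G w) + c * q2 (G w) + d * q3 (G w)))%R =
  a * q0 (qintegral mu G) + b * q1 (qintegral mu G) + c * q2 (qintegral mu G)
  + d * q3 (qintegral mu G).
Proof.
move=> /qintegrableP[].
move=> /[dup] j0 /(integrableZ a) i0 /[dup] j1 /(integrableZ b) i1.
move=> /[dup] j2 /(integrableZ c) i2 /[dup] j3 /(integrableZ d) i3.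
have iD (u v : H -> R) : mu.-integrable setT (EFin \o u) ->
    mu.-integrable setT (EFin \o v) ->
    mu.-integrable setT (EFin \o (fun w => u w + v w)).
  by move=> hu hv; have := integrableD measurableT hu hv; apply: eq_integrable.
have i01 := iD _ _ i0 i1; have i012 := iD _ _ i01 i2.
rewrite (RintegralD measurableT i012 i3) (RintegralD measurableT i01 i2).
by rewrite RintegralD// !RintegralZl.
Qed.

Lemma qintegralMr G c : qintegrable G ->
  qintegral mu (fun w => G w * c) = qintegral mu G * c.
Proof.
move=> iG.
have E (k : H -> R) x y z t :
    (forall p, k (p * c) = x * q0 p + y * q1 p + z * q2 p + t * q3 p) ->
    (\int[mu]_w k (G w * c))%R = k (qintegral mu G * c).
  by move=> kE; rewrite kE -Rintegral4//; apply: eq_Rintegral => w _.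
apply: quat_eq.
- by apply: (E _ (q0 c) (- q1 c) (- q2 c) (- q3 c)) => p /=; ring.
- by apply: (E _ (q1 c) (q0 c) (q3 c) (- q2 c)) => p /=; ring.
- by apply: (E _ (q2 c) (- q3 c) (q0 c) (q1 c)) => p /=; ring.
- by apply: (E _ (q3 c) (q2 c) (- q1 c) (q0 c)) => p /=; ring.
Qed.

Lemma qintegral_conj G : qintegrable G ->
  qintegral mu (fun w => qconj (G w)) = qconj (qintegral mu G).
Proof.
have RN (g : H -> R) : mu.-integrable setT (EFin \o g) ->
    (\int[mu]_w (- g w))%R = - (\int[mu]_w (g w))%R.
  move=> ig; rewrite -mulN1r -RintegralZl//.
  by apply: eq_Rintegral => w _; rewrite mulN1r.
by move=> /qintegrableP[_ i1 i2 i3]; apply: quat_eq => //=; exact: RN.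
Qed.

(** Conjugation turns left multiplication into right multiplication. *)
Lemma qintegralMl G c : qintegrable G ->
  qintegral mu (fun w => c * G w) = c * qintegral mu G.
Proof.
move=> iG; have [mG fG] := iG.
have icG : qintegrable (fun w => qconj (G w)).
  apply: (@qintegrable_le _ (fun w => `|G w|)) => //.
    exact: measurableT_comp (@measurable_qconj R) mG.
  by move=> w; rewrite qnorm_conj.
have -> : (fun w => c * G w) = (fun w => qconj (qconj (G w) * qconj c)).
  by apply/funext => w; rewrite qconjM !qconjK.
rewrite qintegral_conj; last exact: qintegrableMr.
by rewrite qintegralMr// qintegral_conj// qconjM !qconjK.
Qed.

Lemma qintegral_series (G : nat -> H -> H) : (forall n, qintegrable (G n)) ->
  forall n, qintegrable (fun w => series (G ^~ w) n) /\
    qintegral mu (fun w => series (G ^~ w) n) = series (fun k => qintegral mu (G k)) n.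
Proof.
move=> iG; elim=> [|n [ih1 ih2]].
  have -> : (fun w => series (G ^~ w) 0) = (fun=> 0).
    by apply/funext => w; rewrite /series/= big_geq.
  rewrite /series/= big_geq//; split.
    apply: (@qintegrable_le _ (fun=> 0)) => //.
    - by move=> w; rewrite normr0.
    - by rewrite integral0.
  by apply: quat_eq; rewrite /= /Rintegral integral0.
have E (u : nat -> H) : series u n.+1 = series u n + u n.
  by rewrite /series/= big_nat_recr.
have -> : (fun w => series (G ^~ w) n.+1) = (fun w => series (G ^~ w) n + G n w).
  by apply/funext => w; rewrite E.
split; first exact: qintegrableD.
by rewrite qintegralD// ih2 E.
Qed.

Lemma qintegral_cvg (G_ : nat -> H -> H) (G : H -> H) (B : H -> R) :
  (forall n, measurable_fun setT (G_ n)) -> (forall w, G_ ^~ w @ \oo --> G w) ->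
  (forall n w, `|G_ n w| <= B w) -> measurable_fun setT B ->
  (\int[mu]_w (B w)%:E < +oo)%E -> measurable_fun setT G ->
  qintegrable G /\ (fun n => qintegral mu (G_ n)) @ \oo --> qintegral mu G.
Proof.
move=> mG_ cG GB mB fB mG.
have B0 w : 0 <= B w by exact: le_trans (normr_ge0 _) (GB 0%N w).
have GB' w : `|G w| <= B w.
  apply: (closed_cvg (fun x => x <= B w) (@closed_le _ (B w)) _ _ (cvg_norm (cG w))).
  by near=> n; exact: GB.
have iG : qintegrable G by exact: qintegrable_le fB.
split => //.
have iB : mu.-integrable setT (EFin \o B).
  apply/integrableP; split; first exact/measurable_EFinP.
  by apply: le_lt_trans fB; apply: integral_monoT => w //=; rewrite lee_fin ger0_norm.
have key (k : H -> R) : (forall p, `|k p| <= `|p|) ->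
    (forall n, measurable_fun setT (fun w => k (G_ n w))) ->
    (forall w, k (G_ n w) @[n --> \oo] --> k (G w)) ->
    mu.-integrable setT (EFin \o (fun w => k (G w))) ->
    (\int[mu]_w k (G_ n w))%R @[n --> \oo] --> (\int[mu]_w k (G w))%R.
  move=> kle mk ck ik.
  have := @dominated_cvg _ _ _ mu setT measurableT
    (fun n w => (k (G_ n w))%:E) (fun w => (k (G w))%:E) (EFin \o B).
  have fk : (\int[mu]_w (k (G w))%:E)%E \is a fin_num by exact: integrable_fin_num.
  rewrite -(fineK fk) => h; apply: fine_cvg; apply: h => //.
  - by move=> n; exact/measurable_EFinP.
  - by move=> w _; apply: cvg_EFin; [near=> n|exact: ck].
  - by move=> n w _; rewrite lee_fin (le_trans (kle _)).
have mq n := proj1 (measurable_qcoords (G_ n)) (mG_ n).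
have cq w := proj1 (cvg_quatP (FF := eventually_filter) (G_ ^~ w) (G w)) (cG w).
have [i0 i1 i2 i3] := qintegrableP iG.
apply/cvg_quatP; split => /=; apply: key => //.
- exact: q0_le.
- by move=> n; have [] := mq n.
- by move=> w; have [] := cq w.
- exact: q1_le.
- by move=> n; have [] := mq n.
- by move=> w; have [] := cq w.
- exact: q2_le.
- by move=> n; have [] := mq n.
- by move=> w; have [] := cq w.
- exact: q3_le.
- by move=> n; have [] := mq n.
- by move=> w; have [] := cq w.
Unshelve. all: end_near. Qed.

End QuaternionicIntegral.

(** * The Toeplitz transform as a power series *)

Section ToeplitzPowerSeries.
Variable R : realType.
Local Notation H := (quat R).

Lemma series_exp_le (x : R) n : 0 <= x ->
  series (fun k => k`!%:R^-1 * x ^+ k) n <= expR x.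
Proof.
move=> x0; rewrite [leRHS](_ : _ = limn (series (fun k => k`!%:R^-1 * x ^+ k))); last first.
  by rewrite -exp_coeffE.
apply: nondecreasing_cvgn_le; last exact: is_cvg_series_exp.
by apply: nondecreasing_series => k _; rewrite mulr_ge0 ?exprn_ge0 ?invr_ge0.
Qed.

Lemma exp_term_le (x : R) n : 0 <= x -> n`!%:R^-1 * x ^+ n <= expR x.
Proof.
move=> x0; apply: le_trans (series_exp_le n.+1 x0).
rewrite /series/= big_nat_recr//= lerDr; apply: sumr_ge0 => k _.
by rewrite mulr_ge0 ?exprn_ge0 ?invr_ge0.
Qed.

Lemma measurable_qpow d (T : measurableType d) (g : T -> H) n :
  measurable_fun setT g -> measurable_fun setT (fun t => g t ^+ n).
Proof.
move=> mg; elim: n => [|n ih]; first exact: measurable_cst.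
by under eq_fun do rewrite exprS; exact: measurable_qmul.
Qed.

Variable alpha : R.
Hypothesis alpha_gt0 : 0 < alpha.
Let alpha_ge0 : 0 <= alpha := ltW alpha_gt0.
Local Notation K := (fock_kernel alpha).
Local Opaque fock_kernel.

Variable mu : {measure set H -> \bar R}.
Hypothesis mu_sf : sigma_finite setT mu.
Variable C : R.
Hypothesis mu_box : box_bounded mu 1 C.

(** Half of the Gaussian absorbs the exponential: b |w| <= alpha |w|^2 / 2 + b^2 / (2 alpha). *)
Lemma exp_gauss_fin (b : R) : 0 <= b ->
  (\int[mu]_w (expR (b * `|w|) * expR (- alpha * `|w| ^+ 2))%:E < +oo)%E.
Proof.
move=> b0; pose k := expR (b ^+ 2 / (2 * alpha)).
have a2 : 0 < alpha / 2 by exact: divr_gt0.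
apply: (@le_lt_trans _ _ (k%:E * gauss_mu mu (alpha / 2) (0%R, 0%R))%E); last first.
  apply: lte_mul_pinfty; rewrite ?lee_fin ?expR_ge0//.
  exact: le_lt_trans (gauss_mu_bounded mu_sf _ ltr01 a2 mu_box) (ltry _).
rewrite /gauss_mu -(ge0_integralZl _ measurableT); last 3 first.
- apply/measurable_EFinP.
  exact: measurableT_comp (measurable_gauss_dist2 _ _) (@measurable_hpi R).
- by move=> w _; rewrite lee_fin expR_ge0.
- by rewrite lee_fin expR_ge0.
apply: integral_monoT => w; first by rewrite lee_fin mulr_ge0 ?expR_ge0.
rewrite -EFinM lee_fin -!expRD ler_expR /dist2 /hpi/= !sub0r !sqrrN -(qnorm_im w).
have -> : b ^+ 2 / (2 * alpha) + - (alpha / 2 * `|w| ^+ 2) =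
    b * `|w| + - alpha * `|w| ^+ 2 + (b - alpha * `|w|) ^+ 2 / (2 * alpha).
  by move: `|w| => x; field; rewrite gt_eqF.
by rewrite lerDl divr_ge0 ?sqr_ge0// mulr_ge0.
Qed.

Variable f : H -> H.
Hypothesis f_reg : slice_regular f.
Hypothesis f_fin : (fock_sqnorm alpha f < +oo)%E.

Let E (w : H) : R := expR (- alpha * `|w| ^+ 2).
Let mE : measurable_fun [set: H] E. Proof. exact: measurable_fock_weight. Qed.
Let mf : measurable_fun setT f := slice_of_regular f_reg.

Let mfE : measurable_fun setT (fun w => `|f w| ^+ 2 * E w).
Proof. by apply: measurable_funM => //; exact: measurable_qnorm_sqr. Qed.

Let f_mu_fin : (\int[mu]_w (`|f w| ^+ 2 * E w)%:E < +oo)%E.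
Proof. exact: (carleson_fin alpha_gt0 mu_sf mu_box). Qed.

(** Dominates the partial sums of the kernel series at z, with b = alpha |z|, and the coefficient
    integrands at any radius. *)
Let expf (b : R) (w : H) : R := expR (b * `|w|) * (E w * `|f w|).

Let mexpf b : measurable_fun setT (expf b).
Proof.
apply: measurable_funM.
  apply: (measurableT_comp (@measurable_expR R)); apply: measurable_funM => //.
  exact: measurable_qnorm.
by apply: measurable_funM => //; exact: measurableT_comp (@measurable_qnorm R) mf.
Qed.

Let expf_ge0 b w : 0 <= expf b w.
Proof. by rewrite !mulr_ge0 ?expR_ge0. Qed.

(** AM-GM separates the exponential, left to [exp_gauss_fin], from |f|^2, left to the Carleson
    embedding. *)
Let expf_fin (b : R) : 0 <= b -> (\int[mu]_w (expf b w)%:E < +oo)%E.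
Proof.
move=> b0; have b20 : 0 <= 2 * b by rewrite mulr_ge0.
apply: (@le_lt_trans _ _ (\int[mu]_w ((expR (2 * b * `|w|) * E w)%:E
    + (`|f w| ^+ 2 * E w)%:E))%E).
  apply: integral_monoT => w; first by rewrite lee_fin expf_ge0.
  rewrite -EFinD lee_fin /expf (_ : 2 * b * `|w| = b * `|w| + b * `|w|); last by ring.
  rewrite expRD; have := expR_ge0 (- alpha * `|w| ^+ 2); rewrite -/(E w).
  move: (expR (b * _)) `|f w| (E w) => x y e e0.
  rewrite -mulrDl mulrCA [leLHS]mulrC ler_wpM2r//.
  have := sqr_ge0 (x - y); have := sqr_ge0 (x + y); nra.
rewrite ge0_integralD//; last 4 first.
- by move=> w _; rewrite lee_fin mulr_ge0 ?expR_ge0.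
- apply/measurable_EFinP; apply: measurable_funM => //.
  apply: (measurableT_comp (@measurable_expR R)); apply: measurable_funM => //.
  exact: measurable_qnorm.
- by move=> w _; rewrite lee_fin mulr_ge0 ?expR_ge0.
- exact/measurable_EFinP.
by rewrite lte_add_pinfty//; exact: exp_gauss_fin.
Qed.

Let h k w : H := E w *: (kcoef alpha w k * f w).

Let mh k : measurable_fun setT (h k).
Proof.
apply: measurable_qscale => //; apply: measurable_qmul => //.
apply: measurable_qscale => //; apply: measurable_qpow; exact: measurable_qconj.
Qed.

Let normE0 (w : H) : `|E w| = E w.
Proof. by rewrite ger0_norm// expR_ge0. Qed.

Let norm_kcoef (w : H) k : `|kcoef alpha w k| = k`!%:R^-1 * (alpha * `|w|) ^+ k.
Proof.
rewrite /kcoef normrZ qnormX qnorm_conj exprMn ger0_norm.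
  by rewrite mulrAC mulrC.
by rewrite mulr_ge0 ?exprn_ge0 ?invr_ge0.
Qed.

Let h_le (rho : R) k w : 0 <= rho -> `|h k w| * rho ^+ k <= expf (alpha * rho) w.
Proof.
move=> r0; rewrite /h normrZ normE0 qnormM norm_kcoef /expf.
have w0 : 0 <= alpha * rho * `|w| by rewrite !mulr_ge0.
apply: le_trans (ler_wpM2r _ (exp_term_le k w0)); last by rewrite mulr_ge0 ?expR_ge0.
rewrite le_eqVlt; apply/orP; left; apply/eqP; rewrite !exprMn.
by move: (E w) `|f w| (_^-1) (_ ^+ _) (rho ^+ _) (_ ^+ _) => *; ring.
Qed.

Let ih k : qintegrable mu (h k).
Proof.
apply: (@qintegrable_le _ _ _ (expf (alpha * 1))) => //; last first.
  by apply: expf_fin; rewrite mulr1.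
by move=> w; apply: le_trans (h_le k w ler01); rewrite expr1n mulr1.
Qed.

Let a k := qintegral mu (h k).

Let entire_a : entire a.
Proof.
move=> rho r0; have r20 : 0 <= 2 * rho by rewrite mulr_ge0.
have ar0 : 0 <= alpha * (2 * rho) by rewrite mulr_ge0.
pose M := fine (\int[mu]_w (expf (alpha * (2 * rho)) w)%:E).
(* A uniform bound at twice the radius leaves a geometric series of ratio 1/2 at rho. *)
have aM k : `|a k| * (2 * rho) ^+ k <= 4 * M.
  have n1 (c : R) : `|c%:A : H| = `|c| by rewrite normrZ qnorm1 mulr1.
  rewrite -[X in _ * X]ger0_norm ?exprn_ge0// -n1 -qnormM -qintegralMr//.
  apply: qnorm_integral_le; first exact: qintegrableMr.
  rewrite fineK; last first.
    rewrite ge0_fin_numE ?expf_fin//; apply: integral_ge0 => w _.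
    by rewrite lee_fin expf_ge0.
  apply: integral_monoT => w; rewrite lee_fin// qnormM n1 ger0_norm ?exprn_ge0//.
  exact: h_le.
have cg : cvgn (series (geometric (4 * M) 2^-1)).
  by apply: is_cvg_geometric_series; rewrite ger0_norm// invf_lt1// ltr1n.
apply: series_le_cvg cg => k.
- by rewrite mulr_ge0 ?exprn_ge0.
- rewrite /geometric/= mulr_ge0 ?exprn_ge0//.
  by apply: le_trans (aM 0%N); rewrite mulr_ge0.
rewrite /geometric/= exprVn ler_pdivlMr ?exprn_gt0//.
by apply: le_trans (aM k); rewrite exprMn -mulrA [X in _ * X]mulrC.
Qed.

Let partial z n w := series (fun k => z ^+ k * h k w) n.

Let partialE z n w : partial z n w =
  E w *: (series (fun k => z ^+ k * kcoef alpha w k) n * f w).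
Proof.
rewrite /partial /series /= mulr_suml scaler_sumr; apply: eq_bigr => k _.
by rewrite /h -scalerAr mulrA.
Qed.

Let partial_le z n w : `|partial z n w| <= expf (alpha * `|z|) w.
Proof.
rewrite partialE normrZ normE0 qnormM /expf mulrCA ler_wpM2r ?mulr_ge0 ?expR_ge0//.
have w0 : 0 <= alpha * `|z| * `|w| by rewrite !mulr_ge0.
apply: le_trans (series_exp_le n w0); rewrite /series/=.
apply: le_trans (ler_norm_sum _ _ _) _; apply: ler_sum => k _.
rewrite qnormM qnormX norm_kcoef !exprMn.
move: (_^-1) (_ ^+ _) (`|w| ^+ _) (_ ^+ _) => *.
by rewrite le_eqVlt; apply/orP; left; apply/eqP; ring.
Qed.

(** Dominated convergence for the partial sums of the kernel exchanges the series with the integral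
    against mu. *)
Let toeplitz_facts z :
  qintegrable mu (fun w => E w *: (K z w * f w)) /\
  series (fun k => z ^+ k * a k) @ \oo --> toeplitz alpha mu f z.
Proof.
have iz k : qintegrable mu (fun w => z ^+ k * h k w) by exact: qintegrableMl.
have hp n := qintegral_series iz n.
have az0 : 0 <= alpha * `|z| by rewrite mulr_ge0.
have mK : measurable_fun setT (fun w => K z w).
  rewrite (_ : (fun w => K z w) = (fun w => qconj (K w z))).
    apply: measurableT_comp; first exact: measurable_qconj.
    by apply: slice_of_regular; exact: kernel_slice_regular.
  by apply/funext => w; rewrite (kernel_conj alpha_ge0 w z).
have := @qintegral_cvg _ mu (fun n w => partial z n w) (fun w => E w *: (K z w * f w))
  (expf (alpha * `|z|)).
case.
- by move=> n; have [[]] := hp n.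
- move=> w; rewrite (_ : partial z ^~ w = fun n => E w *:
    (series (fun k => z ^+ k * kcoef alpha w k) n * f w)); last first.
    by apply/funext => n; rewrite partialE.
  apply: cvgZl_tmp; apply: cvg_qmulr; exact: cvg_kernel.
- by move=> n w; exact: partial_le.
- exact: mexpf.
- exact: expf_fin.
- by apply: measurable_qscale => //; exact: measurable_qmul.
move=> i1 c1; split => //.
rewrite (_ : series (fun k => z ^+ k * a k) = fun n => qintegral mu (fun w => partial z n w))//.
apply/funext => n; have [_ ->] := hp n.
by rewrite /series/=; apply: eq_bigr => k _; rewrite qintegralMl.
Qed.

Lemma toeplitz_integrable z :
  qintegrable mu (fun w => expR (- alpha * `|w| ^+ 2) *: (K z w * f w)).
Proof. by have [] := toeplitz_facts z. Qed.

Lemma toeplitz_slice_regular : slice_regular (toeplitz alpha mu f).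
Proof. by apply: (power_series_slice_regular entire_a) => z; have [] := toeplitz_facts z. Qed.

End ToeplitzPowerSeries.

(** * Schur's test and the boundedness of the Toeplitz operator *)

Section ToeplitzBounded.
Variable R : realType.
Local Notation H := (quat R).
Local Notation mR := (measurableTypeR R).
Local Notation plane := (@plane_measure R).

(** Recovers the Cauchy-Schwarz form from AM-GM with a free parameter, by the choice t = X / A. *)
Lemma sqr_le_of_amgm (X A B : R) : 0 <= X -> 0 < A ->
  (forall t, 0 < t -> 2 * X <= t * A + B / t) -> X ^+ 2 <= A * B.
Proof.
move=> X0 A0 hX.
have [X1|X1] := eqVneq X 0.
  (* If B < 0, then t^2 = - B / (2 A) makes the right-hand side equal to B / (2 t) < 0. *)
  have B0 : 0 <= B.
    rewrite leNgt; apply/negP => B0.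
    have t0 : 0 < Num.sqrt (- B / (2 * A)).
      by rewrite sqrtr_gt0 divr_gt0// ?oppr_gt0// mulr_gt0.
    have := hX _ t0; rewrite X1 mulr0; apply/negP; rewrite -ltNge.
    rewrite -(pmulr_llt0 _ t0) mulrDl divfK ?gt_eqF// mulrAC -expr2 sqr_sqrtr.
      rewrite (_ : _ + B = B / 2) ?pmulr_llt0 ?invr_gt0//.
      by field; rewrite gt_eqF.
    by rewrite divr_ge0 ?oppr_ge0 ?mulr_ge0// ltW.
  by rewrite X1 expr0n/= mulr_ge0// ltW.
have {}X0 : 0 < X by rewrite lt_neqAle eq_sym X1.
have := hX _ (divr_gt0 X0 A0); rewrite divfK ?gt_eqF//.
rewrite -(ler_pM2r X0) (_ : (X + _) * X = X ^+ 2 + A * B).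
  by rewrite -mulrA -expr2; move: (X ^+ 2) (A * B) => x y; lra.
by field; rewrite !gt_eqF.
Qed.

Variable alpha : R.
Hypothesis alpha_gt0 : 0 < alpha.
Let alpha_ge0 : 0 <= alpha := ltW alpha_gt0.
Local Notation K := (fock_kernel alpha).
Local Opaque fock_kernel.

Variable mu : {measure set H -> \bar R}.
Hypothesis mu_sf : sigma_finite setT mu.
Variable C : R.
Hypothesis mu_box : box_bounded mu 1 C.

Let E (w : H) : R := expR (- alpha * `|w| ^+ 2).
Let mE : measurable_fun [set: H] E. Proof. exact: measurable_fock_weight. Qed.

Let a2 : 0 < alpha / 2. Proof. exact: divr_gt0. Qed.

Let C_ge0 : 0 <= C := box_bounded_ge0 mu_box.

Let expR_half (x : R) : expR (- (alpha * x)) = expR (- (alpha / 2 * x)) ^+ 2.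
Proof. by rewrite expr2 -expRD; congr expR; field. Qed.

(** The bound of [gauss_mu_bounded] for s = 1 and b = alpha / 2; the added 1 makes it positive, as
    [sqr_le_of_amgm] demands. *)
Definition schur_const : R :=
  (4 * 1 ^+ 2)^-1 * expR (2 * (alpha / 2) * 1 ^+ 2) * C * (2 * pi / (alpha / 2)) + 1.

Lemma schur_const_gt0 : 0 < schur_const.
Proof.
by rewrite ltr_wpDl// !mulr_ge0 ?expR_ge0 ?pi_ge0 ?invr_ge0// mulr_ge0// ?ltW.
Qed.

Lemma gauss_mu_schur m : (gauss_mu mu (alpha / 2) m <= schur_const%:E)%E.
Proof.
apply: le_trans (gauss_mu_bounded mu_sf m ltr01 a2 mu_box) _.
by rewrite lee_fin lerDl.
Qed.

Section Norm.
Variable f : H -> H.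
Hypothesis f_reg : slice_regular f.
Hypothesis f_fin : (fock_sqnorm alpha f < +oo)%E.

Let mf : measurable_fun setT f := slice_of_regular f_reg.
Let mfE : measurable_fun setT (fun w => `|f w| ^+ 2 * E w).
Proof. by apply: measurable_funM => //; exact: measurable_qnorm_sqr. Qed.

Let F (u : H * (mR * mR)) : R :=
  expR (- (alpha / 2 * dist2 u.2 (hpi u.1))) * (`|f u.1| ^+ 2 * E u.1).

Let F_ge0 u : 0 <= F u. Proof. by rewrite !mulr_ge0 ?expR_ge0. Qed.

Let mF : measurable_fun setT F.
Proof.
apply: measurable_funM; last exact: (measurableT_comp mfE measurable_fst).
apply: (measurableT_comp (@measurable_expR R)); apply: measurableT_comp => //.
apply: measurable_funM => //; rewrite /dist2.
have m1 := measurableT_comp (@measurable_hpi R) (@measurable_fst _ _ H (mR * mR)%type).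
have m2 := @measurable_snd _ _ H (mR * mR)%type.
apply: measurable_funD; apply: measurable_funX; apply: measurable_funB.
- exact: measurableT_comp measurable_fst m2.
- exact: measurableT_comp measurable_fst m1.
- exact: measurableT_comp measurable_snd m2.
- exact: measurableT_comp measurable_snd m1.
Qed.

(** The Gaussian smoothing at m of the measure |f|^2 e^(- alpha |w|^2) dmu. *)
Let smooth (m : R * R) : \bar R := (\int[mu]_w (F (w, m))%:E)%E.

Let f_mu_fin : (\int[mu]_w (`|f w| ^+ 2 * E w)%:E < +oo)%E.
Proof. exact: (carleson_fin alpha_gt0 mu_sf mu_box). Qed.

Let smooth_fin m : smooth m \is a fin_num.
Proof.
rewrite ge0_fin_numE; last by apply: integral_ge0 => w _; rewrite lee_fin.
apply: le_lt_trans f_mu_fin; apply: integral_monoT => w; first by rewrite lee_fin.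
rewrite lee_fin /F/= ler_piMl ?mulr_ge0 ?expR_ge0// expR_le1 oppr_le0.
by rewrite mulr_ge0 ?(ltW a2)// addr_ge0 ?sqr_ge0.
Qed.

(** The square root of [ker_dens_le] leaves a Gaussian g with exponent alpha / 2. AM-GM is applied
    to the other factor only, so that g weights both terms. *)
Let schur_term z w (t : R) : 0 < t ->
  expR (- (alpha / 2 * `|z| ^+ 2)) * `|E w *: (K z w * f w)| <=
  t / 2 * expR (- (alpha / 2 * dist2 (hpi z) (hpi w))) + (2 * t)^-1 * F (w, hpi z).
Proof.
move=> t0; set s := expR (- (alpha / 2 * `|z| ^+ 2)).
set g := expR (- (alpha / 2 * dist2 (hpi z) (hpi w))).
pose e := expR (- (alpha / 2 * `|w| ^+ 2)).
have Ee : E w = e ^+ 2 by rewrite /E mulNr expR_half.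
have s0 : 0 <= s by exact: expR_ge0.
have g0 : 0 <= g by exact: expR_ge0.
have e0 : 0 <= e by exact: expR_ge0.
have : e * s * `|K w z| <= g.
  rewrite -(@ler_pXn2r _ 2) ?nnegrE ?mulr_ge0// !exprMn.
  have := ker_dens_le alpha_gt0 z w; rewrite /ker_dens.
  move: (`|K w z| ^+ 2) => k.
  have -> : expR (- (alpha * `|w| ^+ 2)) = e ^+ 2 by rewrite -mulNr -Ee.
  have -> : expR (- (alpha * `|z| ^+ 2)) = s ^+ 2.
    exact: expR_half.
  have -> // : expR (- (alpha * dist2 (hpi z) (hpi w))) = g ^+ 2.
  exact: expR_half.
rewrite -(kernel_normC alpha_gt0 z w) normrZ qnormM {1}Ee ger0_norm ?sqr_ge0//.
rewrite /F/= -/g Ee; move: `|K z w| `|f w| (normr_ge0 (f w)) => k y y0 h1.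
apply: (@le_trans _ _ (g * (e * y))).
  have -> : s * (e ^+ 2 * (k * y)) = e * s * k * (e * y) by ring.
  by rewrite ler_wpM2r// mulr_ge0.
rewrite -subr_ge0 (_ : _ - _ = g * ((t - e * y) ^+ 2 / (2 * t))).
  by rewrite mulr_ge0// divr_ge0 ?sqr_ge0// mulr_ge0// ltW.
by field; rewrite gt_eqF.
Qed.

Let schur_pointwise z :
  expR (- (alpha * `|z| ^+ 2)) * `|toeplitz alpha mu f z| ^+ 2 <=
  16 * schur_const * fine (smooth (hpi z)).
Proof.
(* Each factor takes one 4 of [qnorm_integral_le], to fit the product A B of [sqr_le_of_amgm]. *)
have -> : 16 * schur_const * fine (smooth (hpi z)) =
  (4 * schur_const) * (4 * fine (smooth (hpi z))) by ring.
pose s := expR (- (alpha / 2 * `|z| ^+ 2)).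
have s0 : 0 < s by exact: expR_gt0.
have -> : expR (- (alpha * `|z| ^+ 2)) = s ^+ 2.
  exact: expR_half.
rewrite -exprMn; apply: sqr_le_of_amgm.
- by rewrite mulr_ge0// ltW.
- by rewrite mulr_gt0// schur_const_gt0.
move=> t t0.
have iG := toeplitz_integrable alpha_gt0 mu_sf mu_box f_reg f_fin z.
suff : `|toeplitz alpha mu f z| <=
    4 * (s^-1 * (t / 2 * schur_const + (2 * t)^-1 * fine (smooth (hpi z)))).
  move/(ler_wpM2l (ltW s0)) => h; apply: le_trans (ler_wpM2l (ler0n _ 2) h) _.
  rewrite le_eqVlt; apply/orP; left; apply/eqP.
  by move: (fine _) schur_const => x y; field; rewrite !gt_eqF.
apply: qnorm_integral_le => //.
rewrite EFinM EFinD !EFinM fineK//.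
have t20 : (0 <= (t / 2)%:E)%E by rewrite lee_fin divr_ge0// ltW.
have ti0 : (0 <= ((2 * t)^-1)%:E)%E by rewrite lee_fin invr_ge0 mulr_ge0// ltW.
apply: (@le_trans _ _ ((s^-1)%:E * ((t / 2)%:E * gauss_mu mu (alpha / 2) (hpi z)
  + ((2 * t)^-1)%:E * smooth (hpi z)))%E); last first.
  apply: lee_wpmul2l; first by rewrite lee_fin invr_ge0 ltW.
  by apply: leeD => //; apply: lee_wpmul2l => //; exact: gauss_mu_schur.
have mg : measurable_fun setT (fun w => expR (- (alpha / 2 * dist2 (hpi z) (hpi w)))).
  exact: measurableT_comp (measurable_gauss_dist2 _ _) (@measurable_hpi R).
have mFz : measurable_fun setT (fun w => F (w, hpi z)).
  exact: measurableT_comp mF (measurable_pair2 _).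
rewrite /gauss_mu /smooth -(ge0_integralZl _ measurableT _ _ t20); last 2 first.
- exact/measurable_EFinP.
- by move=> w _; rewrite lee_fin expR_ge0.
rewrite -(ge0_integralZl _ measurableT _ _ ti0); last 2 first.
- exact/measurable_EFinP.
- by move=> w _; rewrite lee_fin.
rewrite -ge0_integralD//; last 4 first.
- by move=> w _; rewrite mule_ge0// lee_fin expR_ge0.
- by apply: measurable_funeM; exact/measurable_EFinP.
- by move=> w _; rewrite mule_ge0// lee_fin.
- by apply: measurable_funeM; exact/measurable_EFinP.
rewrite -(ge0_integralZl _ measurableT); last 3 first.
- by apply: emeasurable_funD; apply: measurable_funeM; exact/measurable_EFinP.
- by move=> w _; rewrite adde_ge0// mule_ge0// lee_fin ?expR_ge0.
- by rewrite lee_fin invr_ge0 ltW.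
apply: integral_monoT => w; first by rewrite lee_fin.
rewrite -!EFinM lee_fin ler_pdivlMl//.
exact: schur_term.
Qed.

(** In order: the density of the Fock norm, [schur_pointwise], the plane integral of the Gaussian
    with exponent alpha / 2, and the Carleson embedding. *)
Definition toeplitz_const : R :=
  2 * alpha / pi * (16 * schur_const) * (pi / (alpha / 2)) * carleson_const alpha C.

(** Second half of Schur's test: after exchanging the integrals, the Gaussian integrates to a
    constant in z and [carleson] bounds what remains. *)
Lemma toeplitz_sqnorm_le :
  (fock_sqnorm alpha (toeplitz alpha mu f) <= toeplitz_const%:E * fock_sqnorm alpha f)%E.
Proof.
pose k := 2 * alpha / pi * (16 * schur_const).
have k1 : 0 <= 2 * alpha / pi by rewrite divr_ge0 ?mulr_ge0// pi_ge0.
have k0 : 0 <= k by rewrite mulr_ge0// mulr_ge0// ltW// schur_const_gt0.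
have msm : measurable_fun setT (smooth : mR * mR -> \bar R).
  apply: (@measurable_mu_integral _ _ mu_sf (fun u => (F u)%:E)).
  - exact/measurable_EFinP.
  - by move=> u; rewrite lee_fin.
have sm0 m : (0 <= smooth m)%E by apply: integral_ge0 => w _; rewrite lee_fin.
have mpsi : measurable_fun setT (fun m : mR * mR => k * fine (smooth m)).
  apply: measurable_funM => //; exact: measurableT_comp (fine_measurable measurableT) msm.
have psi0 m : 0 <= k * fine (smooth m) by rewrite mulr_ge0// fine_ge0.
apply: (@le_trans _ _ (\int[@dV R]_z (k * fine (smooth (hpi z)))%:E)%E).
  apply: integral_monoT => z; rewrite lee_fin.
    by rewrite mulr_ge0 ?sqr_ge0// mulr_ge0// expR_ge0.
  have := ler_wpM2l k1 (schur_pointwise z); rewrite mulNr !mulrA.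
  by rewrite /k !mulrA.
apply: le_trans (integral_dV_hpi_le mpsi psi0) _.
have -> : (\int[plane]_m (k * fine (smooth m))%:E = k%:E * \int[plane]_m smooth m)%E.
  rewrite -(ge0_integralZl _ measurableT)//.
  by apply: eq_integral => m _; rewrite EFinM fineK.
rewrite -(@tonelli_mu _ _ mu_sf (fun u => (F u)%:E)); last 2 first.
- exact/measurable_EFinP.
- by move=> u; rewrite lee_fin.
have -> : (\int[mu]_w \int[plane]_n (F (w, n))%:E =
    (pi / (alpha / 2))%:E * \int[mu]_w (`|f w| ^+ 2 * E w)%:E)%E.
  rewrite -(ge0_integralZl _ measurableT); last 3 first.
  - exact/measurable_EFinP.
  - by move=> w _; rewrite lee_fin mulr_ge0 ?expR_ge0.
  - by rewrite lee_fin divr_ge0 ?pi_ge0// ltW.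
  apply: eq_integral => w _; rewrite -(gauss_plane (hpi w) a2) muleC.
  rewrite -(ge0_integralZl _ measurableT); last 3 first.
  - by apply/measurable_EFinP; exact: measurable_gauss_dist2.
  - by move=> n _; rewrite lee_fin expR_ge0.
  - by rewrite lee_fin mulr_ge0 ?expR_ge0.
  apply: eq_integral => n _; rewrite -EFinM /F/= mulrC; congr (_ * expR (- (_ * _)))%:E.
  by rewrite /dist2; ring.
rewrite muleA -EFinM.
have kp : (0 <= (k * (pi / (alpha / 2)))%:E)%E.
  by rewrite lee_fin mulr_ge0// divr_ge0 ?pi_ge0// ltW.
apply: le_trans (lee_wpmul2l kp (carleson alpha_gt0 mu_sf mu_box f_reg)) _.
by rewrite muleA -EFinM.
Qed.

End Norm.

Lemma toeplitz_const_ge0 : 0 <= toeplitz_const.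
Proof.
rewrite !mulr_ge0 ?expR_ge0 ?invr_ge0 ?pi_ge0 ?(ltW a2)//.
exact: ltW schur_const_gt0.
Qed.

Lemma toeplitz_bounded_of_box : toeplitz_bounded alpha mu.
Proof.
have ff f : fock alpha f -> fock alpha (toeplitz alpha mu f).
  move=> [f_reg f_fin]; split; first exact: (toeplitz_slice_regular alpha_gt0 mu_sf mu_box).
  apply: le_lt_trans (toeplitz_sqnorm_le f_reg f_fin) _.
  by apply: lte_mul_pinfty => //; rewrite lee_fin toeplitz_const_ge0.
exists (toeplitz alpha mu); split => //.
- move=> f g c [fr ff0] [gr gf0]; apply/funext => z.
  have iF := toeplitz_integrable alpha_gt0 mu_sf mu_box fr ff0 z.
  have iG := toeplitz_integrable alpha_gt0 mu_sf mu_box gr gf0 z.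
  rewrite /toeplitz -(qintegralMr _ iF) -qintegralD//; last exact: qintegrableMr.
  congr qintegral; apply/funext => w.
  by rewrite mulrDr scalerDr mulrA -scalerAl.
- exists (Num.sqrt toeplitz_const) => f fF; have [fr f0] := fF.
  rewrite /fock_norm -sqrtrM ?toeplitz_const_ge0//; apply: ler_wsqrtr.
  have := toeplitz_sqnorm_le fr f0.
  rewrite -(fock_norm_sqr alpha_gt0 fF) -(fock_norm_sqr alpha_gt0 (ff _ fF)).
  by rewrite -EFinM lee_fin.
Qed.

End ToeplitzBounded.

(** * Assembly of the equivalences *)

Unset Implicit Arguments.

Theorem theorem1p1 (R : realType) (alpha : R) (alpha_gt0 : 0 < alpha)
  (mu : {measure set (quat R) -> \bar R})
  (kernel_sq_int : forall z : quat R,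
    (\int[mu]_w (`|fock_kernel alpha z w| ^+ 2
                 * expR (- alpha * `|w| ^+ 2))%:E < +oo)%E)
  (radon_mu1 : radon_on (~` @real_axis R) mu) :
  [/\ toeplitz_bounded alpha mu <-> bounded_above (berezin alpha mu),
      bounded_above (berezin alpha mu) <->
        (exists2 r : R, 0 < r & bounded_above (box_average mu r)) &
      (exists2 r : R, 0 < r & bounded_above (box_average mu r)) <->
        (forall r : R, 0 < r -> bounded_above (box_average mu r))].
Proof.
have mu_sf := sigma_finite_mu alpha_gt0 kernel_sq_int.
have average_all : bounded_above (berezin alpha mu) ->
    forall r : R, 0 < r -> bounded_above (box_average mu r).
  by move=> hb r r0; exact (average_of_berezin alpha_gt0 r0 hb).
have berezin_ex : (exists2 r : R, 0 < r & bounded_above (box_average mu r)) ->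
    bounded_above (berezin alpha mu).
  by move=> [r r0 hr]; exact (berezin_of_average alpha_gt0 kernel_sq_int r0 hr).
split; split.
- exact: (berezin_bounded_of_toeplitz alpha_gt0 kernel_sq_int).
(* Radius 2 gives boxes of half-side 1, the size on which the Carleson embedding rests. *)
- move=> /average_all/(_ 2 (ltr0n _ 2))/(box_bounded_of_average (ltr0n _ 2))[C].
  by rewrite divff// => /(toeplitz_bounded_of_box alpha_gt0 mu_sf).
- by move=> /average_all h1; exists 1 => //; exact: h1.
- exact: berezin_ex.
- by move=> /berezin_ex/average_all.
- by move=> h; exists 1 => //; exact: h.
Qed.
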